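(* Let $(G,d(\cdot))$ be an ESP such that $G\subset\mathbb{R}^J$ is the closure of a connected open set, $d(x)$ is a non-empty, non-zero, closed, convex cone with vertex at $0$ for $x\in\partial G$, $d(x)=\{0\}$ for $x\in G^\circ$, and the graph of $d(\cdot)$ is closed. Let $b:G\to\mathbb{R}^J$ and $\sigma:G\to\mathbb{R}^{J\times K}$ satisfy, with $a:=\sigma\sigma^T$: (i) there is $\tilde L<\infty$ with $|\sigma(x)-\sigma(y)|+|b(x)-b(y)|\le\tilde L|x-y|$ for all $x,y\in G$; (ii) there is $\lambda>0$ with $\sum_{i,j}a_{ij}(x)\xi_i\xi_j\ge\lambda|\xi|^2$ for all $\xi\in\mathbb{R}^J$, $x\in G$. Suppose there exist constants $L,R<\infty$ and $\beta>0$ such that \begin{enumerate} \item the ESP $(G,d(\cdot))$ satisfies the test function condition (defined in the context) with the constants $L,R,\beta$; \item $\displaystyle\sup_{x\in N_R(\mathcal{V})\cap G}\Big[\sum_{i,j=1}^J|a_{ij}(x)|\vee|b(x)|\Big]<\infty$; \item given an $\{\mathcal{F}_t\}$-adapted $K$-dimensional Brownian motion $W$, for every $z\in G$ there exists a strong Markov, strong solution $Z$ to the SDER associated with $(G,d(\cdot))$, $b$, $\sigma$, which has initial condition $z$ and satisfies, for every $t\in[0,\infty)$, $$\mathbb{E}_z\left[\int_0^{t\wedge\tau_0}\frac{\mathbf{1}_{(0,R]}(d(Z(s),\mathcal{V}))}{[d(Z(s),\mathcal{V})]^\beta}\,ds\right]<\infty,$$ where $\tau_0:=\inf\{t\ge0:Z(t)\in\mathcal{V}\}$.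 \end{enumerate} Then $Z(\cdot\wedge\tau_0)$ is an $\{\mathcal{F}_t\}$-semimartingale under $\mathbb{P}_z$.
   Context: Let $S_1(0)$ be the unit sphere in $\mathbb{R}^J$, $d^1(x):=d(x)\cap S_1(0)$, $\mathcal{V}:=\{x\in\partial G:\exists\,d\in S_1(0)\text{ with }\{d,-d\}\subseteq d^1(x)\}$ and $\mathcal{U}:=\partial G\setminus\mathcal{V}$. $d(x,A)$ is the Euclidean distance from $x$ to the set $A$ and $N_\delta(A)=\{y:d(y,A)\le\delta\}$. $\mathcal{C}^2(U)$ is the space of real functions twice continuously differentiable on some open set containing $U$; $\mathrm{supp}[g]$ is the support of $g$. Test function condition with constants $L,R<\infty$, $\beta>0$: there is $g\in\mathcal{C}^2(G^\circ\cup\mathcal{U})$ such that (1) $\mathrm{supp}[g]\subset N_R(\mathcal{V})$; (2) there exist $\theta>0$ and $r\in(0,R)$ such that (a) $\langle\nabla g(x),d\rangle\ge0$ for $d\in d^1(x)$, $x\in\mathcal{U}$, and (b) $\langle\nabla g(x),d\rangle\ge\theta$ for $d\in d^1(x)$, $x\in\mathcal{U}\cap N_r(\mathcal{V})$; (3) $\sup_{x\in G^\circ\cup\mathcal{U}}|g(x)|\vee|\nabla g(x)|\le L$ and for $x\in G^\circ\cup\mathcal{U}$, $\frac12\sum_{i,j=1}^J\left|\frac{\partial^2g(x)}{\partial x_i\partial x_j}\right|\le\frac{L}{[d(x,\mathcal{V})]^\beta}$. Probability setting: $((\Omega,\mathcal{F},\mathbb{P}),\{\mathcal{F}_t\})$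 is a complete filtered probability space with right-continuous filtration and $\mathcal{F}_0$ containing all null sets; $\mathbb{P}_z,\mathbb{E}_z$ denote probability and expectation conditioned on $Z(0)=z$. A continuous $\{\mathcal{F}_t\}$-adapted process $Z$ is a strong solution to the SDER associated with $(G,d(\cdot))$, $b$, $\sigma$ and $W$ if $\mathbb{P}$-a.s. for all $t\ge0$: $Z(t)\in G$ and $Z(t)=Z(0)+\int_0^tb(Z(s))\,ds+\int_0^t\sigma(Z(s))\cdot dW(s)+Y(t)$, where $Y(t)-Y(s)\in\overline{\mathrm{co}}[\cup_{u\in(s,t]}d(Z(u))]$ for all $0\le s\le t$ ($\overline{\mathrm{co}}$ is the closed convex hull). *)

(* Defs.v *)
From HB Require Import structures.
From mathcomp Require Import all_boot all_order all_algebra.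
From mathcomp Require Import all_classical all_reals all_analysis.
Set Implicit Arguments.
Unset Strict Implicit.
Unset Printing Implicit Defensive.
Import Order.TTheory GRing.Theory Num.Theory.
Import numFieldNormedType.Exports.
Local Open Scope classical_set_scope.
Local Open Scope ring_scope.

Section Euclid.
Context {R : realType}.

(* The library norm on matrices is the sup norm; its topology is the usual one
   and is used below, but every metric quantity is Euclidean (Frobenius). *)
Definition enorm m n (A : 'M[R]_(m, n)) : R :=
  Num.sqrt (\sum_i \sum_j A i j ^+ 2).

Definition edot n (u v : 'cV[R]_n) : R := \sum_i u i ord0 * v i ord0.

(* Valued in \bar R, so that the distance to the empty set is +oo. *)
Definition set_dist n (x : 'cV[R]_n) (A : set 'cV[R]_n) : \bar R :=
  ereal_inf [set (enorm (x - a))%:E | a in A].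

Definition nbhd n (delta : R) (A : set 'cV[R]_n) : set 'cV[R]_n :=
  [set y | (set_dist y A <= delta%:E)%E].

Definition bdry n (A : set 'cV[R]_n) : set 'cV[R]_n := closure A `\` A°.

Definition convex n (A : set 'cV[R]_n) : Prop :=
  convex_set (A : set (convex_lmodType 'cV[R]_n)).

Definition closed_convex_hull n (A : set 'cV[R]_n) : set 'cV[R]_n :=
  smallest [set C | closed C /\ convex C] A.

Definition cone n (C : set 'cV[R]_n) : Prop :=
  forall (a : R) v, 0 <= a -> C v -> C (a *: v).

Definition partial n (i : 'I_n) (g : 'cV[R]_n -> R) : 'cV[R]_n -> R :=
  fun x => 'D_(delta_mx i ord0) g x.

Definition grad n (g : 'cV[R]_n -> R) (x : 'cV[R]_n) : 'cV[R]_n :=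
  \col_i partial i g x.

Definition C2 n (U : set 'cV[R]_n) (g : 'cV[R]_n -> R) : Prop :=
  exists2 O : set 'cV[R]_n, open O /\ U `<=` O & forall x, O x ->
    [/\ {for x, continuous g},
        forall i, derivable g x (delta_mx i ord0) /\
                  {for x, continuous (partial i g)} &
        forall i j, derivable (partial j g) x (delta_mx i ord0) /\
                    {for x, continuous (partial i (partial j g))}].

(* Support of g regarded as a function on U. *)
Definition supp n (U : set 'cV[R]_n) (g : 'cV[R]_n -> R) : set 'cV[R]_n :=
  closure [set x | U x /\ g x != 0].

End Euclid.

Section ESP.
Context {R : realType} {J : nat}.
Variables (G : set 'cV[R]_J) (d : 'cV[R]_J -> set 'cV[R]_J).

(* The values of d outside G are irrelevant. *)
Definition ESP : Prop :=
  [/\ exists O, [/\ open O, connected O & G = closure O],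
      forall x, bdry G x ->
        [/\ d x !=set0, d x <> [set 0], closed (d x), convex (d x) & cone (d x)],
      forall x, G° x -> d x = [set 0] &
      closed [set p : 'cV[R]_J * 'cV[R]_J | G p.1 /\ d p.1 p.2]].

Definition d1 (x : 'cV[R]_J) : set 'cV[R]_J :=
  d x `&` [set v | enorm v = 1].

Definition Vset : set 'cV[R]_J :=
  [set x | bdry G x /\ exists2 v, enorm v = 1 & d1 x v /\ d1 x (- v)].

Definition Uset : set 'cV[R]_J := bdry G `\` Vset.

(* When Vset is empty the distance is +oo and L / (+oo)^beta = 0. *)
Definition test_function_condition (L rad beta : R) : Prop :=
  let D := G° `|` Uset in
  exists g : 'cV[R]_J -> R,
  [/\ C2 D g,
      supp D g `<=` nbhd rad Vset,
      exists theta r : R,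
        [/\ 0 < theta, 0 < r < rad,
            forall x v, Uset x -> d1 x v -> 0 <= edot (grad g x) v &
            forall x v, (Uset `&` nbhd r Vset) x -> d1 x v ->
              theta <= edot (grad g x) v],
      (ereal_sup [set (Num.max `|g x| (enorm (grad g x)))%:E | x in D]
         <= L%:E)%E &
      forall x, D x ->
        ((2^-1 * \sum_i \sum_j `|partial i (partial j g) x|)%:E <=
         L%:E * (poweR (set_dist x Vset) beta)^-1)%E].

End ESP.

Section Processes.
Context {R : realType} {disp : measure_display} {Omega : measurableType disp}.
Variables (P : probability Omega R) (F : R -> set (set Omega)).

(* Time is the half-line t >= 0 of R: values at negative times, of filtrations
   and of processes alike, are irrelevant.  Path properties are required up to
   a P-null set, which is harmless since F 0 contains all null sets. *)

Definition usual_filtration : Prop :=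
  [/\ forall t, 0 <= t -> sigma_algebra setT (F t) /\ F t `<=` measurable,
      forall s t, 0 <= s -> s <= t -> F s `<=` F t,
      forall t, 0 <= t -> \bigcap_(s in [set s | t < s]) F s `<=` F t &
      forall N, P.-negligible N -> F 0 N].

Definition adapted m n (X : R -> Omega -> 'M[R]_(m, n)) : Prop :=
  forall t, 0 <= t -> forall i j B, measurable B ->
    F t [set w | B (X t w i j)].

Definition continuous_paths m n (X : R -> Omega -> 'M[R]_(m, n)) : Prop :=
  \forall w \ae P, {within `[0, +oo[, continuous (fun t => X t w)}.

Definition real_adapted (X : R -> Omega -> R) : Prop :=
  forall t, 0 <= t -> forall B, measurable B -> F t (X t @^-1` B).

Definition cadlag_paths (X : R -> Omega -> R) : Prop :=
  \forall w \ae P,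
    (forall t, 0 <= t -> X s w @[s --> t^'+] --> X t w) /\
    (forall t, 0 < t -> cvg (X s w @[s --> t^'-])).

Definition stopping_time (tau : Omega -> \bar R) : Prop :=
  (forall w, (0 <= tau w)%E) /\
  forall t, 0 <= t -> F t [set w | (tau w <= t%:E)%E].

Definition stopping_field (tau : Omega -> \bar R) : set (set Omega) :=
  [set A | measurable A /\
    forall t, 0 <= t -> F t (A `&` [set w | (tau w <= t%:E)%E])].

(* t /\ tau, a real number as long as 0 <= tau. *)
Definition tmin (t : R) (tau : \bar R) : R := fine (Order.min t%:E tau).

Definition stopped T (X : R -> Omega -> T) (tau : Omega -> \bar R) :
  R -> Omega -> T := fun t w => X (tmin t (tau w)) w.

Definition hitting_time n (A : set 'cV[R]_n) (X : R -> Omega -> 'cV[R]_n)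
    (w : Omega) : \bar R :=
  ereal_inf [set t%:E | t in [set t : R | 0 <= t /\ A (X t w)]].

(* The last clause is E[X_t | F_s] = X_s. *)
Definition martingale (X : R -> Omega -> R) : Prop :=
  [/\ real_adapted X,
      forall t, 0 <= t -> P.-integrable setT (fun w => (X t w)%:E) &
      forall s t, 0 <= s -> s <= t -> forall A, F s A ->
        (\int[P]_(w in A) (X t w)%:E = \int[P]_(w in A) (X s w)%:E)%E].

Definition local_martingale0 (M : R -> Omega -> R) : Prop :=
  [/\ real_adapted M, cadlag_paths M, (\forall w \ae P, M 0 w = 0) &
      exists T : nat -> Omega -> \bar R,
        [/\ forall n, stopping_time (T n),
            \forall w \ae P, (forall n, (T n w <= T n.+1 w)%E) /\
                             T n w @[n --> \oo] --> +oo%E &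
            forall n, martingale (stopped M (T n))]].

Definition finite_variation0 (A : R -> Omega -> R) : Prop :=
  [/\ real_adapted A, cadlag_paths A, (\forall w \ae P, A 0 w = 0) &
      \forall w \ae P, forall t, 0 <= t ->
        bounded_variation 0 t (fun s => A s w)].

Definition real_semimartingale (X : R -> Omega -> R) : Prop :=
  real_adapted X /\ exists M A : R -> Omega -> R,
    [/\ local_martingale0 M, finite_variation0 A &
        \forall w \ae P, forall t, 0 <= t -> X t w = X 0 w + M t w + A t w].

Definition semimartingale n (X : R -> Omega -> 'cV[R]_n) : Prop :=
  forall i, real_semimartingale (fun t w => X t w i ord0).

(* Increments over [s, t] are N(0, (t - s) I), independently of F s;
   the library's normal_prob takes the standard deviation. *)
Definition brownian_motion K (W : R -> Omega -> 'cV[R]_K) : Prop :=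
  [/\ adapted W, continuous_paths W, (\forall w \ae P, W 0 w = 0) &
      forall s t, 0 <= s -> s < t -> forall A (B : 'I_K -> set R), F s A ->
        (forall k, measurable (B k)) ->
        (P (A `&` [set w | forall k, B k ((W t w - W s w)%R k ord0)]) =
         P A * \prod_(k < K) normal_prob 0 (Num.sqrt (t - s)%R) (B k))%E].

(* The simple process with value sp_coef i on ]sp_time i, sp_time i.+1],
   for i < sp_size, and 0 elsewhere. *)
Record simple_process J K := SimpleProcess {
  sp_size : nat;
  sp_time : nat -> R;
  sp_coef : nat -> Omega -> 'M[R]_(J, K);
  sp_time_ge0 : 0 <= sp_time 0;
  sp_time_le : forall i, sp_time i <= sp_time i.+1;
  sp_coef_meas : forall i k l B, measurable B ->
    F (sp_time i) [set w | B (sp_coef i w k l)];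
  sp_coef_bounded : exists C, forall i w, enorm (sp_coef i w) <= C }.

Definition sp_val J K (S : simple_process J K) (t : R) (w : Omega) :
    'M[R]_(J, K) :=
  \sum_(i < sp_size S)
    (\1_(`]sp_time S i, sp_time S i.+1]) t : R) *: sp_coef S i w.

Definition sp_integral J K (S : simple_process J K)
    (W : R -> Omega -> 'cV[R]_K) (t : R) (w : Omega) : 'cV[R]_J :=
  \sum_(i < sp_size S) sp_coef S i w *m
    (W (Num.min (sp_time S i.+1) t) w - W (Num.min (sp_time S i) t) w).

Definition cvg0_in_probability (X : nat -> Omega -> \bar R) : Prop :=
  forall e : R, 0 < e ->
    P [set w | (e%:E < X n w)%E] @[n --> \oo] --> 0%E.

(* I_t = \int_0^t H_s . dW_s: as usual, I is the limit in probability, uniformly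
   on compact time intervals, of the integrals of simple processes S n with
   \int_0^T |S n - H|^2 ds --> 0 in probability.  This determines I up to
   indistinguishability. *)
Definition ito_integral J K (W : R -> Omega -> 'cV[R]_K)
    (H : R -> Omega -> 'M[R]_(J, K)) (I : R -> Omega -> 'cV[R]_J) : Prop :=
  [/\ adapted I, continuous_paths I &
      exists S : nat -> simple_process J K, forall T : R, 0 < T ->
        cvg0_in_probability (fun n w =>
          \int[lebesgue_measure]_(s in `[0%R, T])
            ((enorm (sp_val (S n) s w - H s w)) ^+ 2)%:E)%E /\
        cvg0_in_probability (fun n w =>
          ereal_sup [set (enorm (sp_integral (S n) W t w - I t w))%:E
                    | t in `[0, T]])].

(* Y t - Y s is constrained for s < t only: for s = t the union is empty while
   the increment is 0. *)
Definition SDER_strong_solution J K (G : set 'cV[R]_J)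
    (d : 'cV[R]_J -> set 'cV[R]_J) (b : 'cV[R]_J -> 'cV[R]_J)
    (sigma : 'cV[R]_J -> 'M[R]_(J, K)) (W : R -> Omega -> 'cV[R]_K)
    (Z : R -> Omega -> 'cV[R]_J) : Prop :=
  [/\ adapted Z, continuous_paths Z &
      exists I Y : R -> Omega -> 'cV[R]_J,
        ito_integral W (fun s w => sigma (Z s w)) I /\
        \forall w \ae P, forall t, 0 <= t ->
          [/\ G (Z t w),
              Z t w = Z 0 w
                + \col_i Rintegral lebesgue_measure `[0, t]
                           (fun s => b (Z s w) i ord0)
                + I t w + Y t w &
              forall s, 0 <= s -> s < t ->
                closed_convex_hull
                  (\bigcup_(u in [set u | s < u <= t]) d (Z u w))
                  (Y t w - Y s w)]].

Definition borel n := g_sigma_algebraType (@open 'cV[R]_n).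

(* Time-homogeneous strong Markov property with respect to F, with transition
   function p: P(X_(tau+t) \in B | F_tau) = p_t(X_tau, B) on {tau < oo}. *)
Definition strong_markov n (X : R -> Omega -> 'cV[R]_n) : Prop :=
  exists p : R -> R.-pker borel n ~> borel n,
  forall tau, stopping_time tau -> forall t, 0 <= t ->
  forall B : set (borel n), measurable B ->
  forall A, stopping_field tau A ->
    (P (A `&` [set w | tau w < +oo] `&` [set w | B (X (fine (tau w) + t)%R w)])
     = \int[P]_(w in A `&` [set w | tau w < +oo])
         p t (X (fine (tau w)) w : borel n) B)%E.

End Processes.

(* 1_(0,rad](dist) / dist^beta *)
Definition singular_weight (R : realType) (rad beta : R) (dist : \bar R) :
    \bar R :=
  if (0 < dist <= rad%:E)%E then (poweR dist beta)^-1%E else 0%E.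

Definition lipschitz_coefficients (R : realType) J K (G : set 'cV[R]_J)
    (b : 'cV[R]_J -> 'cV[R]_J) (sigma : 'cV[R]_J -> 'M[R]_(J, K)) : Prop :=
  exists Lt : R, forall x y, G x -> G y ->
    enorm (sigma x - sigma y) + enorm (b x - b y) <= Lt * enorm (x - y).

Definition diffusion_matrix (R : realType) J K
    (sigma : 'cV[R]_J -> 'M[R]_(J, K)) (x : 'cV[R]_J) : 'M[R]_J :=
  sigma x *m (sigma x)^T.

Definition uniformly_elliptic (R : realType) J (G : set 'cV[R]_J)
    (a : 'cV[R]_J -> 'M[R]_J) : Prop :=
  exists2 lambda : R, 0 < lambda & forall (xi x : 'cV[R]_J), G x ->
    lambda * enorm xi ^+ 2 <= \sum_i \sum_j a x i j * xi i ord0 * xi j ord0.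

(* Main.v *)
Require Import Defs.
From HB Require Import structures.
From mathcomp Require Import all_boot all_order all_algebra.
From mathcomp Require Import all_classical all_reals all_analysis.
From mathcomp Require Import measurable_realfun normal_distribution ring lra.
Import Order.TTheory GRing.Theory Num.Theory.
Import numFieldNormedType.Exports.
Local Open Scope classical_set_scope.
Local Open Scope ring_scope.
Import HBSimple HBNNSimple.
Set Implicit Arguments.
Unset Strict Implicit.
Unset Printing Implicit Defensive.

(** Up to the hitting time [tau0] of [V = Vset G d] the solution is the sum of its
    initial value, the drift, the stochastic integral [I] and the pushing term [Y].
    Stopped at the exit times of balls, [I] is an L2 martingale, and the drift is
    locally Lipschitz along each path. Everything thus rests on the variation of [Y] on
    the closed interval up to [tau0], the hitting time included.

    At a point [x] outside [V] the cone [d x] contains no line, so some [p] pairs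
    strictly positively with all its unit vectors; as the graph of [d] is closed,
    the same [p] works for the cones at all points near [x] ([cone_separation]).
    Over short times the increments of [Y] then lie in the half-space cone
    [c * enorm v <= edot p v] ([hull_halfspace]), and the variation of [Y] is
    dominated by a telescoping sum ([bv_on_cone]). By compactness the variation is
    finite on every compact interval before [tau0]; it could still blow up at [tau0].

    Close to [V] the test function [g] replaces the vector [p], at the price that
    its second derivatives explode like [dist ^ - beta]. While the path stays in a
    compact piece of the punctured neighbourhood of [V], a second order expansion
    over one step of a time grid gives ([near_step])
      theta / 4 |dY| <= dg - <grad g, dI> + L |db| + C(Z) (4 |dI|^2 + 4 |db|^2),
    with [C] of the order of [1 + dist ^ - beta]: the gradient gains [theta |dY|] on
    reflection directions, and the term quadratic in [dY] is absorbed since [dY] is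
    small compared with [1 / C]. Sum over the grid and take expectations. The
    increments of [g] telescope and [g] is bounded; the terms linear in [dI] have mean
    zero and [|dI|^2] has conditional mean of the order of the time step
    ([ito_incr_cond_mean], [ito_incr_cond_sq]), the diffusion coefficient being bounded
    near [V]; what remains is a Riemann sum of [C(Z)], controlled by the time integral
    of [dist ^ - beta], whose expectation is finite by assumption. The expected
    variation seen by the grid is therefore bounded by a constant that depends neither
    on the grid nor on the compact piece ([near_variation_Ex]). Refining the grid, then
    exhausting the punctured neighbourhood, Fatou's lemma bounds the variation of [Y]
    over any stretch of time, starting before [tau0], that the path spends near [V]
    ([near_bounded]). A path that hits [V] is near [V] just before, so the variation is
    finite up to [tau0] ([reflection_bv]).

    Along a grid only the conditional moments of the increments of [I] enter. They
    are derived from the definition of [I] as a limit of simple integrals, stopped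
    when their energy is too large ([ito_incr_moments]). *)

(** * Sub-sigma-algebras and expectations *)

Section SimpleDensity.
Context {R : realType} {disp : measure_display} {T : measurableType disp}.
Variable mu : {measure set T -> \bar R}.

Lemma integral_cvg_monotoneM (f : nat -> T -> R) (h Z : T -> R) :
  (forall n, measurable_fun setT (f n)) -> (forall n w, 0 <= f n w) ->
  (forall w, nondecreasing_seq (f ^~ w)) ->
  (forall w, f n w @[n --> \oo] --> h w) ->
  measurable_fun setT Z -> (forall w, 0 <= Z w) ->
  (\int[mu]_w (f n w * Z w)%:E)%E @[n --> \oo] --> (\int[mu]_w (h w * Z w)%:E)%E.
Proof.
move=> mf f0 fnd fh mZ Z0.
have -> : (\int[mu]_w (h w * Z w)%:E =
    \int[mu]_w limn (fun n => (f n w * Z w)%:E))%E.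
  apply: eq_integral => w _; apply/esym/cvg_lim => //.
  by apply: cvg_EFin; [exact: nearW|apply: cvgMl].
apply: cvg_monotone_convergence => //.
- by move=> n; apply/measurable_EFinP/measurable_funM.
- by move=> n w _; rewrite lee_fin mulr_ge0.
- by move=> w _ a b ab; rewrite lee_fin ler_wpM2r// fnd.
Qed.

Lemma integral_simpleM (f Z : T -> R) : finite_set (range f) ->
  measurable_fun setT f -> (forall w, 0 <= f w) ->
  measurable_fun setT Z -> (forall w, 0 <= Z w) ->
  (\int[mu]_w (f w * Z w)%:E = \sum_(y \in range f)
     y%:E * \int[mu]_(w in f @^-1` [set y]) (Z w)%:E)%E.
Proof.
move=> ffin mf f0 mZ Z0.
have my y : measurable (f @^-1` [set y]) by rewrite -[_ @^-1` _]setTI; exact: mf.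
have -> : (\int[mu]_w (f w * Z w)%:E = \int[mu]_w \sum_(y \in range f)
    (y * \1_(f @^-1` [set y]) w * Z w)%:E)%E.
  apply: eq_integral => w _; rewrite fsumEFin//; congr (_%:E).
  rewrite -(@mulr_fsuml _ _ (Z w) _ (fun y => y * \1_(f @^-1` [set y]) w)).
  congr (_ * _); rewrite (fsbigD1 (f w))//=; last by exists w.
  rewrite indicE mem_set//= mulr1 fsbig1 ?addr0// => y [_ /= fy].
  by rewrite indicE memNset ?mulr0//= => fwy; apply: fy.
rewrite ge0_integral_fsum//; last first.
- move=> y w _; rewrite lee_fin mulr_ge0//.
  rewrite indicE; case: (boolP (w \in _)); rewrite ?mulr0// mulr1.
  by move=> /set_mem <-.
- move=> y; apply/measurable_EFinP/measurable_funM => //.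
  by apply: measurable_funM => //; exact: measurable_indic.
apply: eq_fsbigr => y /set_mem [w0 _ yE].
have y0 : 0 <= y by rewrite -yE.
under eq_integral => w _ do rewrite -mulrA EFinM.
rewrite ge0_integralZl//; last first.
- by move=> w _; rewrite lee_fin mulr_ge0.
- by apply/measurable_EFinP/measurable_funM => //; exact: measurable_indic.
congr (_ * _)%E.
rewrite [RHS]integral_mkcond; apply: eq_integral => w _.
by rewrite epatch_indic /= muleC EFinM.
Qed.

End SimpleDensity.

(** Both sides are limits along simple functions increasing to [h], on which they
    agree by assumption. *)
Lemma ge0_integral_density {R : realType} {disp : measure_display}
    {T : measurableType disp} (mu nu : {measure set T -> \bar R}) (h Z : T -> R) :
  measurable_fun setT h -> (forall w, 0 <= h w) ->
  measurable_fun setT Z -> (forall w, 0 <= Z w) ->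
  (forall A, measurable A -> nu A = (\int[mu]_(w in A) (Z w)%:E)%E) ->
  (\int[nu]_w (h w)%:E = \int[mu]_w (h w * Z w)%:E)%E.
Proof.
move=> mh h0 mZ Z0 nuE.
have mh' : measurable_fun setT (EFin \o h) by exact/measurable_EFinP.
pose fs := nnsfun_approx measurableT mh'.
pose f n (w : T) : R := fs n w.
have mf n : measurable_fun [set: T] (f n) by exact: measurable_funP.
have f0 n w : 0 <= f n w by exact: fun_ge0.
have ffin n : finite_set (range (f n)) by exact: (fimfunP (fs n)).
have fnd w : nondecreasing_seq (f ^~ w).
  by move=> a b ab; have /lefP := nd_nnsfun_approx measurableT mh' ab; apply.
have fh w : f n w @[n --> \oo] --> h w.
  apply: (@fine_cvg _ _ _ _ (fun n => (f n w)%:E)); apply: (@cvg_nnsfun_approx _ T R setT measurableT _ mh' _ w) => // w' _.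
  by rewrite lee_fin.
have c1 := integral_cvg_monotoneM mf f0 fnd fh mZ Z0 (mu := mu).
have c2 := integral_cvg_monotoneM mf f0 fnd fh (@measurable_cst _ _ T R setT 1) (fun=> ler01) (mu := nu).
have -> : (\int[nu]_w (h w)%:E = \int[nu]_w (h w * 1)%:E)%E.
  by apply: eq_integral => w _; rewrite mulr1.
rewrite -(cvg_lim _ c1)// -(cvg_lim _ c2)//; congr (limn _).
apply/funext => n; rewrite !integral_simpleM//.
apply: eq_fsbigr => y _; congr (_ * _)%E.
have my : measurable (f n @^-1` [set y]) by rewrite -[_ @^-1` _]setTI; exact: mf.
transitivity (\int[nu]_(w in f n @^-1` [set y]) (cst 1%:E) w)%E => //.
by rewrite integral_cst// mul1e nuE.
Qed.

Section SubSigmaAlgebra.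
Context {R : realType} {disp : measure_display} {Omega : measurableType disp}.
Variables (P : probability Omega R) (G : set (set Omega)).
Hypothesis sG : sigma_algebra setT G.
Hypothesis Gm : G `<=` measurable.

(** Measurability with respect to [G], which need not be the sigma-algebra of the
    type: filtrations are families of sets of sets. *)
Definition smeas (f : Omega -> R) : Prop :=
  @measurable_fun _ _ (g_sigma_algebraType G) R setT f.

Lemma measurable_subsigma (A : set Omega) :
  @measurable _ (g_sigma_algebraType G) A <-> G A.
Proof. by rewrite (@measurable_g_measurableTypeE Omega G sG). Qed.

Lemma smeasP f : smeas f <-> forall B, measurable B -> G (f @^-1` B).
Proof.
split=> [mf B mB|Gf _ B mB].
  by apply/measurable_subsigma; rewrite -[_ @^-1` _]setTI; exact: mf.
by rewrite setTI; apply/measurable_subsigma; exact: Gf.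
Qed.

Lemma smeas_measurable f : smeas f -> measurable_fun setT f.
Proof. by move=> /smeasP Gf _ B mB; rewrite setTI; exact/Gm/Gf. Qed.

Lemma subsigmaT : G setT.
Proof. by rewrite -measurable_subsigma; exact: measurableT. Qed.

Lemma subsigmaC A : G A -> G (~` A).
Proof. by rewrite -!measurable_subsigma => mA; exact: measurableC. Qed.

Lemma subsigmaI A B : G A -> G B -> G (A `&` B).
Proof. by rewrite -!measurable_subsigma => mA mB; exact: measurableI. Qed.

Lemma subsigma_bigcupT I (A : I -> set Omega) : countable [set: I] ->
  (forall i, G (A i)) -> G (\bigcup_i A i).
Proof.
move=> cI GA; apply/measurable_subsigma.
apply: (@countable_bigcupT_measurable _ (g_sigma_algebraType G)) => // i.
exact/measurable_subsigma.
Qed.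

Lemma subsigma_bigcapT I (A : I -> set Omega) : countable [set: I] ->
  (forall i, G (A i)) -> G (\bigcap_i A i).
Proof.
move=> cI GA; rewrite -[X in G X]setCK setC_bigcap; apply/subsigmaC.
by apply: subsigma_bigcupT => // i; exact: subsigmaC.
Qed.

Lemma smeas_indic A : G A -> smeas \1_A.
Proof. by move=> GA; apply: measurable_indic; exact/measurable_subsigma. Qed.

(** The inequality says that [E[X | G] <= E[Y | G]]. Conditional expectations are
    used only in this form, tested on the sets of [G] and extended to nonnegative
    [G]-measurable weights by simple approximation. *)
Lemma le_integral_subsigma (h X Y : Omega -> R) :
  smeas h -> (forall w, 0 <= h w) ->
  measurable_fun setT X -> measurable_fun setT Y ->
  (forall w, 0 <= X w) -> (forall w, 0 <= Y w) ->
  (forall A, G A -> (\int[P]_(w in A) (X w)%:E <= \int[P]_(w in A) (Y w)%:E)%E) ->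
  (\int[P]_w (h w * X w)%:E <= \int[P]_w (h w * Y w)%:E)%E.
Proof.
move=> mh h0 mX mY X0 Y0 XY.
have mh' : @measurable_fun _ _ (g_sigma_algebraType G) _ setT (EFin \o h).
  exact/measurable_EFinP.
pose fs := nnsfun_approx measurableT mh'.
pose f n (w : Omega) : R := fs n w.
have mf n : measurable_fun [set: Omega] (f n).
  by apply: smeas_measurable; exact: measurable_funP.
have f0 n w : 0 <= f n w by exact: fun_ge0.
have ffin n : finite_set (range (f n)) by exact: (fimfunP (fs n)).
have fnd w : nondecreasing_seq (f ^~ w).
  by move=> a b ab; have /lefP := nd_nnsfun_approx measurableT mh' ab; apply.
have fh w : f n w @[n --> \oo] --> h w.
  apply: (@fine_cvg _ _ _ _ (fun n => (f n w)%:E)); apply: (@cvg_nnsfun_approx _ (g_sigma_algebraType G) R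
    setT measurableT _ mh' _ w) => // w' _.
  by rewrite lee_fin.
have cX := integral_cvg_monotoneM mf f0 fnd fh mX X0 (mu := P).
have cY := integral_cvg_monotoneM mf f0 fnd fh mY Y0 (mu := P).
rewrite -(cvg_lim _ cX)// -(cvg_lim _ cY)//.
apply: (lee_lim (cvgP _ cX) (cvgP _ cY)).
apply: nearW => n; rewrite !integral_simpleM//.
apply: lee_fsum => // y [w0 _ <-].
apply: lee_wpmul2l; first by rewrite lee_fin.
apply: XY; have /smeasP := @measurable_funP _ _ (g_sigma_algebraType G) R setT (fs n).
by apply.
Qed.

Hypothesis GN : forall N, P.-negligible N -> G N.

Lemma subsigma_ae A B : G B -> (\forall w \ae P, A w <-> B w) -> G A.
Proof.
move=> GB AB; set N := ~` [set w | A w <-> B w].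
have GNN : G N by exact: GN.
have GAN : G (A `&` N).
  by apply: GN; apply: negligibleS AB => w [].
have -> : A = (B `&` ~` N) `|` (A `&` N).
  apply/seteqP; split=> w.
    move=> Aw; have [Nw|Nw] := pselect (N w); first by right.
    by left; split=> //; move: Nw => /contrapT /= [+ _]; exact.
  by move=> [[Bw /contrapT /= [_]]|[]//]; exact.
rewrite -!measurable_subsigma in GB GNN GAN *.
by apply: measurableU => //; apply: measurableI => //; exact: measurableC.
Qed.

Lemma smeas_ae f g : smeas g -> (\forall w \ae P, f w = g w) -> smeas f.
Proof.
move=> /smeasP Gg fg; apply/smeasP => B mB.
apply: (subsigma_ae (Gg _ mB)); apply: filterS fg => w /= fgw.
by rewrite /preimage /= fgw.
Qed.

(** Setting the sequence to zero where it diverges, a [G]-measurable null set, turns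
    the convergence into convergence everywhere. *)
Lemma smeas_cvg_ae (f : nat -> Omega -> R) (g : Omega -> R) :
  (forall n, smeas (f n)) ->
  (\forall w \ae P, f n w @[n --> \oo] --> g w) -> smeas g.
Proof.
move=> mf fg; set N := ~` [set w | f n w @[n --> \oo] --> g w].
have GNN : G N by exact: GN.
have mN : smeas \1_(~` N) by apply: smeas_indic; apply: subsigmaC.
apply: (@smeas_ae _ (fun w => g w * \1_(~` N) w)); last first.
  apply: filterS fg => w fgw; rewrite indicE mem_set /= ?mulr1//.
apply: (@measurable_fun_cvg _ (g_sigma_algebraType G) R setT
  (fun n w => f n w * \1_(~` N) w)) => [n|w _].
  apply: (@measurable_funM _ (g_sigma_algebraType G) R setT (f n)) => //.
  exact: mf.
rewrite indicE; have [Nw|Nw] := pselect (N w).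
  by rewrite memNset ?mulr0; [under eq_fun do rewrite mulr0; exact: cvg_cst
    | apply].
rewrite mem_set//= mulr1; under eq_fun do rewrite mulr1.
exact: contrapT Nw.
Qed.

End SubSigmaAlgebra.

Section Expectation.
Context {R : realType} {disp : measure_display} {Omega : measurableType disp}.
Variable P : probability Omega R.

Definition rint (f : Omega -> R) : Prop := P.-integrable setT (EFin \o f).
Definition Ex (f : Omega -> R) : R := Rintegral P setT f.

Lemma rint_measurable f : rint f -> measurable_fun setT f.
Proof. by move=> /integrableP[/measurable_EFinP]. Qed.

Lemma ExE f : rint f -> (\int[P]_w (f w)%:E)%E = (Ex f)%:E.
Proof. by move=> If; rewrite /Ex /Rintegral fineK//; exact: integrable_fin_num. Qed.

Lemma rintD f g : rint f -> rint g -> rint (fun w => f w + g w).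
Proof.
move=> If Ig; have := integrableD measurableT If Ig.
by apply: eq_integrable => // w _; rewrite /= EFinD.
Qed.

Lemma rintZ c f : rint f -> rint (fun w => c * f w).
Proof.
move=> If; have := integrableZl measurableT c If.
by apply: eq_integrable => // w _; rewrite /= EFinM.
Qed.

Lemma rintN f : rint f -> rint (fun w => - f w).
Proof.
move=> /(rintZ (-1)); apply: eq_integrable => // w _; congr EFin.
by rewrite mulN1r.
Qed.

Lemma rintB f g : rint f -> rint g -> rint (fun w => f w - g w).
Proof. by move=> If Ig; apply: rintD => //; exact: rintN. Qed.

Lemma rint_cst c : rint (fun=> c).
Proof.
apply/integrableP; split; first exact/measurable_EFinP.
by rewrite integral_cst//= probability_setT mule1 ltry.
Qed.

Lemma rint_sum (I : Type) (s : seq I) (Q : pred I) (f : I -> Omega -> R) :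
  (forall i, Q i -> rint (f i)) -> rint (fun w => \sum_(i <- s | Q i) f i w).
Proof.
move=> If; have := integrable_sum measurableT s If.
by apply: eq_integrable => // w _; rewrite /= sumEFin.
Qed.

Lemma rint_le (f g : Omega -> R) : measurable_fun setT f -> (forall w, `|f w| <= g w) ->
  rint g -> rint f.
Proof.
move=> mf fg Ig; apply: (le_integrable measurableT) Ig.
  exact/measurable_EFinP.
by move=> w _; rewrite /= lee_fin (le_trans (fg w))// ler_norm.
Qed.

Lemma rint_bounded (f : Omega -> R) c : measurable_fun setT f -> (forall w, `|f w| <= c) ->
  rint f.
Proof. by move=> mf fc; apply: (rint_le mf fc); exact: rint_cst. Qed.

Lemma rint_sqM (f g : Omega -> R) : measurable_fun setT f -> measurable_fun setT g ->
  rint (fun w => f w ^+ 2) -> rint (fun w => g w ^+ 2) ->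
  rint (fun w => f w * g w).
Proof.
move=> mf mg If Ig; apply: (@rint_le _ (fun w => f w ^+ 2 + g w ^+ 2)).
- exact: measurable_funM.
- move=> w; have := sqr_ge0 (`|f w| - `|g w|).
  rewrite normrM sqrrB !real_normK ?num_real// => h.
  have := sqr_ge0 (f w); have := sqr_ge0 (g w).
  have := normr_ge0 (f w); have := normr_ge0 (g w).
  by nra.
- exact: rintD.
Qed.

Lemma rint_sq (f : Omega -> R) : measurable_fun setT f -> rint (fun w => f w ^+ 2) -> rint f.
Proof.
move=> mf If; have -> : f = (fun w => f w * (fun=> 1) w).
  by apply/funext => w; rewrite mulr1.
apply: rint_sqM => //; exact: rint_cst.
Qed.

Lemma rint_ge0 (f : Omega -> R) : measurable_fun setT f -> (forall w, 0 <= f w) ->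
  (\int[P]_w (f w)%:E < +oo)%E -> rint f.
Proof.
move=> mf f0 fy; apply/integrableP; split; first exact/measurable_EFinP.
by under eq_integral do rewrite /= ger0_norm//.
Qed.

Lemma ExD f g : rint f -> rint g -> Ex (fun w => f w + g w) = Ex f + Ex g.
Proof. exact: RintegralD. Qed.

Lemma ExZ c f : rint f -> Ex (fun w => c * f w) = c * Ex f.
Proof. exact: RintegralZl. Qed.

Lemma ExN f : rint f -> Ex (fun w => - f w) = - Ex f.
Proof.
move=> If; rewrite -mulN1r -ExZ//; congr Ex; apply/funext => w.
by rewrite mulN1r.
Qed.

Lemma ExB f g : rint f -> rint g -> Ex (fun w => f w - g w) = Ex f - Ex g.
Proof. exact: RintegralB. Qed.

Lemma Ex_cst c : Ex (fun=> c) = c.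
Proof. by rewrite /Ex /Rintegral integral_cst//= probability_setT mule1. Qed.

Lemma Ex_sum (I : eqType) (s : seq I) (f : I -> Omega -> R) :
  (forall i, i \in s -> rint (f i)) ->
  Ex (fun w => \sum_(i <- s) f i w) = \sum_(i <- s) Ex (f i).
Proof.
elim: s => [|i s IH] If.
  by under eq_fun do rewrite big_nil; rewrite big_nil Ex_cst.
under eq_fun do rewrite big_cons.
rewrite big_cons ExD ?IH//.
- by move=> j js; apply: If; rewrite inE js orbT.
- by apply: If; rewrite inE eqxx.
- rewrite (_ : (fun w => _) = (fun w => \sum_(j <- s | j \in s) f j w)).
    by apply: rint_sum => j js; apply: If; rewrite inE js orbT.
  by apply/funext => w; rewrite -big_seq.
Qed.

Lemma Ex_ae (f g : Omega -> R) : rint f -> rint g -> (\forall w \ae P, f w <= g w) ->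
  Ex f <= Ex g.
Proof.
move=> If Ig fg; rewrite -lee_fin -!ExE// -sube_ge0 ?integrable_fin_num//.
rewrite -integralB_EFin//.
rewrite (@ae_eq_integral _ _ _ _ _ (fun w => (Num.max 0 (g w - f w))%:E))//.
- by apply: integral_ge0 => w _; rewrite lee_fin le_max lexx.
- apply/measurable_EFinP/measurable_funB; exact: rint_measurable.
- apply/measurable_EFinP/(@measurable_maxr _ _ _ _ (cst 0)) => //.
  by apply/measurable_funB; exact: rint_measurable.
- apply: filterS fg => w fgw _; rewrite -EFinB; congr EFin.
  by rewrite max_r// subr_ge0.
Qed.

Lemma Ex_le (f g : Omega -> R) : rint f -> rint g -> (forall w, f w <= g w) -> Ex f <= Ex g.
Proof. by move=> If Ig fg; apply: Ex_ae => //; exact: aeW. Qed.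

Lemma Ex_ge0 (f : Omega -> R) : (forall w, 0 <= f w) -> 0 <= Ex f.
Proof. by move=> f0; apply: Rintegral_ge0. Qed.

Lemma rint_indicM A (f : Omega -> R) : measurable A -> rint f -> rint (fun w => \1_A w * f w).
Proof.
move=> mA If; apply: (@rint_le _ (fun w => `|f w|)).
- by apply: measurable_funM; [exact: measurable_indic|exact: rint_measurable].
- move=> w; rewrite normrM indicE; case: (_ \in _) => //=.
    by rewrite normr1 mul1r.
  by rewrite normr0 mul0r.
- exact: integrable_abse If.
Qed.

Lemma Ex_indicM A (f : Omega -> R) : measurable A ->
  (\int[P]_(w in A) (f w)%:E = \int[P]_w (\1_A w * f w)%:E)%E.
Proof.
move=> mA; rewrite integral_mkcond; apply: eq_integral => w _.
by rewrite epatch_indic /= muleC EFinM.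
Qed.

End Expectation.

Section CondExpectation.
Context {R : realType} {disp : measure_display} {Omega : measurableType disp}.
Variables (P : probability Omega R) (G : set (set Omega)).
Hypothesis sG : sigma_algebra setT G.
Hypothesis Gm : G `<=` measurable.

(** Integrability of [h * X] comes for free from the inequality of the integrals. *)
Lemma cond_Ex_le (h X Y : Omega -> R) : smeas G h -> (forall w, 0 <= h w) ->
  rint P X -> rint P Y -> (forall w, 0 <= X w) -> (forall w, 0 <= Y w) ->
  (forall A, G A -> Ex P (fun w => \1_A w * X w) <= Ex P (fun w => \1_A w * Y w)) ->
  rint P (fun w => h w * Y w) ->
  rint P (fun w => h w * X w) /\
    Ex P (fun w => h w * X w) <= Ex P (fun w => h w * Y w).
Proof.
move=> mh h0 IX IY X0 Y0 XY IhY.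
have hle : (\int[P]_w (h w * X w)%:E <= \int[P]_w (h w * Y w)%:E)%E.
  apply: (le_integral_subsigma sG Gm) => //;
    [exact: rint_measurable IX|exact: rint_measurable IY|].
  move=> A GA; rewrite (Ex_indicM P X (Gm GA)) (Ex_indicM P Y (Gm GA)).
  by rewrite !ExE ?lee_fin ?XY//; apply: rint_indicM => //; exact: Gm.
have IhX : rint P (fun w => h w * X w).
  apply: rint_ge0 => [|w|].
  - by apply: measurable_funM; [exact: smeas_measurable mh|exact: rint_measurable IX].
  - by rewrite mulr_ge0.
  - by rewrite (le_lt_trans hle)// ExE// ltry.
by split=> //; rewrite -lee_fin -!ExE.
Qed.

(** Splitting [X] into positive and negative parts reduces to [cond_Ex_le] in both
    directions, for a nonnegative [h]; a signed [h] is split likewise. *)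
Lemma cond_Ex_eq0 (h X : Omega -> R) : smeas G h -> rint P X ->
  (forall A, G A -> Ex P (fun w => \1_A w * X w) = 0) ->
  rint P (fun w => h w * X w) -> Ex P (fun w => h w * X w) = 0.
Proof.
move=> mh IX X0 IhX.
have mh' := smeas_measurable sG Gm mh.
have mX := rint_measurable IX.
pose p (f : Omega -> R) w := Num.max 0 (f w).
pose q (f : Omega -> R) w := Num.max 0 (- f w).
have p0 f w : 0 <= p f w by rewrite le_max lexx.
have q0 f w : 0 <= q f w by rewrite le_max lexx.
have pq f w : f w = p f w - q f w.
  rewrite /p /q; case: (lerP 0 (f w)) => f0.
    by rewrite max_l ?subr0// oppr_le0.
  by rewrite max_r ?oppr_ge0 ?ltW// add0r opprK.
have ple f w : p f w <= `|f w| by rewrite /p ge_max normr_ge0 ler_norm.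
have qle f w : q f w <= `|f w| by rewrite /q ge_max normr_ge0 -normrN ler_norm.
have mp f : measurable_fun setT f -> measurable_fun setT (p f).
  by move=> mf; exact: (@measurable_maxr _ _ _ _ (cst 0)).
have mq f : measurable_fun setT f -> measurable_fun setT (q f).
  by move=> mf; apply: (@measurable_maxr _ _ _ _ (cst 0)) => //; exact: measurableT_comp.
have Iabs f : rint P f -> rint P (fun w => `|f w|) by move=> If; exact: integrable_abse If.
have IpX : rint P (p X).
  apply: (rint_le _ _ (Iabs _ IX)); first exact: mp.
  by move=> w; rewrite ger0_norm.
have IqX : rint P (q X).
  apply: (rint_le _ _ (Iabs _ IX)); first exact: mq.
  by move=> w; rewrite ger0_norm.
have Epq A : G A -> Ex P (fun w => \1_A w * p X w) = Ex P (fun w => \1_A w * q X w).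
  move=> GA; apply/eqP; rewrite -subr_eq0 -ExB.
  - rewrite -(X0 A GA); apply/eqP; congr (Ex P _); apply/funext => w.
    by rewrite -mulrBr -pq.
  - by apply: rint_indicM => //; exact: Gm.
  - by apply: rint_indicM => //; exact: Gm.
have key (f : Omega -> R) : smeas G f -> (forall w, 0 <= f w) ->
    (forall w, f w <= `|h w|) -> Ex P (fun w => f w * X w) = 0.
  move=> mf f0 fh.
  have mf' := smeas_measurable sG Gm mf.
  have Ifp : rint P (fun w => f w * p X w).
    apply: (rint_le _ _ (Iabs _ IhX)).
      by apply: measurable_funM => //; exact: mp.
    by move=> w; rewrite ger0_norm ?mulr_ge0// normrM ler_pM.
  have Ifq : rint P (fun w => f w * q X w).
    apply: (rint_le _ _ (Iabs _ IhX)).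
      by apply: measurable_funM => //; exact: mq.
    by move=> w; rewrite ger0_norm ?mulr_ge0// normrM ler_pM.
  have -> : (fun w => f w * X w) = (fun w => f w * p X w - f w * q X w).
    by apply/funext => w; rewrite -mulrBr -pq.
  rewrite ExB//; apply/eqP; rewrite subr_eq0 eq_le; apply/andP; split.
    by have [|_ ] := cond_Ex_le mf f0 IpX IqX (p0 X) (q0 X) _ Ifq => // A GA; rewrite Epq.
  by have [|_ ] := cond_Ex_le mf f0 IqX IpX (q0 X) (p0 X) _ Ifp => // A GA; rewrite Epq.
have mhs (f : Omega -> R) : smeas G f -> smeas G (fun w => Num.max 0 (f w)).
  by move=> mf; exact: (@measurable_maxr _ (g_sigma_algebraType G) _ _ (cst 0)).
have sp : smeas G (p h) by exact: mhs.
have sq : smeas G (q h).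
  by apply: mhs; exact: (@measurableT_comp _ _ _ (g_sigma_algebraType G)).
have Ip : rint P (fun w => p h w * X w).
  apply: (rint_le _ _ (Iabs _ IhX)); first by apply: measurable_funM => //; exact: mp.
  by move=> w; rewrite !normrM ler_wpM2r// ger0_norm.
have Iq : rint P (fun w => q h w * X w).
  apply: (rint_le _ _ (Iabs _ IhX)); first by apply: measurable_funM => //; exact: mq.
  by move=> w; rewrite !normrM ler_wpM2r// ger0_norm.
have -> : (fun w => h w * X w) = (fun w => p h w * X w - q h w * X w).
  by apply/funext => w; rewrite -mulrBl -pq.
by rewrite ExB// !key// subr0.
Qed.

End CondExpectation.

Section LimitExpectation.
Context {R : realType} {disp : measure_display} {Omega : measurableType disp}.
Variable P : probability Omega R.

Lemma Ex_fatou (Y : nat -> Omega -> R) (Z : Omega -> R) (c : nat -> R) (b : R) :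
  (forall n, rint P (Y n)) -> (forall n w, 0 <= Y n w) ->
  measurable_fun setT Z -> (forall w, 0 <= Z w) ->
  (\forall w \ae P, Y n w @[n --> \oo] --> Z w) ->
  (forall n, Ex P (Y n) <= c n) -> c n @[n --> \oo] --> b ->
  rint P Z /\ Ex P Z <= b.
Proof.
move=> IY Y0 mZ Z0 YZ Yc cb.
have mY n : measurable_fun setT (fun w => (Y n w)%:E).
  by apply/measurable_EFinP; exact: rint_measurable (IY n).
have Zb : (\int[P]_w (Z w)%:E <= b%:E)%E.
  have -> : (\int[P]_w (Z w)%:E = \int[P]_w limn_einf (fun n => (Y n w)%:E))%E.
    apply: ae_eq_integral => //; first exact/measurable_EFinP.
    rewrite (_ : (fun w => _) = (fun w => - limn_esup (fun n => (- (Y n w)%:E)))%E); last first.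
      by apply/funext => w.
    apply: (measurableT_comp (@oppe_measurable _ setT)).
    apply: measurable_fun_limn_esup => n.
    exact: (measurableT_comp (@oppe_measurable _ setT)).
    apply: filterS YZ => w YZw _; apply/esym.
    have cv : (Y n w)%:E @[n --> \oo] --> (Z w)%:E by apply: cvg_EFin; [exact: nearW|].
    by rewrite is_cvg_limn_einfE ?(cvg_lim _ cv)//; exact: cvgP cv.
  apply: le_trans (fatou P measurableT mY _) _ => [n w _|]; first by rewrite lee_fin.
  have cbE : (c n)%:E @[n --> \oo] --> b%:E by apply: cvg_EFin; [exact: nearW|].
  rewrite limn_einf_lim -(cvg_lim _ cbE)//; apply: lee_lim (cvgP _ cbE) _; first exact: is_cvg_einfs.
  apply: nearW => n; rewrite (@le_trans _ _ (\int[P]_w (Y n w)%:E)%E)//; last by rewrite ExE// lee_fin.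
  by apply: ereal_inf_lbound; exists n => /=.
have IZ : rint P Z by apply: rint_ge0 => //; rewrite (le_lt_trans Zb)// ltry.
by split=> //; rewrite -lee_fin -ExE.
Qed.

Lemma Ex_dominated (Y : nat -> Omega -> R) (Z g : Omega -> R) :
  (forall n, measurable_fun setT (Y n)) -> measurable_fun setT Z -> rint P g ->
  (\forall w \ae P, Y n w @[n --> \oo] --> Z w) ->
  (forall n, \forall w \ae P, `|Y n w| <= g w) ->
  Ex P (Y n) @[n --> \oo] --> Ex P Z.
Proof.
move=> mY mZ Ig YZ Yg.
have [|||||IZ _ h] := @dominated_convergence _ _ R P setT measurableT
  (fun n w => (Y n w)%:E) (fun w => (Z w)%:E) (fun w => (g w)%:E).
- by move=> n; exact/measurable_EFinP.
- exact/measurable_EFinP.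
- by apply: filterS YZ => w YZw _; apply: cvg_EFin; [exact: nearW|].
- exact: Ig.
- by apply: filterS (ae_foralln Yg) => w h n _; rewrite lee_fin.
- apply: (@fine_cvg _ _ _ _ (fun n => \int[P]_w (Y n w)%:E)%E).
  by rewrite fineK//; exact: integrable_fin_num.
Qed.

(** A sequence bounded in L2 is uniformly integrable, so that vanishing expectations
    pass to an almost sure limit: truncation at level [M] changes expectations by at
    most [b / M], and the truncated sequence converges boundedly. *)
Lemma Ex_eq0_L2_limit (X : nat -> Omega -> R) (Z : Omega -> R) (b : R) :
  (forall n, measurable_fun setT (X n)) -> measurable_fun setT Z ->
  (forall n, rint P (fun w => X n w ^+ 2)) ->
  (forall n, Ex P (fun w => X n w ^+ 2) <= b) ->
  (\forall w \ae P, X n w @[n --> \oo] --> Z w) ->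
  (forall n, Ex P (X n) = 0) ->
  rint P (fun w => Z w ^+ 2) /\ Ex P Z = 0.
Proof.
move=> mX mZ IX Xb XZ EX0.
have mX2 n : measurable_fun setT (fun w => X n w ^+ 2) by exact: measurable_funX.
have [IZ2 Zb] : rint P (fun w => Z w ^+ 2) /\ Ex P (fun w => Z w ^+ 2) <= b.
  apply: (@Ex_fatou (fun n w => X n w ^+ 2) _ (fun=> b)) => //.
  - by move=> n w; rewrite sqr_ge0.
  - exact: measurable_funX.
  - by move=> w; rewrite sqr_ge0.
  - by apply: filterS XZ => w XZw; under eq_fun do rewrite expr2; rewrite expr2; apply: cvgM.
  - exact: cvg_cst.
split=> //.
have b0 : 0 <= b by apply: le_trans (Xb 0%N); apply: Ex_ge0 => w; rewrite sqr_ge0.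
have IZ : rint P Z by exact: rint_sq.
pose k M (x : R) := Num.max (- M) (Num.min x M).
have mk M (f : Omega -> R) : measurable_fun setT f -> measurable_fun setT (fun w => k M (f w)).
  move=> mf; apply: (@measurable_maxr _ _ _ _ (cst (- M))) => //.
  exact: (@measurable_minr _ _ _ _ _ (cst M)).
have kM M x : 0 <= M -> `|k M x| <= M.
  move=> M0; rewrite ler_norml le_max lexx /= ge_max ge_min lexx orbT andbT.
  by rewrite ge0_cp.
have kx M x : 0 < M -> `|x - k M x| <= x ^+ 2 / M.
  move=> M0; rewrite ler_pdivlMr// /k.
  case: (lerP x M) => xM; case: (lerP (- M) x) => Mx.
  - by rewrite subrr normr0 mul0r sqr_ge0.
  - by rewrite ltr0_norm ?subr_lt0//; nra.
  - rewrite max_r; last by rewrite ge0_cp ?ltW.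
    by rewrite gtr0_norm ?subr_gt0//; nra.
  - by have := lt_trans M0 xM; nra.
have Ik M (f : Omega -> R) : 0 <= M -> measurable_fun setT f -> rint P (fun w => k M (f w)).
  by move=> M0 mf; apply: (@rint_bounded _ _ _ _ _ M) => [|w]; [exact: mk|exact: kM].
have dk M (f : Omega -> R) : 0 < M -> measurable_fun setT f -> rint P (fun w => f w ^+ 2) ->
    Ex P (fun w => f w ^+ 2) <= b -> `|Ex P f - Ex P (fun w => k M (f w))| <= b / M.
  move=> M0 mf If fb.
  have If1 := rint_sq mf If.
  have I2 : rint P (fun w => f w ^+ 2 / M).
    by have := rintZ (M^-1) If; under eq_fun do rewrite mulrC.
  have E2 : Ex P (fun w => f w ^+ 2 / M) <= b / M.
    under eq_fun do rewrite mulrC.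
    by rewrite ExZ// mulrC ler_wpM2r// invr_ge0 ltW.
  rewrite -ExB//; last exact/Ik/mf/ltW.
  rewrite ler_norml; apply/andP; split.
    rewrite lerNl -ExN; last by apply: rintB => //; exact/Ik/mf/ltW.
    apply: le_trans E2; apply: Ex_le => //; first by apply: rintN; apply: rintB => //; exact/Ik/mf/ltW.
    by move=> w; apply: le_trans (kx _ _ M0); rewrite -normrN ler_norm.
  apply: le_trans E2; apply: Ex_le => //; first by apply: rintB => //; exact/Ik/mf/ltW.
  by move=> w; apply: le_trans (kx _ _ M0); rewrite ler_norm.
have EkZ M : 0 < M -> `|Ex P (fun w => k M (Z w))| <= b / M.
  move=> M0.
  have cv : Ex P (fun w => k M (X n w)) @[n --> \oo] --> Ex P (fun w => k M (Z w)).
    apply: (@Ex_dominated _ _ (fun=> M)).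
    - by move=> n; exact: mk.
    - exact: mk.
    - exact: rint_cst.
    - apply: filterS XZ => w XZw.
      apply: (@continuous_cvg _ _ _ _ _ _ (k M)) => //.
      apply: continuous_max; first exact: cst_continuous.
      by apply: continuous_min; [move=> ?; exact: cvg_id|exact: cst_continuous].
    - by move=> n; apply: aeW => w; exact: kM (ltW M0).
  have cvn : (fun n => `|Ex P (fun w => k M (X n w))|) n @[n --> \oo] --> `|Ex P (fun w => k M (Z w))|.
    exact: cvg_norm.
  rewrite -(cvg_lim _ cvn)//.
  apply: limr_le; [exact: cvgP cvn|apply: nearW => n].
  have := dk _ (X n) M0 (mX n) (IX n) (Xb n).
  by rewrite EX0 sub0r normrN.
apply/eqP; rewrite -normr_le0; apply/ler_addgt0Pr => e e0; rewrite add0r.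
have M0 : 0 < (b + 1) * 2 / e by rewrite divr_gt0// mulr_gt0// ltr_wpDl.
have := dk _ Z M0 mZ IZ2 Zb; have := EkZ _ M0.
have -> : b / ((b + 1) * 2 / e) = b / (b + 1) * e / 2 by field; rewrite !gt_eqF//; lra.
have : b / (b + 1) <= 1 by rewrite ler_pdivrMr; lra.
move=> h1 h2 h3.
have h4 : b / (b + 1) * e / 2 <= e / 2 by rewrite ler_pM2r// ler_piMl// ltW.
rewrite (_ : Ex P Z = (Ex P Z - Ex P (fun w => k ((b + 1) * 2 / e) (Z w))) + Ex P (fun w => k ((b + 1) * 2 / e) (Z w))); last by rewrite subrK.
by rewrite (le_trans (ler_normD _ _))//; lra.
Qed.

End LimitExpectation.

(** * Moments of Gaussian increments *)
Section Gaussian.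
Context {R : realType}.
Variable sigma : R.
Hypothesis s0 : 0 < sigma.
Let mu := @lebesgue_measure R.

Lemma integral_normal_prob (h : R -> R) : measurable_fun setT h ->
  (forall x, 0 <= h x) ->
  (\int[normal_prob 0 sigma]_x (h x)%:E = \int[mu]_x (h x * normal_pdf 0 sigma x)%:E)%E.
Proof.
move=> mh h0; apply: ge0_integral_density => //.
- exact: measurable_normal_pdf.
- by move=> w; exact: normal_pdf_ge0.
Qed.

(** With [y = x ^+ 2 / (4 * sigma ^+ 2)], the bound [y <= expR y] absorbs the weight
    [x ^+ 2] into a Gaussian of double variance. The constant is not sharp; any
    multiple of [sigma ^+ 2] serves. *)
Lemma normal_second_moment :
  (\int[normal_prob 0 sigma]_x (x ^+ 2)%:E <= (8 * sigma ^+ 2)%:E)%E.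
Proof.
rewrite integral_normal_prob//; last first.
  by move=> x; rewrite sqr_ge0.
pose s2 := sigma * Num.sqrt 2.
have q2 : Num.sqrt 2 ^+ 2 = 2 :> R by rewrite sqr_sqrtr.
have q0 : 0 < Num.sqrt 2 :> R by rewrite sqrtr_gt0.
have s20 : 0 < s2 by rewrite mulr_gt0.
have bound x : x ^+ 2 * normal_pdf 0 sigma x <= 8 * sigma ^+ 2 * normal_pdf 0 s2 x.
  rewrite !normal_pdfE ?gt_eqF//.
  have pk : normal_peak sigma = Num.sqrt 2 * normal_peak s2.
    rewrite /normal_peak /s2 exprMn q2.
    have -> : sigma ^+ 2 * 2 * pi *+ 2 = 2 * (sigma ^+ 2 * pi *+ 2) by ring.
    rewrite sqrtrM// invfM mulrA divff ?mul1r// gt_eqF//.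
  have fx : x ^+ 2 * normal_fun 0 sigma x <= 4 * sigma ^+ 2 * normal_fun 0 s2 x.
    rewrite /normal_fun subr0 /s2 exprMn q2.
    set y := x ^+ 2 / (4 * sigma ^+ 2).
    have -> : - x ^+ 2 / (sigma ^+ 2 *+ 2) = - y - y by rewrite /y; field; exact: lt0r_neq0.
    have -> : - x ^+ 2 / (sigma ^+ 2 * 2 *+ 2) = - y by rewrite /y; field; exact: lt0r_neq0.
    have -> : x ^+ 2 = 4 * sigma ^+ 2 * y by rewrite /y; field; exact: lt0r_neq0.
    rewrite expRD -(mulrA (4 * _)) ler_wpM2l//; first by rewrite mulr_ge0// sqr_ge0.
    rewrite mulrA ler_piMl ?expR_ge0// expRN ler_pdivrMr ?expR_gt0// mul1r.
    by rewrite (le_trans _ (expR_ge1Dx _))// ler_wpDl.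
  rewrite mulrCA pk.
  have p0 := normal_peak_ge0 s2; have q2' : Num.sqrt 2 <= 2 :> R by nra.
  have G0 : 0 <= normal_fun 0 s2 x by exact: normal_fun_ge0.
  have sg : 0 <= sigma ^+ 2 by rewrite sqr_ge0.
  have h1 : Num.sqrt 2 * normal_peak s2 * (x ^+ 2 * normal_fun 0 sigma x) <=
      2 * normal_peak s2 * (4 * sigma ^+ 2 * normal_fun 0 s2 x).
    apply: ler_pM => //; first by rewrite mulr_ge0// ltW.
      by rewrite mulr_ge0 ?sqr_ge0// normal_fun_ge0.
    by rewrite ler_wpM2r.
  by apply: le_trans h1 _; rewrite le_eqVlt; apply/orP; left; apply/eqP; ring.
apply: (@le_trans _ _ (\int[mu]_x (8 * sigma ^+ 2 * normal_pdf 0 s2 x)%:E)%E).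
  apply: ge0_le_integral => //.
  - by move=> x _; rewrite lee_fin mulr_ge0 ?sqr_ge0// normal_pdf_ge0.
  - apply/measurable_EFinP/measurable_funM; [exact: exprn_measurable|exact: measurable_normal_pdf].
  - apply/measurable_EFinP/measurable_funM => //; exact: measurable_normal_pdf.
  - by move=> x _; rewrite lee_fin.
under eq_integral do rewrite EFinM.
rewrite ge0_integralZl//; last first.
- by rewrite lee_fin mulr_ge0// sqr_ge0.
- by move=> x _; rewrite lee_fin normal_pdf_ge0.
- by apply/measurable_EFinP; exact: measurable_normal_pdf.
by rewrite integral_normal_pdf mule1.
Qed.

(** Both sides are exchanged by the substitution of [- x] for [x]. *)
Lemma normal_symmetric :
  (\int[normal_prob 0 sigma]_x (Num.max 0 x)%:E =
   \int[normal_prob 0 sigma]_x (Num.max 0 (- x))%:E)%E.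
Proof.
have m1 : measurable_fun setT (fun x : R => Num.max 0 x).
  exact: (@measurable_maxr _ _ _ _ (cst 0) id).
have m2 : measurable_fun setT (fun x : R => Num.max 0 (- x)).
  by apply: (@measurable_maxr _ _ R setT (cst 0) (fun x : R => - x)) => //; exact: oppr_measurable.
rewrite !integral_normal_prob//; try by move=> x; rewrite le_max lexx.
have mg (f : R -> R) : measurable_fun setT f ->
    measurable_fun setT (fun x => (f x * normal_pdf 0 sigma x)%:E).
  move=> mf; apply/measurable_EFinP/measurable_funM => //; exact: measurable_normal_pdf.
have -> : (\int[mu]_x (Num.max 0 x * normal_pdf 0 sigma x)%:E =
    \int[mu]_(x in `[0%R, +oo[) (Num.max 0 x * normal_pdf 0 sigma x)%:E)%E.
  rewrite [RHS]integral_mkcond; apply: eq_integral => x _; rewrite /patch.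
  case: ifPn => //; rewrite notin_setE /= in_itv /= andbT => /negP; rewrite -ltNge => x0.
  by rewrite max_l ?mul0r// ltW.
have -> : (\int[mu]_x (Num.max 0 (- x) * normal_pdf 0 sigma x)%:E =
    \int[mu]_(x in `]-oo, (- 0)%R]) (Num.max 0 (- x) * normal_pdf 0 sigma x)%:E)%E.
  rewrite [RHS]integral_mkcond; apply: eq_integral => x _; rewrite /patch.
  case: ifPn => //; rewrite notin_setE /= in_itv /= oppr0 => /negP; rewrite -ltNge => x0.
  by rewrite max_l ?mul0r// oppr_le0 ltW.
rewrite (@ge0_integration_by_substitutionNy R (fun x => Num.max 0 (- x) * normal_pdf 0 sigma x) 0).
- apply: eq_integral => x _ /=; rewrite opprK; congr ((_ * _)%:E).
  by rewrite !normal_pdfE ?gt_eqF// /normal_fun !subr0 sqrrN.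
- apply: continuous_subspaceT => x; apply: cvgM; last exact: continuous_normal_pdf (lt0r_neq0 s0) _.
  apply: continuous_max; first exact: cst_continuous.
  by move=> y; apply: cvgN; exact: cvg_id.
- by move=> x _; rewrite mulr_ge0 ?normal_pdf_ge0// le_max lexx.
Qed.

Context {disp : measure_display} {Omega : measurableType disp}.
Variable P : probability Omega R.

(** Restricted to [A], the law of [Y] is the Gaussian law scaled by [P A]. *)
Lemma integral_gaussian_increment (A : set Omega) (Y : Omega -> R) (h : R -> R) :
  measurable A -> measurable_fun setT Y ->
  (forall B, measurable B -> P (A `&` Y @^-1` B) = (P A * normal_prob 0 sigma B)%E) ->
  measurable_fun setT h -> (forall x, 0 <= h x) ->
  (\int[P]_(w in A) (h (Y w))%:E = P A * \int[normal_prob 0 sigma]_x (h x)%:E)%E.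
Proof.
move=> mA mY PY mh h0.
have mhE : measurable_fun setT (EFin \o h) by exact/measurable_EFinP.
have mY' : @measurable_fun _ _ Omega (measurableTypeR R) setT Y by exact: mY.
pose Yf : {mfun Omega >-> measurableTypeR R} := @mfun_Sub _ _ Omega (measurableTypeR R) Y (mem_set mY').
pose m1 : {measure set Omega -> \bar R} := mrestr P mA.
have -> : (\int[P]_(w in A) (h (Y w))%:E = \int[m1]_(w in A) (h (Y w))%:E)%E.
  by apply: eq_measure_integral => B mB BA; rewrite /m1 /= /mrestr setIidl.
have -> : (\int[m1]_(w in A) (h (Y w))%:E = \int[m1]_w (h (Y w))%:E)%E.
  rewrite [RHS](@ge0_negligible_integral _ _ _ _ _ (~` A))//.
  - by rewrite setTD setCK.
  - exact: measurableC.
  - by apply/measurable_EFinP/measurableT_comp.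
  - by move=> w _; rewrite lee_fin.
  - by rewrite /m1 /= /mrestr setICl; exact: (measure0 P).
have := @ge0_integral_pushforward _ _ _ (measurableTypeR R) R Yf mY' m1 setT (EFin \o h) measurableT mhE.
rewrite preimage_setT => <-; last by move=> y _; rewrite lee_fin.
have PAf : P A \is a fin_num by exact: fin_num_measure.
have PA0 : 0 <= fine (P A) by exact: fine_ge0.
transitivity (\int[mscale (NngNum PA0) (normal_prob 0 sigma)]_x (h x)%:E)%E.
  apply: (@eq_measure_integral _ (measurableTypeR R) R setT (mscale (NngNum PA0) (normal_prob 0 sigma)) (pushforward m1 Yf)) => B mB _.
  transitivity (P (A `&` Y @^-1` B)); first by rewrite setIC.
  rewrite PY//; transitivity ((fine (P A))%:E * normal_prob 0 sigma B)%E => //.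
  by rewrite fineK.
by rewrite ge0_integral_mscale//= ?fineK// => x _; rewrite lee_fin.
Qed.

Lemma gaussian_increment_moments (A : set Omega) (Y : Omega -> R) :
  measurable A -> measurable_fun setT Y ->
  (forall B, measurable B -> P (Y @^-1` B) = normal_prob 0 sigma B) ->
  (forall B, measurable B -> P (A `&` Y @^-1` B) = (P A * normal_prob 0 sigma B)%E) ->
  [/\ rint P (fun w => Y w ^+ 2), Ex P (fun w => \1_A w * Y w) = 0 &
      Ex P (fun w => \1_A w * Y w ^+ 2) <= Ex P (fun w => \1_A w * (8 * sigma ^+ 2))].
Proof.
move=> mA mY PY PAY.
have mY2 : measurable_fun setT (fun w => Y w ^+ 2) by exact: measurable_funX.
have msq : measurable_fun setT (fun x : R => x ^+ 2) by exact: exprn_measurable.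
have IY2 : rint P (fun w => Y w ^+ 2).
  apply: rint_ge0 => // [w|]; first by rewrite sqr_ge0.
  have := @integral_gaussian_increment setT Y (fun x => x ^+ 2) measurableT mY.
  move=> -> //; last by move=> x; rewrite sqr_ge0.
    by rewrite probability_setT mul1e (le_lt_trans normal_second_moment)// ltry.
  by move=> B mB; rewrite setTI probability_setT mul1e PY.
have IY := rint_sq mY IY2.
have mp : measurable_fun setT (fun x : R => Num.max 0 x).
  exact: (@measurable_maxr _ _ _ _ (cst 0) id).
have mq : measurable_fun setT (fun x : R => Num.max 0 (- x)).
  by apply: (@measurable_maxr _ _ R setT (cst 0) (fun x : R => - x)) => //; exact: oppr_measurable.
split=> //.
- have I1 : rint P (fun w => Num.max 0 (Y w)).
    apply: (rint_le (measurableT_comp mp mY) _ (integrable_abse IY)) => w /=.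
    by rewrite ger0_norm ?le_max ?lexx// ge_max normr_ge0 ler_norm.
  have I2 : rint P (fun w => Num.max 0 (- Y w)).
    apply: (rint_le (measurableT_comp mq mY) _ (integrable_abse IY)) => w /=.
    by rewrite ger0_norm ?le_max ?lexx// ge_max normr_ge0 -normrN ler_norm.
  have -> : (fun w => \1_A w * Y w) =
      (fun w => \1_A w * Num.max 0 (Y w) - \1_A w * Num.max 0 (- Y w)).
    apply/funext => w; rewrite -mulrBr; congr (_ * _).
    case: (lerP 0 (Y w)) => Y0; first by rewrite max_l ?subr0// oppr_le0.
    by rewrite max_r ?oppr_ge0 ?ltW// add0r opprK.
  have J1 := rint_indicM mA I1; have J2 := rint_indicM mA I2.
  rewrite ExB//; apply/eqP; rewrite subr_eq0; apply/eqP; apply: EFin_inj.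
  rewrite -!ExE// -!Ex_indicM//.
  rewrite (integral_gaussian_increment mA mY PAY mp) => [|x]; last by rewrite le_max lexx.
  rewrite (integral_gaussian_increment mA mY PAY mq) => [|x]; last by rewrite le_max lexx.
  by rewrite normal_symmetric.
- rewrite -lee_fin -!ExE//; last 2 first.
  + by apply: rint_indicM => //; exact: rint_cst.
  + exact: rint_indicM.
  rewrite -!Ex_indicM// (integral_gaussian_increment mA mY PAY msq) => [|x]; last by rewrite sqr_ge0.
  rewrite integral_cst// muleC; apply: lee_wpmul2r => //.
  exact: normal_second_moment.
Qed.

End Gaussian.

(** * Discrete stochastic integrals *)
Section FiltrationFacts.
Context {R : realType} {disp : measure_display} {Omega : measurableType disp}.
Variables (P : probability Omega R) (F : R -> set (set Omega)).
Hypothesis uF : usual_filtration P F.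

Lemma filtration_sigma t : 0 <= t -> sigma_algebra setT (F t).
Proof. by case: uF => + _ _ _ => /[apply] -[]. Qed.

Lemma filtration_measurable t : 0 <= t -> F t `<=` measurable.
Proof. by case: uF => + _ _ _ => /[apply] -[]. Qed.

Lemma filtration_null t : 0 <= t -> forall N, P.-negligible N -> F t N.
Proof.
by case: uF => _ inc _ nul t0 N /nul; apply: inc => //; rewrite lexx.
Qed.

Lemma filtration_le s t : 0 <= s -> s <= t -> F s `<=` F t.
Proof. by case: uF => _ inc _ _; exact: inc. Qed.

Lemma Fsmeas_measurable t (f : Omega -> R) : 0 <= t -> smeas (F t) f -> measurable_fun setT f.
Proof. by move=> t0; apply: smeas_measurable; [exact: filtration_sigma|exact: filtration_measurable]. Qed.

Lemma Fsmeas_le s t (f : Omega -> R) : 0 <= s -> s <= t -> smeas (F s) f -> smeas (F t) f.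
Proof.
move=> s0 st; have t0 := le_trans s0 st.
move=> /(smeasP (filtration_sigma s0)) h; apply/(smeasP (filtration_sigma t0)).
by move=> B mB; apply: (filtration_le s0 st); exact: h.
Qed.

Lemma filtration_set_measurable t A : 0 <= t -> F t A -> measurable A.
Proof. by move=> t0; exact: filtration_measurable. Qed.

End FiltrationFacts.

Section SmeasAlgebra.
Context {R : realType} {disp : measure_display} {Omega : measurableType disp}.
Variable G : set (set Omega).
Implicit Types f g : Omega -> R.

Lemma smeasD f g : smeas G f -> smeas G g -> smeas G (fun w => f w + g w).
Proof. exact: (@measurable_funD _ (g_sigma_algebraType G)). Qed.

Lemma smeasB f g : smeas G f -> smeas G g -> smeas G (fun w => f w - g w).
Proof. exact: (@measurable_funB _ (g_sigma_algebraType G)). Qed.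

Lemma smeasM f g : smeas G f -> smeas G g -> smeas G (fun w => f w * g w).
Proof. exact: (@measurable_funM _ (g_sigma_algebraType G)). Qed.

Lemma smeas_cst c : smeas G (fun=> c : R).
Proof. exact: (@measurable_cst _ _ (g_sigma_algebraType G)). Qed.

Lemma smeas_sum (I : Type) (s : seq I) (f : I -> Omega -> R) :
  (forall i, smeas G (f i)) -> smeas G (fun w => \sum_(i <- s) f i w).
Proof. exact: (@measurable_sum _ (g_sigma_algebraType G)). Qed.

Lemma smeas_comp (h : R -> R) f : measurable_fun setT h -> smeas G f ->
  smeas G (fun w => h (f w)).
Proof. exact: (@measurableT_comp _ _ _ (g_sigma_algebraType G)). Qed.

End SmeasAlgebra.

Lemma sqr_sum_le {R : realType} K (a : 'I_K -> R) :
  (\sum_k a k) ^+ 2 <= K%:R * \sum_k a k ^+ 2.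
Proof.
rewrite expr2 big_distrlr /=.
apply: (@le_trans _ _ (\sum_(i < K) \sum_(j < K) (a i ^+ 2 + a j ^+ 2) / 2)).
  apply: ler_sum => i _; apply: ler_sum => j _.
  by have := sqr_ge0 (a i - a j); rewrite sqrrB; nra.
rewrite le_eqVlt; apply/orP; left; apply/eqP.
rewrite (eq_bigr (fun i => (K%:R * a i ^+ 2 + \sum_j a j ^+ 2) / 2)); last first.
  move=> i _; rewrite -mulr_suml; congr (_ / 2).
  by rewrite big_split /= sumr_const card_ord mulr_natl.
rewrite -mulr_suml big_split /= sumr_const card_ord -mulr_sumr -(mulr_natl (\sum_j _) K).
by field.
Qed.

Section DiscreteIntegral.
Context {R : realType} {disp : measure_display} {Omega : measurableType disp}.
Variables (P : probability Omega R) (F : R -> set (set Omega)).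
Hypothesis uF : usual_filtration P F.
Variables (K : nat) (W : R -> Omega -> 'cV[R]_K).
Hypothesis bW : brownian_motion P F W.

Definition dW (s t : R) (k : 'I_K) (w : Omega) : R := W t w k ord0 - W s w k ord0.

Lemma smeas_W t k : 0 <= t -> smeas (F t) (fun w => W t w k ord0).
Proof.
move=> t0; apply/(smeasP (filtration_sigma uF t0)) => B mB.
by case: bW => aW _ _ _; exact: aW.
Qed.

Lemma smeas_dW s t k : 0 <= s -> s <= t -> smeas (F t) (dW s t k).
Proof.
move=> s0 st; apply: smeasB; first by apply: smeas_W; exact: le_trans st.
exact: (Fsmeas_le uF s0 st (smeas_W _ s0)).
Qed.

Lemma dW_law s t k A B : 0 <= s -> s < t -> F s A -> measurable B ->
  P (A `&` dW s t k @^-1` B) = (P A * normal_prob 0 (Num.sqrt (t - s)) B)%E.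
Proof.
move=> s0 st FA mB; case: bW => _ _ _ h.
have := h s t s0 st A (fun j => if j == k then B else setT) FA.
rewrite (bigD1 k)//= eqxx big1 ?mule1; last first.
  by move=> j /negbTE ->; exact: probability_setT.
move=> <-; last by move=> j; case: ifP.
congr (P _); apply/seteqP; split=> w [Aw /= Bw]; split=> //.
  by move=> j; case: eqP => [->|//]; move: Bw; rewrite /dW /= !mxE.
by have := Bw k; rewrite eqxx /dW !mxE.
Qed.

Lemma dW_moments s t k A : 0 <= s -> s <= t -> F s A ->
  [/\ rint P (fun w => dW s t k w ^+ 2), Ex P (fun w => \1_A w * dW s t k w) = 0 &
      Ex P (fun w => \1_A w * dW s t k w ^+ 2) <= Ex P (fun w => \1_A w * (8 * (t - s)))].
Proof.
move=> s0; rewrite le_eqVlt => /predU1P[<- FA|st FA].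
  have -> : dW s s k = fun=> 0 by apply/funext => w; rewrite /dW subrr.
  rewrite subrr !mulr0 expr0n /=.
  split; [exact: rint_cst| |].
    by under eq_fun do rewrite mulr0; rewrite Ex_cst.
  by under eq_fun do rewrite mulr0.
have mA := filtration_set_measurable uF s0 FA.
have q0 : 0 < Num.sqrt (t - s) by rewrite sqrtr_gt0 subr_gt0.
have mdW := Fsmeas_measurable uF (le_trans s0 (ltW st)) (smeas_dW k s0 (ltW st)).
have [|B mB|I2 E1 E2] := gaussian_increment_moments q0 (P := P) mA mdW.
- move=> B mB; rewrite -[_ @^-1` B]setTI dW_law//.
    by rewrite probability_setT mul1e.
  exact: (subsigmaT (filtration_sigma uF s0)).
- exact: dW_law.
have q2 : Num.sqrt (t - s) ^+ 2 = t - s by rewrite sqr_sqrtr// subr_ge0 ltW.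
by rewrite q2 in E2.
Qed.

Lemma cond_dW_eq0 s t k (h : Omega -> R) : 0 <= s -> s <= t -> smeas (F s) h ->
  rint P (fun w => h w * dW s t k w) -> Ex P (fun w => h w * dW s t k w) = 0.
Proof.
move=> s0 st mh Ih; have sF := filtration_sigma uF s0.
have mdW := Fsmeas_measurable uF (le_trans s0 st) (smeas_dW k s0 st).
apply: (cond_Ex_eq0 sF (filtration_measurable uF s0)) => //.
  by have [I _ _] := dW_moments k s0 st (subsigmaT sF); exact: rint_sq.
by move=> A /(dW_moments k s0 st)[].
Qed.

Lemma cond_dW_sqr s t k (h : Omega -> R) : 0 <= s -> s <= t -> smeas (F s) h ->
  (forall w, 0 <= h w) -> rint P h ->
  rint P (fun w => h w * dW s t k w ^+ 2) /\
  Ex P (fun w => h w * dW s t k w ^+ 2) <= 8 * (t - s) * Ex P h.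
Proof.
move=> s0 st mh h0 Ih; have sF := filtration_sigma uF s0.
have [I _ _] := dW_moments k s0 st (subsigmaT sF).
have [||||] := cond_Ex_le sF (filtration_measurable uF s0) mh h0 I (rint_cst P (8 * (t - s))).
- by move=> w; rewrite sqr_ge0.
- by move=> w; rewrite mulr_ge0// subr_ge0.
- by move=> A /(dW_moments k s0 st)[].
- by under eq_fun do rewrite mulrC; exact: rintZ.
move=> I2 le2; split=> //; apply: le_trans le2 _.
by under eq_fun do rewrite mulrC; rewrite ExZ.
Qed.

Variables (u : nat -> R) (h : nat -> 'I_K -> Omega -> R).
Hypothesis u0 : 0 <= u 0.
Hypothesis und : forall i, u i <= u i.+1.
Hypothesis mh : forall i k, smeas (F (u i)) (h i k).
Hypothesis Ih : forall i k, rint P (fun w => h i k w ^+ 2).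

Definition dint n (w : Omega) : R :=
  \sum_(i < n) \sum_k h i k w * dW (u i) (u i.+1) k w.

Lemma grid_ge0 i : 0 <= u i.
Proof. by elim: i => // i IH; exact: le_trans (und i). Qed.

Lemma grid_le i j : (i <= j)%N -> u i <= u j.
Proof.
elim: j => [|j IH]; first by rewrite leqn0 => /eqP ->.
by rewrite leq_eqVlt => /predU1P[->//|/IH h']; exact: le_trans (und j).
Qed.

(** One step of the induction expands the square of [dint n + D]. The cross term
    vanishes because [D] has conditional mean zero; the factor [K] comes from bounding
    the square of a sum over the coordinates of the Brownian motion. *)
Lemma dint_moments n : [/\ smeas (F (u n)) (dint n), rint P (fun w => dint n w ^+ 2),
  Ex P (dint n) = 0 &
  Ex P (fun w => dint n w ^+ 2) <= 8 * K%:R *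
    \sum_(i < n) (u i.+1 - u i) * \sum_k Ex P (fun w => h i k w ^+ 2)].
Proof.
elim: n => [|n [mX IX EX0 EX2]].
  have -> : dint 0 = fun=> 0 by apply/funext => w; rewrite /dint big_ord0.
  rewrite big_ord0 mulr0 expr0n /= Ex_cst; split=> //; first exact: smeas_cst.
    exact: rint_cst.
pose D w := \sum_k h n k w * dW (u n) (u n.+1) k w.
have dE : dint n.+1 = fun w => dint n w + D w.
  by apply/funext => w; rewrite /dint big_ord_recr.
have un0 := grid_ge0 n; have un10 := grid_ge0 n.+1.
have mh1 k : smeas (F (u n.+1)) (h n k) by exact: (Fsmeas_le uF un0 (und n) (@mh n k)).
have mdWn k := smeas_dW k un0 (und n).
have mhd k : smeas (F (u n.+1)) (fun w => h n k w * dW (u n) (u n.+1) k w).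
  by apply: smeasM.
have mD : smeas (F (u n.+1)) D by exact: smeas_sum.
have mX1 := Fsmeas_le uF un0 (und n) mX.
have mX' := Fsmeas_measurable uF un0 mX.
have mD' := Fsmeas_measurable uF un10 mD.
have mhd' k := Fsmeas_measurable uF un10 (mhd k).
have mh2 k : smeas (F (u n)) (fun w => h n k w ^+ 2).
  by apply: (@smeas_comp _ _ _ _ (fun x => x ^+ 2)) => //; exact: exprn_measurable.
have hd2 k := cond_dW_sqr k un0 (und n) (mh2 k) (fun w => sqr_ge0 (h n k w)) (@Ih n k).
have Ihd2 k : rint P (fun w => (h n k w * dW (u n) (u n.+1) k w) ^+ 2).
  by under eq_fun do rewrite exprMn; case: (hd2 k).
have Ihd k : rint P (fun w => h n k w * dW (u n) (u n.+1) k w).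
  by apply: rint_sq.
have D2le w : D w ^+ 2 <= K%:R * \sum_k (h n k w * dW (u n) (u n.+1) k w) ^+ 2.
  exact: sqr_sum_le.
have ID2b : rint P (fun w => K%:R * \sum_k (h n k w * dW (u n) (u n.+1) k w) ^+ 2).
  by apply: rintZ; apply: rint_sum.
have ID2 : rint P (fun w => D w ^+ 2).
  apply: (rint_le _ _ ID2b); first exact: measurable_funX.
  by move=> w; rewrite ger0_norm ?sqr_ge0.
have ID := rint_sq mD' ID2; have IX1 := rint_sq mX' IX.
have IXhd k : rint P (fun w => dint n w * (h n k w * dW (u n) (u n.+1) k w)).
  by apply: rint_sqM.
have IXD : rint P (fun w => dint n w * D w) by exact: rint_sqM.
have EXD : Ex P (fun w => dint n w * D w) = 0.
  have -> : (fun w => dint n w * D w) =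
      (fun w => \sum_k dint n w * (h n k w * dW (u n) (u n.+1) k w)).
    by apply/funext => w; rewrite mulr_sumr.
  rewrite Ex_sum// big1// => k _.
  under eq_fun do rewrite mulrA.
  apply: cond_dW_eq0 => //; first exact: smeasM.
  by under eq_fun do rewrite -mulrA.
have ED : Ex P D = 0.
  by rewrite Ex_sum// big1// => k _; apply: cond_dW_eq0.
have ED2 : Ex P (fun w => D w ^+ 2) <= 8 * K%:R * ((u n.+1 - u n) * \sum_k Ex P (fun w => h n k w ^+ 2)).
  apply: le_trans (Ex_le ID2 ID2b D2le) _.
  rewrite ExZ; last by apply: rint_sum.
  rewrite Ex_sum// (mulrC 8) -mulrA ler_wpM2l// mulrA mulr_sumr.
  apply: ler_sum => k _.
  by have [_] := hd2 k; under eq_fun do rewrite -exprMn.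
rewrite dE; split.
- exact: smeasD.
- have -> : (fun w => (dint n w + D w) ^+ 2) =
      (fun w => dint n w ^+ 2 + 2 * (dint n w * D w) + D w ^+ 2).
    by apply/funext => w; ring.
  by apply: rintD => //; apply: rintD => //; exact: rintZ.
- by rewrite ExD// EX0 ED addr0.
- have -> : (fun w => (dint n w + D w) ^+ 2) =
      (fun w => dint n w ^+ 2 + 2 * (dint n w * D w) + D w ^+ 2).
    by apply/funext => w; ring.
  have I2 := rintZ 2 IXD.
  rewrite ExD//; last exact: rintD.
  rewrite ExD// ExZ// EXD mulr0 addr0 big_ord_recr /= mulrDr.
  exact: lerD.
Qed.

End DiscreteIntegral.

(** * Paths that are continuous on the half-line *)
Section JointMeasurability.
Context {R : realType} {disp : measure_display} {Omega : measurableType disp}.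
Variables (P : probability Omega R).
Hypothesis complete : forall N, P.-negligible N -> measurable N.

(** The path on [[0, T]] frozen on the grid of mesh [m.+1%:R^-1]. *)
Definition sample (X : R -> Omega -> R) (T : R) (m : nat) (p : Omega * R) : R :=
  \sum_(i < (Num.truncn (T * m.+1%:R)).+1)
    (\1_(`[i%:R / m.+1%:R, i.+1%:R / m.+1%:R[) p.2 : R) * X (i%:R / m.+1%:R) p.1.

Lemma sampleE X T m w s : 0 <= s <= T ->
  sample X T m (w, s) = X ((Num.truncn (s * m.+1%:R))%:R / m.+1%:R) w.
Proof.
move=> /andP[s0 sT]; rewrite /sample /=.
have m0 : 0 < m.+1%:R :> R by rewrite ltr0n.
have sm0 : 0 <= s * m.+1%:R by rewrite mulr_ge0.
set i0 := Num.truncn (s * m.+1%:R).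
have i0lt : (i0 < (Num.truncn (T * m.+1%:R)).+1)%N.
  by rewrite ltnS /i0 le_truncn// ler_wpM2r.
have h (i : nat) : (s \in `[i%:R / m.+1%:R, i.+1%:R / m.+1%:R[) = (i == i0).
  rewrite in_itv /= ler_pdivrMr// ltr_pdivlMr//.
  apply/idP/eqP => [|->].
    by move=> /andP[h1 h2]; apply/esym/truncn_def => //; rewrite h1 h2.
  by rewrite /i0 truncn_le sm0 truncnS_gt.
rewrite (bigD1 (Ordinal i0lt))//= indicE mem_set; last by rewrite /= h.
rewrite mul1r big1 ?addr0// => i ii0.
rewrite indicE memNset ?mul0r//= h => /eqP ii0'.
by move/eqP: ii0; apply; exact: val_inj.
Qed.

Lemma sample_cvg (X : R -> Omega -> R) T w s : 0 <= s <= T ->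
  {within `[0, +oo[, continuous (fun t => X t w)} ->
  sample X T m (w, s) @[m --> \oo] --> X s w.
Proof.
move=> s0T cX; have /andP[s0 sT] := s0T.
under eq_fun do rewrite sampleE//.
move/continuous_within_itvcyP : cX => [cX cX0].
have q m : let x := (Num.truncn (s * m.+1%:R))%:R / m.+1%:R in x <= s < x + m.+1%:R^-1.
  have m0 : 0 < m.+1%:R :> R by rewrite ltr0n.
  rewrite /= -{3}(mul1r m.+1%:R^-1) -mulrDl ler_pdivrMr// ltr_pdivlMr//.
  rewrite truncn_le ?mulr_ge0//= natr1.
  by have := truncnS_gt (s * m.+1%:R).
pose x m : R := (Num.truncn (s * m.+1%:R))%:R / m.+1%:R.
have x0 m : 0 <= x m by rewrite /x divr_ge0.
have xs : x m @[m --> \oo] --> s.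
  apply: (@squeeze_cvgr _ _ _ _ (fun m => s - m.+1%:R^-1) (fun=> s)).
  - by apply: nearW => m; have /= := q m; rewrite -/(x m) => /andP[-> h]; rewrite lerBlDr ltW.
  - rewrite -[X in _ --> X]subr0; apply: cvgB; [exact: cvg_cst|exact: cvg_harmonic].
  - exact: cvg_cst.
have [s00|s00] := eqVneq s 0.
  rewrite s00; apply: cvg_near_cst; apply: nearW => m.
  by rewrite mul0r truncn0 mul0r.
have sgt0 : 0 < s by rewrite lt_neqAle eq_sym s00.
apply: (@continuous_cvg _ _ _ _ _ _ (fun t => X t w)) => //.
by apply: cX; rewrite in_itv /= sgt0.
Qed.

(** A continuous process is, off a null set, the pointwise limit of its samples,
    which are jointly measurable. *)
Lemma joint_measurable (X : R -> Omega -> R) T :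
  (forall t, 0 <= t -> measurable_fun setT (X t)) ->
  (\forall w \ae P, {within `[0, +oo[, continuous (fun t => X t w)}) ->
  exists Y : Omega * measurableTypeR R -> R, measurable_fun setT Y /\
    \forall w \ae P, forall s, 0 <= s <= T -> Y (w, s) = X s w.
Proof.
move=> mX cX; pose N := ~` [set w | {within `[0, +oo[, continuous (fun t => X t w)}].
have mN : measurable (~` N) by apply: measurableC; exact: complete.
pose g (p : Omega * measurableTypeR R) : R := \1_(~` N) p.1 * \1_(`[0, T]) p.2.
have mg : measurable_fun setT g.
  apply: measurable_funM.
    by apply: measurableT_comp => //; exact: measurable_indic.
  by apply: (@measurableT_comp _ _ _ _ (measurableTypeR R)) => //; exact: measurable_indic.
exists (fun p => g p * X p.2 p.1); split; last first.
  apply: filterS cX => w cXw s s0T; rewrite /g /= !indicE !mem_set ?mul1r//=.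
apply: (@measurable_fun_cvg _ _ _ _ (fun m p => g p * sample X T m p)).
  move=> m; apply: measurable_funM => //; apply: measurable_sum => i.
  apply: measurable_funM.
    by apply: (@measurableT_comp _ _ _ _ (measurableTypeR R)) => //; exact: measurable_indic.
  by apply: measurableT_comp => //; apply: mX; rewrite divr_ge0.
move=> [w s] _; rewrite /g /=.
have [Nw|Nw] := pselect (N w).
  rewrite indicE memNset ?mul0r; last by apply.
  by under eq_fun do rewrite !mul0r; exact: cvg_cst.
have [s0T|s0T] := pselect (s \in `[0, T]).
  apply: cvgMr; apply: sample_cvg; last exact: contrapT.
  by rewrite in_itv /= in s0T.
have e : \1_(`[0, T]) s = 0 :> R by rewrite indicE memNset.
by rewrite e mulr0 mul0r; under eq_fun do rewrite mul0r; exact: cvg_cst.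
Qed.

Lemma measurable_ae_eq (f g : Omega -> \bar R) : measurable_fun setT g ->
  (\forall w \ae P, f w = g w) -> measurable_fun setT f.
Proof.
move=> mg fg _ B mB; rewrite setTI.
pose N := ~` [set w | f w = g w].
have mN : measurable N by exact: complete.
have -> : f @^-1` B = (g @^-1` B `&` ~` N) `|` (f @^-1` B `&` N).
  apply/seteqP; split=> w.
    move=> Bw; have [Nw|Nw] := pselect (N w); first by right.
    by left; split=> //=; move/contrapT : Nw => /= <-.
  by move=> [[Bw /contrapT /= e]|[]//]; rewrite /preimage /= e.
apply: measurableU.
  by apply: measurableI; [rewrite -[_ @^-1` _]setTI; exact: mg|exact: measurableC].
by apply: complete; apply: negligibleS fg => w [].
Qed.

End JointMeasurability.

Section Paths.
Context {R : realType}.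

(** Uniform continuity where only one of the two points is in the compact set [A]: the
    other may be slightly outside, after one step of a path. *)
Lemma compact_modulus (X V : normedModType R) (A D : set X) (f : X -> V) :
  compact A ->
  (forall x, A x -> D x /\ forall e, 0 < e -> exists2 d, 0 < d &
     forall y, D y -> `|y - x| < d -> `|f y - f x| < e) ->
  forall e, 0 < e -> exists2 d, 0 < d &
    forall x y, A x -> D y -> `|y - x| < d -> `|f y - f x| < e.
Proof.
move=> /compact_near_coveringP cA fA e e0.
pose Q (d : R) (x : X) := A x -> forall y, D y -> `|y - x| < d -> `|f y - f x| < e.
have HQ : \forall d \near 0^'+, A `<=` Q d.
  apply: cA => x Ax; have [_ /(_ _ (divr_gt0 e0 (ltr0n _ 2)))[d d0 fd]] := fA x Ax.
  have d20 : 0 < d / 2 by rewrite divr_gt0.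
  exists (ball x (d / 2), [set d' : R | d' < d / 2]) => /=.
    split; first exact: nbhsx_ballx.
    by apply: nbhs_right_lt.
  move=> [x' d'] /= [xx' d'd] Ax' y Dy yx'.
  have xx'2 : `|x' - x| < d / 2 by move: xx'; rewrite -ball_normE /= distrC.
  have h1 : `|f y - f x| < e / 2.
    apply: fd => //; rewrite (splitr d) -(subrK x' y) -addrA.
    by rewrite (le_lt_trans (ler_normD _ _))// ltrD// (lt_trans yx').
  have h2 : `|f x' - f x| < e / 2.
    apply: fd; first by case: (fA x' Ax').
    by rewrite (lt_le_trans xx'2)// ler_pdivrMr// ler_peMr ?ler1n// ltW.
  rewrite (splitr e) -(subrK (f x) (f y)) -addrA.
  by rewrite (le_lt_trans (ler_normD _ _))// ltrD// distrC.
near (0 : R)^'+ => d.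
have dQ : A `<=` Q d by near: d.
have d0 : 0 < d by near: d; exact: nbhs_right_gt.
by exists d => // x y Ax; exact: dQ.
Unshelve. all: by end_near. Qed.

(** Continuity on the half-line of times, in the metric form in which it is used;
    see [within_pcont]. *)
Definition pcont (V : normedModType R) (f : R -> V) : Prop :=
  forall t, 0 <= t -> forall e, 0 < e -> exists2 d, 0 < d &
    forall s, 0 <= s -> `|s - t| < d -> `|f s - f t| < e.

Lemma within_pcont (V : normedModType R) (f : R -> V) :
  {within `[0, +oo[, continuous f} <-> pcont f.
Proof.
split=> [/subspace_continuousP cf t t0 e e0|cf].
  have t0' : `[0, +oo[%classic t by rewrite /= in_itv /= t0.
  have /cvgrPdist_lt/(_ e e0) := cf t t0'.
  rewrite near_withinE => /nbhs_ballP[d /= d0 h]; exists d => // s s0 st.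
  rewrite distrC; apply: h; last by rewrite /= in_itv /= s0.
  by rewrite -ball_normE /= distrC.
apply/subspace_continuousP => t; rewrite /= in_itv /= andbT => t0.
apply/cvgrPdist_lt => e e0; rewrite near_withinE.
have [d d0 h] := cf t t0 e e0; apply/nbhs_ballP; exists d => //= s.
rewrite -ball_normE /= => ts; rewrite in_itv /= andbT => s0.
by rewrite distrC; apply: h => //; rewrite distrC.
Qed.

Lemma pcont_unif (V : normedModType R) (f : R -> V) T : pcont f ->
  forall e, 0 < e -> exists2 d, 0 < d & forall s t, 0 <= s -> 0 <= t <= T ->
    `|s - t| < d -> `|f s - f t| < e.
Proof.
move=> cf e e0.
have [||d d0 h] := @compact_modulus R V `[0, T]%classic [set s | 0 <= s] f _ _ e e0.
- exact: segment_compact.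
- move=> t; rewrite /= in_itv /= => /andP[t0 _]; split=> // e' e'0.
  by have [d d0 h] := cf t t0 e' e'0; exists d.
by exists d => // s t s0 tT st; apply: h => //=; rewrite in_itv.
Qed.

Lemma pcont_bounded (V : normedModType R) (f : R -> V) T : pcont f ->
  exists2 M, 0 <= M & forall t, 0 <= t <= T -> `|f t| <= M.
Proof.
move=> cf.
have /compact_near_coveringP cA := @segment_compact R 0 T.
pose Q (M : R) (t : R) := 0 <= t <= T -> `|f t| <= M.
have HQ : \forall M \near +oo, `[0, T]%classic `<=` Q M.
  apply: cA => t; rewrite /= in_itv /= => /andP[t0 _].
  have [d d0 h] := cf t t0 1 ltr01.
  exists (ball t d, [set M : R | `|f t| + 1 <= M]) => /=.
    split; first exact: nbhsx_ballx.
    by apply: nbhs_pinfty_ge; exact: num_real.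
  move=> [s M] /= [ts hM] /andP[s0 _]; apply: le_trans hM.
  rewrite -lerBlDl (le_trans (lerB_dist _ _))// ltW// h//.
  by move: ts; rewrite -ball_normE /= distrC.
near (+oo : set_system R) => M.
have MQ : `[0, T]%classic `<=` Q M by near: M.
have M0 : 0 <= M by near: M; apply: nbhs_pinfty_ge; exact: num_real.
by exists M => // t tT; apply: MQ => //=; rewrite in_itv.
Unshelve. all: by end_near. Qed.

Lemma rat_between (a b : R) : a < b -> exists q : rat, a < ratr q < b.
Proof.
by move=> /rat_in_itvoo[q]; rewrite in_itv /= => qab; exists q.
Qed.

(** A strict excess persists nearby, hence occurs at a rational time or at [b]:
    events defined by paths are countable unions. *)
Lemma pcont_rat (f : R -> R^o) a b c : 0 <= a -> pcont f ->
  (exists t, a <= t <= b /\ c < f t) <->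
  ((a <= b /\ c < f b) \/ exists q : rat, a <= ratr q <= b /\ c < f (ratr q)).
Proof.
move=> a0 cf; split; last first.
  move=> [[ab cfb]|[q h]]; [exists b|by exists (ratr q)].
  by rewrite ab lexx.
move=> [t [/andP[at_ tb] cft]].
have [tb'|] := eqVneq t b; first by left; rewrite -tb'; split.
move=> tb'; right; have ltb : t < b by rewrite lt_neqAle tb' tb.
have fc0 : 0 < f t - c by rewrite subr_gt0.
have [d d0 h] := cf t (le_trans a0 at_) _ fc0.
have [|q /andP[tq qm]] := @rat_between t (Num.min b (t + d)).
  by rewrite lt_min ltb ltrDl.
exists q; move: qm; rewrite lt_min => /andP[qb qd].
split; first by rewrite (le_trans at_ (ltW tq)) ltW.
have := h (ratr q) (le_trans a0 (le_trans at_ (ltW tq))).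
rewrite gtr0_norm ?subr_gt0// ltrBlDl => /(_ qd).
by rewrite ltr_norml => /andP[+ _]; rewrite opprB ltrBDr subrK.
Qed.

End Paths.

Section PathEvents.
Context {R : realType} {disp : measure_display} {Omega : measurableType disp}.
Variables (P : probability Omega R) (G : set (set Omega)).
Hypothesis sG : sigma_algebra setT G.
Hypothesis GN : forall N, P.-negligible N -> G N.

Lemma path_exceeds (X : R -> Omega -> R) a b c : 0 <= a ->
  (forall t, a <= t <= b -> smeas G (X t)) ->
  (\forall w \ae P, pcont (X ^~ w : R -> R^o)) ->
  G [set w | exists t, a <= t <= b /\ c < X t w].
Proof.
move=> a0 mX cX.
have GX t : a <= t <= b -> G [set w | c < X t w].
  move=> tab; have /(smeasP sG)/(_ `]c, +oo[%classic) := mX t tab.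
  have -> : X t @^-1` `]c, +oo[ = [set w | c < X t w].
    by apply/seteqP; split=> w; rewrite /= in_itv /= andbT.
  by apply; exact: measurable_itv.
have [ab|ab] := leP a b; last first.
  have -> : [set w | exists t, a <= t <= b /\ c < X t w] = ~` setT.
    rewrite setCT; apply/seteqP; split=> w //= [t [/andP[h1 h2] _]].
    by have := lt_le_trans ab (le_trans h1 h2); rewrite ltxx.
  by apply: subsigmaC => //; exact: subsigmaT.
apply: (subsigma_ae sG GN (B := [set w | c < X b w] `|`
  \bigcup_(q : rat) [set w | a <= ratr q <= b /\ c < X (ratr q) w])).
  rewrite -bigcup2E; apply: subsigma_bigcupT => // -[|[|n]] /=.
  - by apply: GX; rewrite ab lexx.
  - apply: subsigma_bigcupT => // q.
    have [qab|qab] := boolP (a <= ratr q <= b).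
      have -> : [set w | true /\ c < X (ratr q) w] = [set w | c < X (ratr q) w].
        by apply/seteqP; split=> w //= [].
      exact: GX.
    have -> : [set w | false /\ c < X (ratr q) w] = ~` setT.
      by rewrite setCT; apply/seteqP; split=> w //= [].
    by apply: subsigmaC => //; exact: subsigmaT.
  - have -> : set0 = ~` [set: Omega] by rewrite setCT.
    by apply: subsigmaC => //; exact: subsigmaT.
apply: filterS cX => w cXw; rewrite /= (pcont_rat b c a0 cXw); split.
  by move=> [[_ h]|[q h]]; [left|right; exists q].
by move=> [h|[q _ h]]; [left|right; exists q].
Qed.

(** On a compact time interval a continuous path hits []-oo, 0]] exactly when it
    comes below [n.+1%:R^-1] for every [n]. *)
Lemma path_hits (X : R -> Omega -> R) a b : 0 <= a ->
  (forall t, a <= t <= b -> smeas G (X t)) ->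
  (\forall w \ae P, pcont (X ^~ w : R -> R^o)) ->
  G [set w | exists t, a <= t <= b /\ X t w <= 0].
Proof.
move=> a0 mX cX.
apply: (subsigma_ae sG GN (B := \bigcap_(m : nat)
  [set w | exists t, a <= t <= b /\ - m.+1%:R^-1 < - X t w])).
  apply: subsigma_bigcapT => // m; apply: path_exceeds => //.
    move=> t tab; apply: (@smeas_comp _ _ _ _ -%R); last exact: mX.
    exact: oppr_measurable.
  apply: filterS cX => w cXw t t0 e e0; have [d d0 h] := cXw t t0 e e0.
  by exists d => // s s0 st; rewrite -opprD normrN; exact: h.
apply: filterS cX => w cXw; split=> /=.
  move=> [t [tab Xt]] m _; exists t; split=> //.
  by rewrite ltrN2 (le_lt_trans Xt)// invr_gt0 ltr0n.
move=> h; have [t0 [/andP[at0 t0b] _]] := h 0%N I.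
have ab := le_trans at0 t0b.
have cab : {within `[a, b], continuous (X ^~ w)}.
  have /within_pcont := cXw; apply: continuous_subspaceW.
  by apply: subset_itv; rewrite bnd_simp.
have [c cab' cmin] := EVT_min ab cab.
exists c; rewrite in_itv /= in cab'; split=> //.
apply/ler_addgt0Pr => e e0; rewrite add0r.
have [m mP] : exists m : nat, m.+1%:R^-1 < e.
  have /cvgrPdist_lt/(_ e e0) := @cvg_harmonic R.
  case=> N _ /(_ N (leqnn N)); rewrite /= sub0r normrN ger0_norm ?invr_ge0// => h'.
  by exists N.
have [t [tab Xt]] := h m I.
apply: le_trans (cmin t _) _; first by rewrite in_itv.
by move: Xt; rewrite ltrN2 => Xt; rewrite (le_trans (ltW Xt))// ltW.
Qed.

End PathEvents.

(** * Euclidean norm and inner product *)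
Section EuclideanFacts.
Context {R : realType}.

Lemma enorm_sqr m n (A : 'M[R]_(m, n)) : enorm A ^+ 2 = \sum_i \sum_j A i j ^+ 2.
Proof.
by rewrite sqr_sqrtr// sumr_ge0// => i _; rewrite sumr_ge0// => j _; rewrite sqr_ge0.
Qed.

Lemma enorm_ge0 m n (A : 'M[R]_(m, n)) : 0 <= enorm A.
Proof. exact: sqrtr_ge0. Qed.

Lemma enorm_cV n (v : 'cV[R]_n) : enorm v ^+ 2 = \sum_i v i ord0 ^+ 2.
Proof. by rewrite enorm_sqr; apply: eq_bigr => i _; rewrite big_ord1. Qed.

Lemma entry_le_enorm m n (A : 'M[R]_(m, n)) i j : `|A i j| <= enorm A.
Proof.
rewrite -(@ler_pXn2r _ 2)// ?nnegrE ?enorm_ge0// real_normK ?num_real// enorm_sqr.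
rewrite (bigD1 i)//= (bigD1 j)//= -addrA lerDl addr_ge0// sumr_ge0// => k _.
  by rewrite sqr_ge0.
by rewrite sumr_ge0// => l _; rewrite sqr_ge0.
Qed.

Lemma mx_norm_leP m n (A : 'M[R]_(m, n)) c : 0 <= c ->
  (`|A| <= c) <-> (forall i j, `|A i j| <= c).
Proof.
move=> c0; rewrite [`|A|]mx_normrE; split=> [h i j|h].
  by apply: le_trans h; apply: (le_bigmax _ (fun i : 'I_m * 'I_n => `|A i.1 i.2|) (i, j)).
by apply: bigmax_le => // -[i j] _; exact: h.
Qed.

Lemma entry_le_norm m n (A : 'M[R]_(m, n)) i j : `|A i j| <= `|A|.
Proof. by have [+ _] := mx_norm_leP A (normr_ge0 A); apply. Qed.

Lemma norm_le_enorm m n (A : 'M[R]_(m, n)) : `|A| <= enorm A.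
Proof. by apply/mx_norm_leP => [|i j]; [exact: enorm_ge0|exact: entry_le_enorm]. Qed.

Lemma enorm_le_sum m n (A : 'M[R]_(m, n)) : enorm A <= \sum_i \sum_j `|A i j|.
Proof.
have s0 : 0 <= \sum_i \sum_j `|A i j| by rewrite sumr_ge0// => i _; rewrite sumr_ge0.
rewrite -(@ler_pXn2r _ 2)// ?nnegrE ?enorm_ge0// enorm_sqr.
have sq (I : finType) (a : I -> R) : (forall i, 0 <= a i) ->
    \sum_i a i ^+ 2 <= (\sum_i a i) ^+ 2.
  move=> a0; rewrite [leRHS]expr2 mulr_suml; apply: ler_sum => i _.
  rewrite expr2 ler_wpM2l// (bigD1 i)//= lerDl sumr_ge0//.
apply: le_trans (sq _ (fun i => \sum_j `|A i j|) _); last by move=> i; rewrite sumr_ge0.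
apply: ler_sum => i _; apply: le_trans (sq _ (fun j => `|A i j|) _) => //.
by apply: ler_sum => j _; rewrite real_normK ?num_real.
Qed.

Lemma enorm_le_norm m n (A : 'M[R]_(m, n)) : enorm A <= (m * n)%:R * `|A|.
Proof.
apply: le_trans (enorm_le_sum A) _.
apply: (@le_trans _ _ (\sum_(i < m) \sum_(j < n) `|A|)).
  by apply: ler_sum => i _; apply: ler_sum => j _; exact: entry_le_norm.
by rewrite !sumr_const !card_ord -mulrnA mulr_natl mulnC.
Qed.

Lemma enorm0 m n : enorm (0 : 'M[R]_(m, n)) = 0.
Proof.
apply/eqP; rewrite eq_le enorm_ge0 andbT.
by apply: le_trans (enorm_le_norm _) _; rewrite normr0 mulr0.
Qed.

Lemma enormN m n (A : 'M[R]_(m, n)) : enorm (- A) = enorm A.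
Proof.
rewrite /enorm; congr (Num.sqrt _); apply: eq_bigr => i _; apply: eq_bigr => j _.
by rewrite mxE sqrrN.
Qed.

Lemma enormBC m n (A B : 'M[R]_(m, n)) : enorm (A - B) = enorm (B - A).
Proof. by rewrite -enormN opprB. Qed.

Lemma enormZ m n c (A : 'M[R]_(m, n)) : enorm (c *: A) = `|c| * enorm A.
Proof.
apply/eqP; rewrite -(@eqrXn2 _ 2)// ?enorm_ge0 ?mulr_ge0 ?enorm_ge0//.
rewrite exprMn real_normK ?num_real// !enorm_sqr mulr_sumr; apply/eqP.
apply: eq_bigr => i _; rewrite mulr_sumr; apply: eq_bigr => j _.
by rewrite mxE exprMn.
Qed.

Lemma edotC n (u v : 'cV[R]_n) : edot u v = edot v u.
Proof. by apply: eq_bigr => i _; rewrite mulrC. Qed.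

Lemma edotDr n (u v w : 'cV[R]_n) : edot u (v + w) = edot u v + edot u w.
Proof. by rewrite /edot -big_split; apply: eq_bigr => i _; rewrite mxE mulrDr. Qed.

Lemma edotZr n c (u v : 'cV[R]_n) : edot u (c *: v) = c * edot u v.
Proof. by rewrite /edot mulr_sumr; apply: eq_bigr => i _; rewrite mxE mulrCA. Qed.

Lemma edotNr n (u v : 'cV[R]_n) : edot u (- v) = - edot u v.
Proof. by rewrite -scaleN1r edotZr mulN1r. Qed.

Lemma edotBr n (u v w : 'cV[R]_n) : edot u (v - w) = edot u v - edot u w.
Proof. by rewrite edotDr edotNr. Qed.

Lemma edotDl n (u v w : 'cV[R]_n) : edot (u + v) w = edot u w + edot v w.
Proof. by rewrite edotC edotDr !(edotC w). Qed.

Lemma edotNl n (u v : 'cV[R]_n) : edot (- u) v = - edot u v.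
Proof. by rewrite edotC edotNr edotC. Qed.

Lemma edotBl n (u v w : 'cV[R]_n) : edot (u - v) w = edot u w - edot v w.
Proof. by rewrite edotDl edotNl. Qed.

Lemma edotZl n c (u v : 'cV[R]_n) : edot (c *: u) v = c * edot u v.
Proof. by rewrite edotC edotZr edotC. Qed.

Lemma edotvv n (u : 'cV[R]_n) : edot u u = enorm u ^+ 2.
Proof. by rewrite enorm_cV; apply: eq_bigr => i _; rewrite expr2. Qed.

Lemma enormD_sqr n (u v : 'cV[R]_n) :
  enorm (u + v) ^+ 2 = enorm u ^+ 2 + 2 * edot u v + enorm v ^+ 2.
Proof. by rewrite -!edotvv edotDl !edotDr (edotC v u); ring. Qed.

Lemma cauchy_schwarz n (u v : 'cV[R]_n) : edot u v <= enorm u * enorm v.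
Proof.
have [u0|u0] := eqVneq (enorm u) 0.
  have -> : u = 0.
    apply/matrixP => i j; rewrite mxE; apply/eqP; rewrite -normr_le0 -u0.
    exact: entry_le_enorm.
  by rewrite enorm0 mul0r /edot big1// => i _; rewrite mxE mul0r.
have [v0|v0] := eqVneq (enorm v) 0.
  have -> : v = 0.
    apply/matrixP => i j; rewrite mxE; apply/eqP; rewrite -normr_le0 -v0.
    exact: entry_le_enorm.
  by rewrite enorm0 mulr0 /edot big1// => i _; rewrite mxE mulr0.
have ug : 0 < enorm u by rewrite lt_neqAle eq_sym u0 enorm_ge0.
have vg : 0 < enorm v by rewrite lt_neqAle eq_sym v0 enorm_ge0.
have := sqr_ge0 (enorm (enorm v *: u + - (enorm u *: v))).
rewrite enormD_sqr enormN !enormZ edotNr edotZl edotZr !ger0_norm ?enorm_ge0// => h.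
rewrite -(ler_pM2l (mulr_gt0 ug vg)) -subr_ge0.
rewrite -(@pmulr_rge0 _ 2)//; apply: le_trans h _.
by rewrite le_eqVlt; apply/orP; left; apply/eqP; ring.
Qed.

Lemma cauchy_schwarz_norm n (u v : 'cV[R]_n) : `|edot u v| <= enorm u * enorm v.
Proof.
rewrite ler_norml cauchy_schwarz andbT lerNl -edotNr.
by apply: le_trans (cauchy_schwarz _ _) _; rewrite enormN.
Qed.

Lemma enormD n (u v : 'cV[R]_n) : enorm (u + v) <= enorm u + enorm v.
Proof.
rewrite -(@ler_pXn2r _ 2)// ?nnegrE ?addr_ge0 ?enorm_ge0// enormD_sqr.
by have := cauchy_schwarz u v; nra.
Qed.

Lemma enorm_dist n (u v : 'cV[R]_n) : `|enorm u - enorm v| <= enorm (u - v).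
Proof.
rewrite ler_norml; apply/andP; split.
  have := enormD u (v - u); rewrite addrCA subrr addr0 enormBC; lra.
by have := enormD v (u - v); rewrite addrCA subrr addr0; lra.
Qed.

Lemma enormD_sqr_le m n (A B : 'M[R]_(m, n)) :
  enorm (A + B) ^+ 2 <= 2 * enorm A ^+ 2 + 2 * enorm B ^+ 2.
Proof.
rewrite !enorm_sqr !mulr_sumr -big_split; apply: ler_sum => i _ /=.
rewrite !mulr_sumr -big_split; apply: ler_sum => j _ /=.
by rewrite mxE; have := sqr_ge0 (A i j - B i j); nra.
Qed.

End EuclideanFacts.

(** * Almost sure approximation of the stochastic integral *)
Section PathOperations.
Context {R : realType}.
Implicit Types f g : R -> R^o.

Lemma pcont_cst (c : R) : pcont (fun=> c : R^o).
Proof. by move=> t t0 e e0; exists 1 => // s s0 st; rewrite subrr normr0. Qed.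

Lemma pcontD f g : pcont f -> pcont g -> pcont (fun t => f t + g t : R^o).
Proof.
move=> cf cg t t0 e e0.
have [d1 d10 h1] := cf t t0 _ (divr_gt0 e0 (ltr0n _ 2)).
have [d2 d20 h2] := cg t t0 _ (divr_gt0 e0 (ltr0n _ 2)).
exists (Num.min d1 d2) => [|s s0]; first by rewrite lt_min d10.
rewrite lt_min => /andP[st1 st2]; rewrite opprD addrACA (splitr e).
by rewrite (le_lt_trans (ler_normD _ _))// ltrD ?h1 ?h2.
Qed.

Lemma pcontZ f (c : R) : pcont f -> pcont (fun t => c * f t : R^o).
Proof.
move=> cf t t0 e e0.
have c0 : 0 < `|c| + 1 by rewrite ltr_wpDl.
have [d d0 h] := cf t t0 _ (divr_gt0 e0 c0); exists d => // s s0 st.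
rewrite -mulrBr normrM; have := h s s0 st; rewrite ltr_pdivlMr// => h'.
apply: le_lt_trans h'; rewrite mulrC ler_wpM2l//.
by rewrite lerDl.
Qed.

Lemma pcontB f g : pcont f -> pcont g -> pcont (fun t => f t - g t : R^o).
Proof.
move=> cf cg; apply: pcontD => //.
have -> : (fun t => - g t : R^o) = (fun t => -1 * g t) by apply/funext => t; rewrite mulN1r.
exact: pcontZ.
Qed.

Lemma pcont_sum (I : Type) (s : seq I) (f : I -> R -> R^o) :
  (forall i, pcont (f i)) -> pcont (fun t => \sum_(i <- s) f i t : R^o).
Proof.
move=> cf; elim: s => [|i s IH].
  by under eq_fun do rewrite big_nil; exact: pcont_cst.
by under eq_fun do rewrite big_cons; exact: pcontD.
Qed.

Lemma pcont_min f (c : R) : 0 <= c -> pcont f -> pcont (fun t => f (Num.min c t) : R^o).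
Proof.
move=> c0 cf t t0 e e0.
have [|d d0 h] := cf (Num.min c t) _ e e0; first by rewrite le_min c0.
exists d => // s s0 st; apply: h; first by rewrite le_min c0.
apply: le_lt_trans st; rewrite /Num.min.
case: (ltP c s) => cs; case: (ltP c t) => ct; rewrite ?subrr ?normr0// ?lexx//.
  by rewrite !ger0_norm; lra.
by rewrite !ler0_norm; lra.
Qed.

Lemma pcont_entry m n (f : R -> 'M[R]_(m, n)) i j : pcont f ->
  pcont (fun t => f t i j : R^o).
Proof.
move=> cf t t0 e e0; have [d d0 h] := cf t t0 e e0; exists d => // s s0 st.
have -> : f s i j - f t i j = (f s - f t) i j by rewrite !mxE.
exact: le_lt_trans (entry_le_norm _ _ _) (h s s0 st).
Qed.

Lemma pcont_enorm n (f : R -> 'cV[R]_n) :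
  (forall i, pcont (fun t => f t i ord0 : R^o)) -> pcont (fun t => enorm (f t) : R^o).
Proof.
move=> cf t t0 e e0.
pose v := fun s => \sum_i \sum_(j < 1) `|(f s - f t) i j|.
suff [d d0 h] : exists2 d, 0 < d & forall s, 0 <= s -> `|s - t| < d -> v s < e.
  exists d => // s s0 st; apply: le_lt_trans (h s s0 st).
  exact: le_trans (enorm_dist _ _) (enorm_le_sum _).
have cv : pcont (fun s => v s : R^o).
  apply: pcont_sum => i.
  under eq_fun do rewrite big_ord1 !mxE.
  move=> u u0 e' e'0; have [d d0 h] := cf i u u0 e' e'0; exists d => // s s0 su.
  apply: le_lt_trans (h s s0 su); apply: le_trans (ler_dist_dist _ _) _.
  by rewrite opprD addrACA subrr addr0.
have vt : v t = 0.
  by rewrite /v big1// => i _; rewrite big1// => j _; rewrite subrr mxE normr0.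
have [d d0 h] := cv t t0 e e0; exists d => // s s0 st.
by have := h s s0 st; rewrite vt subr0; apply: le_lt_trans; rewrite ler_norm.
Qed.

End PathOperations.

Section ItoApproximation.
Context {R : realType} {disp : measure_display} {Omega : measurableType disp}.
Variables (P : probability Omega R) (F : R -> set (set Omega)).
Hypothesis uF : usual_filtration P F.

Lemma null_measurable N : P.-negligible N -> measurable N.
Proof.
by move=> /(filtration_null uF (lexx 0)); exact: (filtration_measurable uF (lexx 0)).
Qed.

(** The index [phi k] is chosen so that [X] or [Y] exceeds [k.+1%:R^-1] with probability at
    most [2 ^- k.+1]; the Borel-Cantelli lemma then applies. *)
Lemma cvg0_probability_subseq (X Y : nat -> Omega -> \bar R) :
  (forall n (e : R), measurable [set w | e%:E < X n w]%E) ->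
  (forall n (e : R), measurable [set w | e%:E < Y n w]%E) ->
  cvg0_in_probability P X -> cvg0_in_probability P Y ->
  exists phi : nat -> nat, \forall w \ae P, forall e : R, 0 < e ->
    exists N, forall n, (N <= n)%N -> (X (phi n) w <= e%:E)%E /\ (Y (phi n) w <= e%:E)%E.
Proof.
move=> mX mY cX cY.
pose B k n := [set w | (k.+1%:R^-1)%:E < X n w]%E `|` [set w | (k.+1%:R^-1)%:E < Y n w]%E.
have mB k n : measurable (B k n) by exact: measurableU.
have choose k : exists n, (P (B k n) <= (1 / (2 ^ k.+1)%:R)%:E)%E.
  have c0 : 0 < 1 / (2 ^ k.+1)%:R / 2 :> R by rewrite !divr_gt0// ltr0n expn_gt0.
  have k0 : 0 < k.+1%:R^-1 :> R by rewrite invr_gt0 ltr0n.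
  have small (Z : nat -> Omega -> \bar R) : cvg0_in_probability P Z ->
      \forall n \near \oo, (P [set w | (k.+1%:R^-1)%:E < Z n w] < (1 / (2 ^ k.+1)%:R / 2)%:E)%E.
    move=> /(_ _ k0) h.
    apply: (h [set x | x < (1 / (2 ^ k.+1)%:R / 2)%:E]%E); apply: open_nbhs_nbhs; split.
      exact: open_ereal_lt_ereal.
    by rewrite /= lte_fin.
  have [n [h1 h2]] : exists n,
      (P [set w | (k.+1%:R^-1)%:E < X n w] < (1 / (2 ^ k.+1)%:R / 2)%:E)%E /\
      (P [set w | (k.+1%:R^-1)%:E < Y n w] < (1 / (2 ^ k.+1)%:R / 2)%:E)%E.
    near \oo => n; exists n; split; near: n; exact: small.
  exists n; apply: le_trans (measureU2 _ _ _) _ => //.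
  by rewrite (splitr (1 / _)) EFinD leeD// ltW.
have [phi Pphi] := choice choose.
exists phi; pose L := lim_sup_set (fun k => B k (phi k)).
have L0 : P L = 0.
  apply: lim_sup_set_cvg0 => [k|]; first exact: mB.
  apply: (@le_lt_trans _ _ 1%:E); last exact: ltry.
  apply: le_trans (@epsilon_trick0 R 1 xpredT ler01).
  by apply: lee_nneseries => // n _; exact: Pphi.
have mL : measurable L.
  apply: bigcapT_measurable => k; apply: bigcup_measurable => j _; exact: mB.
apply: (negligibleS (A := L)); last exact/negligibleP.
move=> w /= Pw; apply: contrapT => Lw; apply: Pw => e e0.
have [k0 Bk0] : exists k0, forall k, (k0 <= k)%N -> ~ B k (phi k) w.
  apply: contrapT => h; apply: Lw => k _; apply: contrapT => h'; apply: h.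
  by exists k => j kj Bj; apply: h'; exists j.
have [m me] : exists m : nat, m.+1%:R^-1 < e.
  have /cvgrPdist_lt/(_ e e0) := @cvg_harmonic R.
  case=> N _ /(_ N (leqnn N)); rewrite /= sub0r normrN ger0_norm ?invr_ge0// => h'.
  by exists N.
exists (maxn k0 m) => n; rewrite geq_max => /andP[k0n mn].
have ne : n.+1%:R^-1 <= e.
  by rewrite (le_trans _ (ltW me))// lef_pV2 ?posrE ?ltr0n// ler_nat ltnS.
split; rewrite leNgt; apply/negP => he; apply: (Bk0 _ k0n); [left|right];
  by rewrite /=; apply: le_lt_trans he; rewrite lee_fin.
Unshelve. all: by end_near. Qed.

Variables (J K : nat) (W : R -> Omega -> 'cV[R]_K).
Hypothesis aW : adapted F W.
Hypothesis cW : \forall w \ae P, pcont (W ^~ w).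
Implicit Types S : simple_process F J K.

Lemma sp_time_ge0' S i : 0 <= sp_time S i.
Proof.
elim: i => [|i IH]; first exact: sp_time_ge0.
exact: le_trans (sp_time_le S i).
Qed.

Lemma sp_coef_smeas S i k l : smeas (F (sp_time S i)) (fun w => sp_coef S i w k l).
Proof.
apply/(smeasP (filtration_sigma uF (sp_time_ge0' S i))) => B mB.
exact: (@sp_coef_meas _ _ _ _ _ _ S i k l B mB).
Qed.

Lemma sp_coef_measurable S i k l : measurable_fun setT (fun w => sp_coef S i w k l).
Proof. exact: (Fsmeas_measurable uF (sp_time_ge0' S i) (@sp_coef_smeas S i k l)). Qed.

Lemma sp_valE S s w k l : sp_val S s w k l =
  \sum_(i < sp_size S) (\1_(`]sp_time S i, sp_time S i.+1]) s : R) * sp_coef S i w k l.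
Proof. by rewrite /sp_val summxE; apply: eq_bigr => i _; rewrite mxE. Qed.

Lemma sp_integralE S t w j : sp_integral S W t w j ord0 =
  \sum_(i < sp_size S) \sum_k sp_coef S i w j k *
    (W (Num.min (sp_time S i.+1) t) w k ord0 - W (Num.min (sp_time S i) t) w k ord0).
Proof.
rewrite /sp_integral summxE; apply: eq_bigr => i _; rewrite mxE.
by apply: eq_bigr => k _; rewrite !mxE.
Qed.

Lemma measurable_W t k : 0 <= t -> measurable_fun setT (fun w => W t w k ord0).
Proof.
move=> t0; apply: (Fsmeas_measurable uF t0).
by apply/(smeasP (filtration_sigma uF t0)) => B mB; exact: aW.
Qed.

Lemma sp_integral_measurable S t j : 0 <= t ->
  measurable_fun setT (fun w => sp_integral S W t w j ord0).
Proof.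
move=> t0; under eq_fun do rewrite sp_integralE.
apply: measurable_sum => i; apply: measurable_sum => k.
apply: measurable_funM; first exact: sp_coef_measurable.
by apply: measurable_funB; apply: measurable_W; rewrite le_min sp_time_ge0'.
Qed.

Lemma sp_integral_pcont S w j : pcont (W ^~ w) ->
  pcont (fun t => sp_integral S W t w j ord0 : R^o).
Proof.
move=> cWw; under eq_fun do rewrite sp_integralE.
apply: pcont_sum => i; apply: pcont_sum => k; apply: pcontZ.
by apply: pcontB; apply: (@pcont_min _ (fun s => W s w k ord0));
  [exact: sp_time_ge0'|exact: pcont_entry|exact: sp_time_ge0'|exact: pcont_entry].
Qed.

Lemma enorm_measurable n (v : Omega -> 'cV[R]_n) :
  (forall i, measurable_fun setT (fun w => v w i ord0)) ->
  measurable_fun setT (fun w => enorm (v w)).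
Proof.
move=> mv; rewrite /enorm.
have ms : measurable_fun setT (fun x : R => Num.sqrt x).
  by apply: continuous_measurable_fun; exact: sqrt_continuous.
apply: (measurableT_comp ms); apply: measurable_sum => i; under eq_fun do rewrite big_ord1.
exact: measurable_funX.
Qed.

Variables (I : R -> Omega -> 'cV[R]_J).
Hypothesis aI : adapted F I.
Hypothesis cI : \forall w \ae P, pcont (I ^~ w).

Lemma measurable_I t k : 0 <= t -> measurable_fun setT (fun w => I t w k ord0).
Proof.
move=> t0; apply: (Fsmeas_measurable uF t0).
by apply/(smeasP (filtration_sigma uF t0)) => B mB; exact: aI.
Qed.

(** By continuity of the paths, the supremum exceeds [e] iff some time does. *)
Lemma ito_sup_measurable S T (e : R) :
  measurable [set w | e%:E < ereal_sup [set (enorm (sp_integral S W t w - I t w))%:E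
     | t in `[0%R, T]]]%E.
Proof.
have := @path_exceeds R _ _ P (@measurable _ Omega) (@sigma_algebra_measurable _ Omega)
  null_measurable (fun t w => enorm (sp_integral S W t w - I t w)) 0 T e (lexx 0).
set A := [set w | exists t, _]; set B := [set w | _] => h.
suff <- : A = B.
  apply: h.
    move=> t /andP[t0 _].
    suff h : measurable_fun setT (fun w => enorm (sp_integral S W t w - I t w)).
      apply/(smeasP (@sigma_algebra_measurable _ Omega)) => C mC.
      by rewrite -[_ @^-1` _]setTI; exact: h.
    apply: enorm_measurable => i; under eq_fun do rewrite !mxE.
    by apply: measurable_funB; [exact: sp_integral_measurable|exact: measurable_I].
  apply: filterS2 cW cI => w cWw cIw; apply: pcont_enorm => i.
  under eq_fun do rewrite !mxE.
  by apply: pcontB; [exact: sp_integral_pcont|exact: pcont_entry].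
apply/seteqP; split=> w.
  move=> [t [tT et]]; apply: (@lt_le_trans _ _ (enorm (sp_integral S W t w - I t w))%:E).
    by rewrite lte_fin.
  by apply: ereal_sup_ubound; exists t => //=; rewrite in_itv.
move=> /ereal_sup_gt[y [t + <-]]; rewrite /= in_itv /= => tT.
by rewrite lte_fin => et; exists t.
Qed.

Variables (H : R -> Omega -> 'M[R]_(J, K)).
Hypothesis mH : forall t i j, 0 <= t -> measurable_fun setT (fun w => H t w i j).
Hypothesis cH : \forall w \ae P, forall i j, pcont (fun t => H t w i j : R^o).

(** Both processes are jointly measurable up to a null set, so that the inner
    integral is measurable by Tonelli's theorem. *)
Lemma ito_L2_measurable S T :
  measurable_fun setT (fun w => \int[lebesgue_measure]_(s in `[0%R, T])
    ((enorm (sp_val S s w - H s w)) ^+ 2)%:E)%E.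
Proof.
have HY (p : 'I_J * 'I_K) : exists Y : Omega * measurableTypeR R -> R,
    measurable_fun setT Y /\
    \forall w \ae P, forall s, 0 <= s <= T -> Y (w, s) = H s w p.1 p.2.
  apply: (@joint_measurable _ _ _ P null_measurable (fun t w => H t w p.1 p.2) T).
    by move=> t t0; exact: mH.
  by apply: filterS cH => w cHw; apply/(@within_pcont R R^o); exact: cHw.
have [Y HY'] := choice HY.
pose f (p : Omega * measurableTypeR R) : \bar R := (\1_(`[0%R, T]) p.2 *
  \sum_i \sum_j (\sum_(k < sp_size S) (\1_(`]sp_time S k, sp_time S k.+1]) p.2 : R) *
     sp_coef S k p.1 i j - Y (i, j) p) ^+ 2)%:E.
have mI (D : interval R) :
    measurable_fun setT (fun p : Omega * measurableTypeR R => \1_[set` D] p.2 : R).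
  have m1 : measurable_fun setT (\1_[set` D] : measurableTypeR R -> R).
    by apply: measurable_indic; exact: measurable_itv.
  exact: (measurableT_comp m1 measurable_snd).
have mf : measurable_fun setT f.
  apply/measurable_EFinP/measurable_funM; first exact: mI.
  apply: measurable_sum => i; apply: measurable_sum => j; apply: measurable_funX.
  apply: measurable_funB; last by case: (HY' (i, j)).
  apply: measurable_sum => k; apply: measurable_funM; first exact: mI.
  exact: (measurableT_comp (@sp_coef_measurable S k i j) measurable_fst).
have f0 p : (0 <= f p)%E.
  rewrite lee_fin mulr_ge0// ?sumr_ge0// => i _.
  by rewrite sumr_ge0// => j _; rewrite sqr_ge0.
have := @measurable_fun_fubini_tonelli_F _ _ Omega (measurableTypeR R) R (@lebesgue_measure R) f mf f0.
move=> mg; apply: (measurable_ae_eq null_measurable mg).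
have : \forall w \ae P, forall p : 'I_J * 'I_K, forall s, 0 <= s <= T -> Y p (w, s) = H s w p.1 p.2.
  by apply: filter_forall => p; case: (HY' p).
apply: filterS => w Yw; rewrite /fubini_F [LHS]integral_mkcond.
apply: eq_integral => s _; rewrite /patch /f /= indicE.
case: ifPn => sT; last by rewrite mul0r.
rewrite mul1r enorm_sqr; congr (_%:E); apply: eq_bigr => i _; apply: eq_bigr => j _.
rewrite !mxE (Yw (i, j))//; last by move/set_mem: sT; rewrite /= in_itv.
by rewrite sp_valE.
Qed.

Lemma ito_approx T : 0 < T -> ito_integral P F W H I ->
  exists S : nat -> simple_process F J K, \forall w \ae P, forall e : R, 0 < e ->
    exists N, forall n, (N <= n)%N ->
      (\int[lebesgue_measure]_(s in `[0%R, T])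
         ((enorm (sp_val (S n) s w - H s w)) ^+ 2)%:E <= e%:E)%E /\
      (forall t, 0 <= t <= T -> enorm (sp_integral (S n) W t w - I t w) <= e).
Proof.
move=> T0 [_ _ [S /(_ T T0)[c1 c2]]].
have [||phi hphi] := cvg0_probability_subseq _ _ c1 c2.
- move=> n e; set B := [set w | _].
  have h := ito_L2_measurable (S n) T measurableT (emeasurable_itv `]e%:E, +oo[).
  have AB A : measurable A -> A = B -> measurable B by move=> mA <-.
  rewrite setTI in h; apply: AB h _.
  by apply/seteqP; split=> w; rewrite /B /= in_itv /= andbT.
- move=> n e; exact: ito_sup_measurable.
exists (S \o phi); apply: filterS hphi => w h e e0; have [N hN] := h e e0.
exists N => n Nn; have [h1 h2] := hN n Nn; split=> // t tT.
rewrite -lee_fin; apply: le_trans h2; apply: ereal_sup_ubound.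
by exists t => //=; rewrite in_itv.
Qed.

End ItoApproximation.

(** * Grids, stopping times and stopped processes *)
Section Grids.
Context {R : realType}.

(** A predictable cut-off turns a telescoping sum into one stopped at a random index. *)
Lemma stopped_sum (f : nat -> R) (p : pred nat) n : (forall i, p i.+1 -> p i) ->
  exists k, [/\ (k <= n)%N, forall i, (i < k)%N -> p i, (k < n)%N -> ~~ p k &
    \sum_(i < n) (if p i then f i.+1 - f i else 0) = f k - f 0%N].
Proof.
move=> pd.
have pd' i j : (i <= j)%N -> p j -> p i.
  elim: j => [|j IH]; first by rewrite leqn0 => /eqP ->.
  by rewrite leq_eqVlt => /predU1P[->//|/IH h /pd]; exact: h.
elim: n => [|n [k [kn pk npk IH]]].
  by exists 0%N; split=> //; rewrite big_ord0 subrr.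
rewrite big_ord_recr /= IH.
move: kn; rewrite leq_eqVlt => /predU1P[kn|kn].
  case: ifPn => pn; last first.
    exists k; split=> //; [by rewrite kn|by move=> _; rewrite kn|by rewrite addr0].
  exists n.+1; split=> //; last by rewrite kn addrC subrKA.
    by move=> i; rewrite ltnS => /pd'; exact.
  by rewrite ltnn.
have npn : p n = false.
  by apply/negbTE; apply: contra (npk kn); apply: pd'; exact: ltnW.
rewrite npn addr0; exists k; split=> //; first exact: leqW (ltnW kn).
by move=> _; exact: npk.
Qed.

(** The points of [L] are inserted one at a time: each interval [[u k, u k.+1]] is cut
    at the point [x] clamped to it, which doubles the number of intervals. *)
Lemma grid_exists (L : seq R) s t d : s <= t -> 0 < d ->
  exists (u : nat -> R) (n : nat), [/\ u 0%N = s, u n = t,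
    (forall i, u i <= u i.+1 /\ u i.+1 - u i <= d),
    (forall i, s <= u i <= t) &
    forall x, x \in L -> forall i, ~ (u i < x < u i.+1)].
Proof.
move=> st d0; elim: L => [|x L [u [n [u0 un ud ust uL]]]].
  pose m := (Num.truncn ((t - s) / d)).+1.
  have m0 : 0 < m%:R :> R by rewrite ltr0n.
  pose h := (t - s) / m%:R.
  have h0 : 0 <= h by rewrite divr_ge0// subr_ge0.
  have hd : h <= d.
    rewrite ler_pdivrMr// mulrC -ler_pdivrMr//.
    by rewrite ltW// truncnS_gt.
  exists (fun i => s + h * (minn i m)%:R), m; split=> //.
  - by rewrite min0n mulr0 addr0.
  - by rewrite minnn /h divfK ?gt_eqF// addrC subrK.
  - move=> i; rewrite lerD2l opprD addrACA subrr add0r -mulrBr.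
    have [mi|im] := leqP m i.
      by rewrite !(minn_idPr _)// ?subrr ?mulr0 ?(ltW d0)// ltnW.
    rewrite (minn_idPl im).
    by rewrite ler_wpM2l ?ler_nat// -natrB// subSnn mulr1.
  - move=> i; rewrite lerDl mulr_ge0//= -lerBrDl -[leRHS](divfK (lt0r_neq0 m0)).
    by rewrite ler_wpM2l// ler_nat geq_minr.
pose c k := Num.max (u k) (Num.min x (u k.+1)).
have ck k : u k <= c k <= u k.+1.
  by rewrite /c le_max lexx /= ge_max ge_min lexx orbT andbT; case: (ud k).
exists (fun i => if odd i then c i./2 else u i./2), n.*2; split=> //.
- by rewrite odd_double doubleK.
- move=> i /=; rewrite uphalf_half; case: (odd i) => /=; have /andP[h1 h2] := ck i./2;
    have [_ h3] := ud i./2; split=> //; rewrite ?add1n ?add0n//; lra.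
- move=> i; case: (odd i) => //; have /andP[h1 h2] := ck i./2.
  have /andP[h3 _] := ust i./2; have /andP[_ h4] := ust (i./2).+1.
  by rewrite (le_trans h3 h1) (le_trans h2 h4).
- move=> y; rewrite inE => /predU1P[->|yL] i /=; rewrite uphalf_half; have /andP[h1 h2] := ck i./2.
    case: (odd i) => /=; rewrite ?add1n ?add0n => /andP[]; rewrite /c.
      rewrite gt_max gt_min => /andP[ux /orP[]]; first by rewrite ltxx.
      by move=> /lt_trans h /h; rewrite ltxx.
    move=> ux; rewrite lt_max => /orP[/lt_trans /(_ ux)|]; first by rewrite ltxx.
    by rewrite lt_min ltxx.
  move=> h; apply: (uL y yL i./2); move: h.
  case: (odd i) => /=; rewrite ?add1n ?add0n => /andP[h3 h4].
    by rewrite (le_lt_trans h1 h3).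
  by rewrite h3 (lt_le_trans h4).
Qed.

Lemma tminE (t : R) (x : \bar R) : (t%:E <= x)%E -> tmin t x = t.
Proof. by rewrite /tmin => h; rewrite min_l. Qed.

Lemma tminE_lt (t : R) (x : \bar R) : (0 <= x)%E -> (x <= t%:E)%E ->
  ((tmin t x)%:E = x)%E.
Proof.
rewrite /tmin => x0 h; rewrite min_r// fineK// ge0_fin_numE//.
by rewrite (le_lt_trans h)// ltry.
Qed.

Lemma tmin_ge0 (t : R) (x : \bar R) : 0 <= t -> (0 <= x)%E -> 0 <= tmin t x.
Proof. by move=> t0 x0; apply: fine_ge0; rewrite le_min lee_fin t0. Qed.

Lemma tmin_le (t : R) (x : \bar R) : (0 <= x)%E -> tmin t x <= t.
Proof.
move=> x0; case: (leP (t%:E)%E x) => [/tminE ->//|/ltW h].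
by rewrite -lee_fin tminE_lt.
Qed.

Lemma tmin_lex (t : R) (x : \bar R) : (0 <= x)%E -> ((tmin t x)%:E <= x)%E.
Proof.
move=> x0; case: (leP (t%:E)%E x) => [h|/ltW h]; first by rewrite tminE.
by rewrite tminE_lt.
Qed.

Lemma tmin_mono (s t : R) (x : \bar R) : s <= t -> (0 <= x)%E -> tmin s x <= tmin t x.
Proof.
move=> st x0; case: (leP (t%:E)%E x) => [h|/ltW h].
  by rewrite (tminE h) (le_trans (tmin_le _ _)).
rewrite -lee_fin (tminE_lt x0 h); exact: tmin_lex.
Qed.

Definition clamp (s t : R) (x : \bar R) : R := Num.max s (tmin t x).

(** The stopped increment as an increment from the deterministic time [s]. *)
Lemma clamp_stop (s t : R) (x : \bar R) (T : zmodType) (f : R -> T) : s <= t ->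
  (0 <= x)%E -> f (tmin t x) - f (tmin s x) = f (clamp s t x) - f s.
Proof.
move=> st x0; rewrite /clamp; case: (leP x s%:E) => h.
  have ht : (x <= t%:E)%E by apply: le_trans h _; rewrite lee_fin.
  have -> : tmin t x = tmin s x by apply: EFin_inj; rewrite !tminE_lt.
  by rewrite max_l ?tmin_le// !subrr.
rewrite (tminE (ltW h)) max_r//.
have [tx|xt] := leP t%:E x; first by rewrite tminE.
by rewrite -lee_fin (tminE_lt x0 (ltW xt)) ltW.
Qed.

Lemma clamp_le (s t : R) (x : \bar R) : s <= t -> (0 <= x)%E -> s <= clamp s t x <= t.
Proof. by move=> st x0; rewrite /clamp le_max lexx ge_max st tmin_le. Qed.

Lemma clamp_lt (s t u : R) (x : \bar R) : (0 <= x)%E -> s <= u -> u < clamp s t x ->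
  (u%:E < x)%E.
Proof.
move=> x0 su; rewrite /clamp lt_max ltNge su /= => h.
by apply: lt_le_trans (tmin_lex t x0); rewrite lte_fin.
Qed.

(** The first grid point that is not before [x] is within one mesh of [x] clamped to
    the range of the grid. *)
Lemma grid_stop (u : nat -> R) (n k : nat) (x : \bar R) d : (0 <= x)%E ->
  (forall i, u i <= u i.+1 /\ u i.+1 - u i <= d) -> (forall i, u 0%N <= u i <= u n) ->
  0 <= d ->
  (k <= n)%N -> (forall i, (i < k)%N -> ((u i)%:E < x)%E) ->
  ((k < n)%N -> ~~ ((u k)%:E < x)%E) ->
  `|u k - clamp (u 0%N) (u n) x| <= d.
Proof.
move=> x0 ud ub d0 kn pk npk.
have u0n : u 0%N <= u n by case/andP: (ub 0%N).
have [k0|k0] := posnP k.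
  rewrite k0 in kn pk npk *.
  move: kn; rewrite leq_eqVlt => /predU1P[<-|kn].
    by rewrite /clamp max_l ?subrr ?normr0 ?tmin_le.
  have := npk kn; rewrite -leNgt => xu.
  rewrite /clamp max_l ?subrr ?normr0//.
  by rewrite -lee_fin (tminE_lt x0)// (le_trans xu)// lee_fin.
have pk1 := pk k.-1; rewrite prednK// in pk1; have {}pk1 := pk1 (leqnn _).
have [_ dk] := ud k.-1; rewrite prednK// in dk.
have /andP[u0k _] := ub k.-1.
have lo : u k.-1 <= clamp (u 0%N) (u n) x.
  rewrite /clamp le_max; apply/orP; right.
  have [h|h] := leP (u n)%:E x; first by rewrite tminE//; case/andP: (ub k.-1).
  by rewrite -lee_fin (tminE_lt x0 (ltW h)) ltW.
have hi : clamp (u 0%N) (u n) x <= u k.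
  rewrite /clamp ge_max; case/andP: (ub k) => -> _ /=.
  move: kn; rewrite leq_eqVlt => /predU1P[->|kn]; first exact: tmin_le.
  have := npk kn; rewrite -leNgt => xu.
  by rewrite -lee_fin (le_trans _ xu)// tmin_lex.
rewrite ger0_norm ?subr_ge0//; lra.
Qed.

End Grids.

Section StoppedProcess.
Context {R : realType} {disp : measure_display} {Omega : measurableType disp}.
Variables (P : probability Omega R) (F : R -> set (set Omega)).
Hypothesis uF : usual_filtration P F.
Variable rho : Omega -> \bar R.
Hypothesis srho : stopping_time F rho.

Lemma stopping_ge0 w : (0 <= rho w)%E. Proof. by case: srho. Qed.

Lemma stopping_lt u : 0 <= u -> F u [set w | (u%:E < rho w)%E].
Proof.
move=> u0; have -> : [set w | (u%:E < rho w)%E] = ~` [set w | (rho w <= u%:E)%E].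
  by apply/seteqP; split=> w /=; [move=> h; rewrite leNgt h|move/negP; rewrite -ltNge].
by apply: (subsigmaC (filtration_sigma uF u0)); case: srho => _; exact.
Qed.

Lemma smeas_stopping u : 0 <= u -> smeas (F u) (fun w => ((u%:E < rho w)%E)%:R : R).
Proof.
move=> u0; have -> : (fun w => ((u%:E < rho w)%E)%:R : R) = \1_[set w | (u%:E < rho w)%E].
  by apply/funext => w; rewrite indicE; congr ((_ : bool)%:R); apply/idP/idP; rewrite inE.
exact: (smeas_indic (filtration_sigma uF u0) (stopping_lt u0)).
Qed.

(** The stopped variable is the limit of the process at the first point of a fine grid
    of [[0, t]] that is not before [rho], which is known at time [t]. *)
Lemma stopped_smeas (X : R -> Omega -> R) t : 0 <= t ->
  (forall s, 0 <= s -> smeas (F s) (X s)) ->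
  (\forall w \ae P, pcont (X ^~ w : R -> R^o)) ->
  smeas (F t) (fun w => X (tmin t (rho w)) w).
Proof.
move=> t0 aX cX.
have hg (m : nat) := @grid_exists R [::] 0 t m.+1%:R^-1 t0 (ltac:(by rewrite invr_gt0 ltr0n)).
have [g hg'] := choice hg; have [N hgN] := choice hg'.
pose Y m w := X 0 w + \sum_(i < N m) ((g m i)%:E < rho w)%E%:R * (X (g m i.+1) w - X (g m i) w).
have mX s : 0 <= s <= t -> smeas (F t) (X s).
  by move=> /andP[s0 st]; apply: (Fsmeas_le uF s0 st); exact: aX.
apply: (smeas_cvg_ae (filtration_sigma uF t0) (filtration_null uF t0) (f := Y)).
  move=> m; have [_ _ _ gt _] := hgN m.
  apply: smeasD; first by apply: mX; rewrite lexx.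
  apply: smeas_sum => i; apply: smeasM; last by apply: smeasB; exact: mX.
  have /andP[g0 gt'] := gt i.
  by apply: (Fsmeas_le uF g0 gt'); exact: smeas_stopping.
apply: filterS cX => w cXw; apply/cvgrPdist_lt => e e0.
have [d d0 hd] := pcont_unif t cXw e0.
have /cvgrPdist_lt/(_ d d0) := @cvg_harmonic R; apply: filterS => m /=.
rewrite sub0r normrN ger0_norm ?invr_ge0// => md.
have [g0 gN gd gt _] := hgN m.
have [|k [kn pk npk sumE]] := @stopped_sum R (fun i => X (g m i) w)
    (fun i => ((g m i)%:E < rho w)%E) (N m).
  by move=> i; apply: le_lt_trans; rewrite lee_fin; case: (gd i).
have -> : Y m w = X (g m k) w.
  rewrite /Y (eq_bigr (fun i : 'I_(N m) => if ((g m i)%:E < rho w)%E then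
    X (g m i.+1) w - X (g m i) w else 0)); last first.
    by move=> i _; case: ifP => _; rewrite ?mul1r ?mul0r.
  by rewrite sumE g0 addrC subrK.
have m0 : 0 <= m.+1%:R^-1 :> R by rewrite invr_ge0.
have gb i : g m 0%N <= g m i <= g m (N m) by rewrite g0 gN; exact: gt.
have := grid_stop (stopping_ge0 w) gd gb m0 kn pk npk.
rewrite g0 gN => close.
have -> : tmin t (rho w) = clamp 0 t (rho w).
  by rewrite /clamp max_r// tmin_ge0// stopping_ge0.
apply: hd.
- by have /andP[] := clamp_le t0 (stopping_ge0 w).
- by case/andP: (gt k) => -> ->.
- by rewrite distrC (le_lt_trans close).
Qed.

Lemma smeas_tmin t : 0 <= t -> smeas (F t) (fun w => tmin t (rho w)).
Proof.
move=> t0; apply: (@stopped_smeas (fun s _ => s)) => // [s s0|]; first exact: smeas_cst.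
by apply: aeW => w s s0 e e0; exists e.
Qed.

End StoppedProcess.

Section SimpleOnGrid.
Context {R : realType} {disp : measure_display} {Omega : measurableType disp}.
Variables (P : probability Omega R) (F : R -> set (set Omega)).
Hypothesis uF : usual_filtration P F.
Variables (J K : nat) (S : simple_process F J K) (a b : R).
Hypothesis ab : a < b.
Hypothesis noS : forall k, (k <= sp_size S)%N -> ~ (a < sp_time S k < b).

Lemma sp_time_out k : (k <= sp_size S)%N -> sp_time S k <= a \/ b <= sp_time S k.
Proof.
move=> kS; case: (leP (sp_time S k) a) => h; first by left.
by right; rewrite leNgt; apply/negP => h'; apply: (noS kS); rewrite h h'.
Qed.

(** On an interval free of jump times a simple process does not move. *)
Lemma sp_val_const s w : a < s <= b -> sp_val S s w = sp_val S b w.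
Proof.
move=> /andP[as_ sb]; apply: eq_bigr => i _; congr (_ *: _).
rewrite !indicE; congr ((_ : bool)%:R); apply/idP/idP; rewrite !inE /= !in_itv /=.
  move=> /andP[h1 h2]; rewrite (lt_le_trans h1 sb) /=.
  by case: (sp_time_out (ltn_ord i)) => // h; have := lt_le_trans as_ (le_trans h2 h); rewrite ltxx.
move=> /andP[h1 h2]; rewrite (le_trans sb h2) andbT.
by case: (sp_time_out (ltnW (ltn_ord i))) => h; [exact: le_lt_trans as_|have := lt_le_trans h1 h; rewrite ltxx].
Qed.

Lemma sp_integral_step (W : R -> Omega -> 'cV[R]_K) w :
  sp_integral S W b w - sp_integral S W a w = sp_val S b w *m (W b w - W a w).
Proof.
rewrite /sp_integral /sp_val -sumrB mulmx_suml; apply: eq_bigr => i _.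
rewrite -mulmxBr -scalemxAl.
have tt := sp_time_le S i.
case: (sp_time_out (ltn_ord i)) => h1.
  have h0 := le_trans tt h1.
  rewrite indicE memNset ?scale0r; last first.
    rewrite /= in_itv /= => /andP[_ h]; have := lt_le_trans ab (le_trans h h1).
    by rewrite ltxx.
  have mm x : x <= a -> Num.min x b = x /\ Num.min x a = x.
    by move=> xa; rewrite !min_l// (le_trans xa)// ltW.
  have [-> ->] := mm _ h1; have [-> ->] := mm _ h0.
  by rewrite subrr mulmx0.
case: (sp_time_out (ltnW (ltn_ord i))) => h0; last first.
  rewrite indicE memNset ?scale0r; last first.
    by rewrite /= in_itv /= => /andP[/lt_le_trans/(_ h0)]; rewrite ltxx.
  have mm x : b <= x -> Num.min x b = b /\ Num.min x a = a.
    by move=> bx; rewrite !min_r// (le_trans _ bx)// ltW.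
  have [-> ->] := mm _ h1; have [-> ->] := mm _ h0.
  by rewrite !subrr mulmx0.
rewrite indicE mem_set ?scale1r; last by rewrite /= in_itv /= h1 (le_lt_trans h0 ab).
have ab' := ltW ab.
rewrite (min_r h1) (min_r (le_trans ab' h1)) (min_l h0) (min_l (le_trans h0 ab')).
by rewrite opprB addrA subrK.
Qed.

Lemma sp_val_smeas j k : 0 <= a -> smeas (F a) (fun w => sp_val S b w j k).
Proof.
move=> a0; under eq_fun do rewrite sp_valE.
apply: smeas_sum => i; rewrite indicE.
case: (boolP (_ \in _)) => [/set_mem|_].
  rewrite /= in_itv /= => /andP[h1 _].
  under eq_fun do rewrite mul1r.
  have [ta|/(lt_le_trans h1)] := sp_time_out (ltnW (ltn_ord i)); last by rewrite ltxx.
  apply: (Fsmeas_le uF (sp_time_ge0' _ _) ta).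
  exact: (@sp_coef_smeas _ _ _ _ _ uF _ _ S i j k).
by under eq_fun do rewrite mul0r; exact: smeas_cst.
Qed.

End SimpleOnGrid.

Lemma sp_val_bounded {R : realType} {disp : measure_display} {Omega : measurableType disp}
    (F : R -> set (set Omega)) (J K : nat) (S : simple_process F J K) :
  exists C, forall s w j k, `|sp_val S s w j k| <= C.
Proof.
have [C hC] := sp_coef_bounded S.
exists (\sum_(i < sp_size S) C) => s w j k; rewrite sp_valE.
apply: le_trans (ler_norm_sum _ _ _) _; apply: ler_sum => i _.
rewrite normrM indicE; apply: le_trans (hC i w).
apply: le_trans (entry_le_enorm _ j k); case: (_ \in _).
  by rewrite normr1 mul1r.
by rewrite normr0 mul0r.
Qed.

(** * Moments of increments of the stochastic integral *)
Section Energy.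
Context {R : realType}.

Lemma integral_steps (D : set R) n (u a : nat -> R) : measurable D ->
  (forall i, u i <= u i.+1) -> (forall i, 0 <= a i) ->
  (forall i, (i < n)%N -> a i != 0 -> `]u i, u i.+1]%classic `<=` D) ->
  (\int[lebesgue_measure]_(r in D)
     (\sum_(i < n) a i * (\1_(`]u i, u i.+1]) r : R))%:E =
   (\sum_(i < n) a i * (u i.+1 - u i))%:E)%E.
Proof.
move=> mD und a0 ua.
under eq_integral do rewrite -sumEFin.
rewrite ge0_integral_sum//; last 2 first.
- by move=> i; apply/measurable_EFinP/measurable_funM.
- by move=> i r _; rewrite lee_fin mulr_ge0.
rewrite -sumEFin; apply: eq_bigr => i _.
under eq_integral do rewrite EFinM.
rewrite ge0_integralZl//; last 2 first.
- by apply/measurable_EFinP/measurable_indic; exact: measurable_itv.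
- by rewrite lee_fin.
have [ai|ai] := eqVneq (a i) 0; first by rewrite ai !mul0e mul0r.
rewrite integral_indic//.
rewrite EFinM; congr (_ * _)%E; rewrite setIidl; last exact: ua.
apply: (eq_trans (lebesgue_measure_itv `]u i, u i.+1])).
rewrite /= lte_fin; case: ifPn => // h.
have -> : u i.+1 = u i by apply/le_anti; rewrite und leNgt h.
by rewrite subrr.
Qed.

(** The energy of an approximation [c] of a process with square [h2], summed until its
    cut-off [p]. The grid may run past [rho] by less than one mesh [d]; there only the
    pathwise bound [M] is available, hence the middle term. *)
Lemma energy_bound (s t rho B M d eps : R) (u : nat -> R) n (p : pred nat)
    (c : nat -> R) (h2 phi : R -> R) :
  0 <= s -> s <= rho <= t -> 0 <= B -> 0 <= M -> 0 <= d ->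
  (forall i, u i <= u i.+1 /\ u i.+1 - u i <= d) -> (forall i, s <= u i <= t) ->
  (forall i, 0 <= c i) -> (forall r, 0 <= phi r) -> measurable_fun `[0, t] phi ->
  (forall i, p i -> u i < u i.+1 -> u i < rho) ->
  (forall i r, u i < r <= u i.+1 -> c i <= 2 * h2 r + 2 * phi r) ->
  (forall r, s <= r < rho -> h2 r <= B) -> (forall r, s <= r <= t -> h2 r <= M) ->
  (\int[lebesgue_measure]_(r in `[0%R, t]) (phi r)%:E <= eps%:E)%E ->
  \sum_(i < n) (if p i then c i * (u i.+1 - u i) else 0) <=
    2 * B * (rho - s) + 2 * M * d + 2 * eps.
Proof.
move=> s0 /andP[srho rhot] B0 M0 d0 ud ub c0 phi0 mphi prho cle hB hM iphi.
have und i : u i <= u i.+1 by case: (ud i).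
have unm i j : (i <= j)%N -> u i <= u j.
  elim: j => [|j IH]; first by rewrite leqn0 => /eqP ->.
  by rewrite leq_eqVlt => /predU1P[->//|/IH h]; exact: le_trans (und j).
pose a i := if p i then c i else 0.
have a0 i : 0 <= a i by rewrite /a; case: ifP.
have ub' i : 0 <= u i <= t.
  by have /andP[h1 h2'] := ub i; rewrite (le_trans s0 h1).
rewrite (eq_bigr (fun i : 'I_n => a i * (u i.+1 - u i))); last first.
  by move=> i _; rewrite /a; case: ifP => //; rewrite mul0r.
rewrite -lee_fin -(@integral_steps `[0, t]%classic)//; last first.
  move=> i _ _ r; rewrite /= !in_itv /= => /andP[k1 k2].
  have /andP[k3 _] := ub' i; have /andP[_ k4] := ub' i.+1.
  by rewrite (le_trans k3 (ltW k1)) (le_trans k2).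
pose g r := 2 * B * (\1_(`[s, rho[) r : R) + 2 * M * (\1_(`[rho, rho + d]) r : R).
have mI (D : interval R) : measurable_fun `[0, t] (\1_[set` D] : R -> R).
  by apply: measurable_indic; exact: measurable_itv.
have mg : measurable_fun `[0, t] g.
  by apply: measurable_funD; apply: measurable_funM.
have ind0 (D : set R) r : 0 <= (\1_D r : R) by [].
have g0 r : 0 <= g r by rewrite addr_ge0// mulr_ge0// mulr_ge0.
apply: (@le_trans _ _ (\int[lebesgue_measure]_(r in `[0%R, t]) (g r + 2 * phi r)%:E)%E).
  apply: ge0_le_integral => //.
  - by move=> r _; rewrite lee_fin sumr_ge0// => i _; rewrite mulr_ge0.
  - by apply/measurable_EFinP/measurable_sum => i; apply: measurable_funM.
  - by apply/measurable_EFinP/measurable_funD => //; exact: measurable_funM.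
  move=> r _; rewrite lee_fin.
  have rhs0 : 0 <= g r + 2 * phi r by rewrite addr_ge0// mulr_ge0.
  have [[i0 ri0]|no] := pselect (exists i0 : 'I_n, r \in `]u i0, u i0.+1]); last first.
    rewrite big1// => i _; rewrite indicE memNset ?mulr0//= => h.
    by apply: no; exists i.
  rewrite (bigD1 i0)//= big1 ?addr0; last first.
    move=> i; rewrite neq_lt => ii0; rewrite indicE memNset ?mulr0//= in_itv /=.
    move: ri0; rewrite in_itv /= => /andP[h1 h2'] /andP[h3 h4].
    case/orP: ii0 => ii0.
      by have := lt_le_trans h1 (le_trans h4 (unm _ _ ii0)); rewrite ltxx.
    by have := lt_le_trans h3 (le_trans h2' (unm _ _ ii0)); rewrite ltxx.
  rewrite indicE mem_set ?mulr1//; move: ri0; rewrite in_itv /= => ri0.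
  rewrite /a; case: ifPn => pi0 //.
  have /andP[h1 h2'] := ri0.
  have ui := prho _ pi0 (lt_le_trans h1 h2').
  have := cle _ _ ri0.
  have /andP[su _] := ub i0; have /andP[_ ut] := ub i0.+1.
  have sr : s <= r by rewrite (le_trans su) ?ltW.
  have rt : r <= t by rewrite (le_trans h2').
  rewrite /g; have [rr|rr] := ltP r rho.
    rewrite [\1_(`[s, rho[) r]indicE mem_set; last by rewrite /= in_itv /= sr.
    have := hB r; rewrite sr rr => /(_ erefl).
    have : 0 <= 2 * M * (\1_(`[rho, rho + d]) r : R) by rewrite !mulr_ge0.
    rewrite /= mulr1n; lra.
  rewrite [\1_(`[rho, rho + d]) r]indicE mem_set; last first.
    rewrite /= in_itv /= rr /=; case: (ud i0) => _; lra.
  have := hM r; rewrite sr rt => /(_ erefl).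
  have : 0 <= 2 * B * (\1_(`[s, rho[) r : R) by rewrite !mulr_ge0.
  rewrite /= mulr1n; lra.
under eq_integral do rewrite EFinD.
rewrite ge0_integralD//; last 4 first.
- by move=> r _; rewrite lee_fin.
- exact/measurable_EFinP.
- by move=> r _; rewrite lee_fin mulr_ge0.
- by apply/measurable_EFinP; exact: measurable_funM.
rewrite [leRHS]EFinD; apply: leeD; last first.
  under eq_integral do rewrite EFinM.
  rewrite ge0_integralZl//; last 2 first.
  - exact/measurable_EFinP.
  - by move=> r _; rewrite lee_fin.
  by rewrite EFinM lee_wpmul2l// lee_fin.
under eq_integral do rewrite EFinD.
rewrite ge0_integralD//; last 4 first.
- by move=> r _; rewrite lee_fin mulr_ge0// mulr_ge0.
- by apply/measurable_EFinP; exact: measurable_funM.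
- by move=> r _; rewrite lee_fin mulr_ge0// mulr_ge0.
- by apply/measurable_EFinP; exact: measurable_funM.
have piece (x y C : R) (D : interval R) : 0 <= C -> x <= y ->
    (lebesgue_measure [set` D] <= (y - x)%:E)%E ->
    (\int[lebesgue_measure]_(r in `[0%R, t]) (C * (\1_[set` D] r : R))%:E <= (C * (y - x))%:E)%E.
  move=> C0 xy hD; under eq_integral do rewrite EFinM.
  rewrite ge0_integralZl//; last by apply/measurable_EFinP.
  rewrite EFinM lee_wpmul2l ?lee_fin// integral_indic//.
  apply: le_trans hD; apply: le_measure; rewrite ?inE.
  - by apply: measurableI; exact: measurable_itv.
  - exact: measurable_itv.
  - exact: subIsetl.
rewrite EFinD; apply: leeD.
  apply: piece => //; first by rewrite mulr_ge0.
  rewrite lebesgue_measure_itv /= lte_fin; case: ifPn => //; rewrite lee_fin subr_ge0//.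
rewrite (_ : 2 * M * d = 2 * M * (rho + d - rho)); last by rewrite addrAC subrr add0r.
apply: piece; [by rewrite mulr_ge0|by rewrite lerDl|].
rewrite lebesgue_measure_itv /= lte_fin; case: ifPn => //; rewrite lee_fin subr_ge0 lerDl//.
Qed.

End Energy.

Section ItoIncrement.
Context {R : realType} {disp : measure_display} {Omega : measurableType disp}.
Variables (P : probability Omega R) (F : R -> set (set Omega)).
Hypothesis uF : usual_filtration P F.
Variables (J K : nat) (W : R -> Omega -> 'cV[R]_K).
Hypothesis bW : brownian_motion P F W.
Variables (H : R -> Omega -> 'M[R]_(J, K)) (I : R -> Omega -> 'cV[R]_J).
Hypothesis iI : ito_integral P F W H I.
Hypothesis mH : forall t i j, 0 <= t -> measurable_fun setT (fun w => H t w i j).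
Hypothesis cH : \forall w \ae P, forall i j, pcont (fun t => H t w i j : R^o).
Variable rho : Omega -> \bar R.
Hypothesis srho : stopping_time F rho.
Variables (s t B : R).
Hypothesis s0 : 0 <= s.
Hypothesis st : s < t.
Hypothesis B0 : 0 <= B.
Hypothesis hB : \forall w \ae P, forall u, s <= u <= t -> (u%:E < rho w)%E ->
  enorm (H u w) ^+ 2 <= B.

Let aW : adapted F W. Proof. by case: bW. Qed.
Let cW : \forall w \ae P, pcont (W ^~ w).
Proof. by case: bW => _ + _ _; apply: filterS => w /within_pcont. Qed.
Let aI : adapted F I. Proof. by case: iI. Qed.
Let cI : \forall w \ae P, pcont (I ^~ w).
Proof. by case: iI => _ + _; apply: filterS => w /within_pcont. Qed.
Let rho0 w : (0 <= rho w)%E. Proof. by case: srho. Qed.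
Let t0 : 0 < t. Proof. exact: le_lt_trans st. Qed.

Definition ito_incr (j : 'I_J) (w : Omega) : R :=
  I (tmin t (rho w)) w j ord0 - I (tmin s (rho w)) w j ord0.

Lemma ito_incr_smeas j : smeas (F t) (ito_incr j).
Proof.
have aIj u : 0 <= u -> smeas (F u) (fun w => I u w j ord0).
  move=> u0; apply/(smeasP (filtration_sigma uF u0)) => D mD; exact: aI.
have cIj : \forall w \ae P, pcont (fun u => I u w j ord0 : R^o).
  by apply: filterS cI => w; exact: pcont_entry.
apply: smeasB; first exact: (stopped_smeas uF srho (ltW t0) aIj cIj).
apply: (Fsmeas_le uF s0 (ltW st)).
exact: (stopped_smeas uF srho s0 aIj cIj).
Qed.

(** A simple process [S], read along a grid [g] that contains its jump times. *)
Section OneApproximation.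
Variables (S : simple_process F J K) (g : nat -> R) (n : nat) (d : R).
Hypothesis d0 : 0 <= d.
Hypothesis gs : g 0%N = s.
Hypothesis gn : g n = t.
Hypothesis gd : forall i, g i <= g i.+1 /\ g i.+1 - g i <= d.
Hypothesis gb : forall i, s <= g i <= t.
Hypothesis gS : forall k, (k <= sp_size S)%N -> forall i, ~ (g i < sp_time S k < g i.+1).

Let c i w : 'M[R]_(J, K) := if g i < g i.+1 then sp_val S (g i.+1) w else 0.
Let x i w : R := enorm (c i w) ^+ 2 * (g i.+1 - g i).
Let kap : R := 2 * B * (t - s) + 1.
(** The approximation is stopped at [rho], and before its energy exceeds [kap], which
    makes its moments finite whatever [S] is. The level [kap] is one more than the
    bound on the energy obtained in the limit. *)
Let p w i : bool := ((g i)%:E < rho w)%E && (\sum_(l < i.+1) x l w <= kap).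

Let g0 i : 0 <= g i. Proof. by case/andP: (gb i) => h _; exact: le_trans h. Qed.
Let gnd i : g i <= g i.+1. Proof. by case: (gd i). Qed.
Let gm i j : (i <= j)%N -> g i <= g j. Proof. exact: (grid_le gnd). Qed.
Let x0 i w : 0 <= x i w. Proof. by rewrite mulr_ge0 ?sqr_ge0// subr_ge0. Qed.
Let kap1 : 0 <= kap. Proof. by rewrite addr_ge0// !mulr_ge0// subr_ge0 ltW. Qed.

Let c_smeas i j k : smeas (F (g i)) (fun w => c i w j k).
Proof.
have [gi|gi] := boolP (g i < g i.+1); last first.
  have -> : (fun w => c i w j k) = fun=> 0.
    by apply/funext => w; rewrite /c (negbTE gi) mxE.
  exact: smeas_cst.
have -> : (fun w => c i w j k) = fun w => sp_val S (g i.+1) w j k.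
  by apply/funext => w; rewrite /c gi.
by apply: (sp_val_smeas uF) (g0 i) => l lS; exact: gS.
Qed.

Let p_mono w i : p w i.+1 -> p w i.
Proof.
rewrite /p => /andP[h1 h2]; apply/andP; split.
  by apply: le_lt_trans h1; rewrite lee_fin.
by apply: le_trans h2; rewrite [leRHS]big_ord_recr /= lerDl.
Qed.

Let x_smeas l i : (l <= i)%N -> smeas (F (g i)) (x l).
Proof.
move=> li; apply: smeasM; last exact: smeas_cst.
under eq_fun do rewrite enorm_sqr.
apply: smeas_sum => a; apply: smeas_sum => b.
apply: (@smeas_comp _ _ _ _ (fun y => y ^+ 2)); first exact: exprn_measurable.
by apply: (Fsmeas_le uF (g0 l) (gm li)); exact: c_smeas.
Qed.

Variables (j : 'I_J) (A : set Omega).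
Hypothesis FA : F s A.

Let p_smeas i : smeas (F (g i)) (fun w => (p w i)%:R : R).
Proof.
have -> : (fun w => (p w i)%:R : R) =
    (fun w => ((g i)%:E < rho w)%E%:R * \1_[set w | \sum_(l < i.+1) x l w <= kap] w).
  apply/funext => w; rewrite /p -mulnb natrM indicE; congr (_ * (_ : bool)%:R).
  by apply/idP/idP; rewrite inE.
apply: smeasM; first exact: (smeas_stopping uF srho).
apply: (smeas_indic (filtration_sigma uF (g0 i))).
have : smeas (F (g i)) (fun w => \sum_(l < i.+1) x l w).
  by apply: smeas_sum => l; apply: x_smeas; rewrite -ltnS.
move=> /(smeasP (filtration_sigma uF (g0 i)))/(_ `]-oo, kap]%classic).
have -> : (fun w => \sum_(l < i.+1) x l w) @^-1` `]-oo, kap]%classic =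
    [set w | \sum_(l < i.+1) x l w <= kap].
  by apply/seteqP; split=> w; rewrite /= in_itv.
by apply; exact: measurable_itv.
Qed.

Let h i k w : R := \1_A w * (p w i)%:R * c i w j k.

Let h_smeas i k : smeas (F (g i)) (h i k).
Proof.
apply: smeasM; last exact: c_smeas.
apply: smeasM; last exact: p_smeas.
apply: (Fsmeas_le uF s0); first by case/andP: (gb i).
exact: (smeas_indic (filtration_sigma uF s0) FA).
Qed.

Let h_rint i k : rint P (fun w => h i k w ^+ 2).
Proof.
have [C hC] := sp_val_bounded S.
have mh' := Fsmeas_measurable uF (g0 i) (@h_smeas i k).
apply: (@rint_bounded _ _ _ _ _ ((`|C|) ^+ 2)); first exact: measurable_funX.
move=> w; rewrite normrX lerXn2r ?nnegrE// /h.
rewrite -[leRHS]mul1r normrM; apply: ler_pM => //.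
  rewrite indicE; case: (_ \in _); case: (p w i); rewrite ?mulr0 ?mul0r ?mulr1 ?normr0 ?normr1//.
rewrite /c; case: ifP => _; last by rewrite mxE normr0.
by apply: le_trans (hC _ _ _ _) _; exact: ler_norm.
Qed.

Definition approx_incr : Omega -> R := dint W g h n.
Definition approx_energy w : R :=
  \1_A w * \sum_(i < n) (if p w i then x i w else 0).

Lemma approx_energy_le w : 0 <= approx_energy w <= kap.
Proof.
have s1 : 0 <= \sum_(i < n) (if p w i then x i w else 0).
  by rewrite sumr_ge0// => i _; case: ifP.
rewrite /approx_energy mulr_ge0//=.
suff h1 : \sum_(i < n) (if p w i then x i w else 0) <= kap.
  rewrite indicE; case: (_ \in _); first by rewrite mul1r.
  by rewrite mul0r.
have [|k [kn pk _]] := @stopped_sum R (fun i => \sum_(l < i) x l w) (p w) n.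
  exact: p_mono.
rewrite big_ord0 subr0; under eq_bigr do rewrite big_ord_recr /= addrAC subrr add0r.
move=> ->; case: k kn pk => [|k] kn pk; first by rewrite big_ord0.
by have /andP[] := pk k (leqnn _).
Qed.

Lemma approx_energy_measurable : measurable_fun setT approx_energy.
Proof.
apply: measurable_funM.
  by apply: measurable_indic; exact: (filtration_set_measurable uF s0 FA).
apply: measurable_sum => i.
have -> : (fun w => if p w i then x i w else 0) = (fun w => (p w i)%:R * x i w).
  by apply/funext => w; case: ifP; rewrite ?mul1r ?mul0r.
by apply: measurable_funM; apply: (Fsmeas_measurable uF (g0 i)) => //; exact: x_smeas.
Qed.

(** The stopped approximation is a discrete stochastic integral of weights that
    are bounded and known at the beginning of each step. *)
Lemma approx_incr_moments :
  [/\ measurable_fun setT approx_incr, rint P (fun w => approx_incr w ^+ 2),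
   Ex P approx_incr = 0 &
   Ex P (fun w => approx_incr w ^+ 2) <= 8 * K%:R * Ex P approx_energy].
Proof.
have [m1 m2 m3 m4] := dint_moments uF bW (g0 0) gnd (@h_smeas) (@h_rint) n.
split=> //; first exact: (Fsmeas_measurable uF (g0 n) m1).
apply: le_trans m4 _; rewrite ler_wpM2l//.
have Ie : rint P approx_energy.
  apply: (@rint_bounded _ _ _ P _ kap approx_energy_measurable) => w.
  by have /andP[h1 h2] := approx_energy_le w; rewrite ger0_norm.
have Is : rint P (fun w => \sum_(i < n) (g i.+1 - g i) * \sum_k h i k w ^+ 2).
  by apply: rint_sum => i _; apply: rintZ; apply: rint_sum => k _; exact: h_rint.
apply: (@le_trans _ _ (Ex P (fun w => \sum_(i < n) (g i.+1 - g i) * \sum_k h i k w ^+ 2))).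
  rewrite Ex_sum; last by move=> i _; apply: rintZ; apply: rint_sum => k _; exact: h_rint.
  apply: ler_sum => i _; rewrite ExZ; last by apply: rint_sum => k _; exact: h_rint.
  by rewrite Ex_sum// => k _; exact: h_rint.
apply: Ex_le => // w; rewrite /approx_energy mulr_sumr; apply: ler_sum => i _.
rewrite /h; case: ifPn => pi; last first.
  by rewrite !mulr0 big1 ?mulr0// => k _; rewrite mul0r expr0n.
rewrite /x mulrA mulrC ler_wpM2r ?subr_ge0//.
rewrite enorm_sqr mulr_sumr (bigD1 j)//= -[leLHS]addr0; apply: lerD; last first.
  by rewrite sumr_ge0// => a _; rewrite mulr_ge0// sumr_ge0// => b _; rewrite sqr_ge0.
rewrite mulr_sumr; apply: ler_sum => k _; rewrite mulr1 exprMn ler_wpM2r ?sqr_ge0//.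
by rewrite indicE; case: (_ \in _); rewrite ?expr1n ?expr0n.
Qed.

(** On a path where [S] is close to [H], the energy up to the stopping time is close to
    that of [H]: the cut-off at level [kap] is then inactive, and the approximation is
    an increment of the simple integral. *)
Lemma approx_path w M e : (forall i j, pcont (fun t => H t w i j : R^o)) ->
  0 <= M -> (forall r, 0 <= r <= t -> enorm (H r w) ^+ 2 <= M) ->
  (forall u, s <= u <= t -> (u%:E < rho w)%E -> enorm (H u w) ^+ 2 <= B) ->
  (\int[lebesgue_measure]_(r in `[0%R, t])
     ((enorm (sp_val S r w - H r w)) ^+ 2)%:E <= e%:E)%E ->
  2 * M * d + 2 * e <= 1 ->
  approx_energy w <= \1_A w * (2 * B * (clamp s t (rho w) - s) + 2 * M * d + 2 * e) /\
  exists k, [/\ s <= g k <= t, `|g k - clamp s t (rho w)| <= d &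
    approx_incr w = \1_A w * (sp_integral S W (g k) w j ord0 - sp_integral S W s w j ord0)].
Proof.
move=> cHw M0 hM hBw iphi small.
have st' := ltW st; have := clamp_le st' (rho0 w) => cl.
pose q i := ((g i)%:E < rho w)%E.
have qm i : q i.+1 -> q i by apply: le_lt_trans; rewrite lee_fin.
have c_path i r : g i < r <= g i.+1 -> c i w = sp_val S r w.
  move=> /andP[h1 h2]; have gi := lt_le_trans h1 h2.
  rewrite /c gi (@sp_val_const _ _ _ _ _ _ S (g i) (g i.+1))//; last by rewrite h1.
  by move=> k kS; exact: gS.
have mphi : measurable_fun `[0, t] (fun r => enorm (sp_val S r w - H r w) ^+ 2).
  have -> : (fun r => enorm (sp_val S r w - H r w) ^+ 2) =
      (fun r => \sum_a \sum_b ((\sum_(i < sp_size S)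
        (\1_(`]sp_time S i, sp_time S i.+1]) r : R) * sp_coef S i w a b) - H r w a b) ^+ 2).
    apply/funext => r; rewrite enorm_sqr; apply: eq_bigr => a _; apply: eq_bigr => b _.
    by rewrite -sp_valE !mxE.
  apply: measurable_sum => a; apply: measurable_sum => b; apply: measurable_funX.
  apply: measurable_funB.
    by apply: measurable_sum => i; apply: measurable_funM.
  apply: subspace_continuous_measurable_fun; first exact: measurable_itv.
  have /(@within_pcont R R^o) := cHw a b; apply: continuous_subspaceW.
  by apply: subset_itv; rewrite bnd_simp.
have EB : \sum_(i < n) (if q i then x i w else 0) <=
    2 * B * (clamp s t (rho w) - s) + 2 * M * d + 2 * e.
  apply: (@energy_bound R s t (clamp s t (rho w)) B M d e g n q
    (fun i => enorm (c i w) ^+ 2) (fun r => enorm (H r w) ^+ 2)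
    (fun r => enorm (sp_val S r w - H r w) ^+ 2)) => //.
  - by move=> i; rewrite sqr_ge0.
  - by move=> r; rewrite sqr_ge0.
  - move=> i qi gi; rewrite /clamp lt_max; apply/orP; right.
    have [tr|tr] := leP t%:E (rho w).
      by rewrite tminE//; apply: lt_le_trans gi _; case/andP: (gb i.+1).
    by rewrite -lte_fin (tminE_lt (rho0 w) (ltW tr)).
  - move=> i r ri; rewrite (c_path _ _ ri).
    by rewrite -{1}(subrK (H r w) (sp_val S r w)) addrC; exact: enormD_sqr_le.
  - move=> r /andP[sr rr]; apply: hBw; last exact: clamp_lt rr.
    by rewrite sr ltW// (lt_le_trans rr)//; case/andP: cl.
  - by move=> r /andP[sr rt]; apply: hM; rewrite (le_trans s0 sr).
have qx0 i : 0 <= (if q i then x i w else 0) by case: ifP.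
have Ble : 2 * B * (clamp s t (rho w) - s) <= 2 * B * (t - s).
  by rewrite ler_wpM2l ?mulr_ge0// lerD2r; case/andP: cl.
have pq i : (i < n)%N -> p w i = q i.
  move=> in_; rewrite /p -/(q i); case: (boolP (q i)) => //= qi.
  have qj : forall l, (l <= i)%N -> q l.
    by move=> l li; apply: le_lt_trans qi; rewrite lee_fin gm.
  have -> : \sum_(l < i.+1) x l w = \sum_(l < i.+1) (if q l then x l w else 0).
    by apply: eq_bigr => l _; rewrite qj// -ltnS.
  apply: (@le_trans _ _ (\sum_(l < n) (if q l then x l w else 0))); last first.
    by apply: le_trans EB _; rewrite /kap; lra.
  rewrite -!(big_mkord xpredT (fun l => if q l then x l w else 0)).
  by rewrite (@big_cat_nat _ _ _ i.+1 0 n)//= lerDl sumr_ge0.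
split.
  rewrite /approx_energy ler_wpM2l//.
  by rewrite (eq_bigr (fun i : 'I_n => if q i then x i w else 0))// => i _; rewrite pq.
have [|k [kn pk npk sumE]] := @stopped_sum R
    (fun i => sp_integral S W (g i) w j ord0) q n; first exact: qm.
exists k; split; first exact: gb.
  have := grid_stop (rho0 w) gd _ d0 kn pk npk; rewrite gs gn; apply.
  by move=> i; exact: gb.
rewrite -gs -sumE /approx_incr /dint mulr_sumr; apply: eq_bigr => i _.
rewrite /h pq//; case: (boolP (q i)) => qi; last first.
  by rewrite !mulr0 big1// => l _; rewrite !mul0r.
under eq_bigr do rewrite mulr1 -mulrA.
rewrite -mulr_sumr; congr (_ * _); rewrite /c; case: ifPn => gi.
  have -> : sp_integral S W (g i.+1) w j ord0 - sp_integral S W (g i) w j ord0 =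
      (sp_integral S W (g i.+1) w - sp_integral S W (g i) w) j ord0 by rewrite !mxE.
  rewrite (sp_integral_step gi)// => [|l lS]; last exact: gS.
  by rewrite mxE; apply: eq_bigr => l _; rewrite !mxE.
have -> : g i.+1 = g i by apply/le_anti; rewrite gnd leNgt gi.
by rewrite subrr big1// => l _; rewrite mxE mul0r.
Qed.

End OneApproximation.

(** Along approximations that converge almost surely, the second moments pass to the
    limit by Fatou's lemma, and the vanishing means by the L2 bound. The second moments
    are compared with the energies, which tend to at most the energy of the limit. *)
Lemma ito_incr_moments j A : F s A ->
  rint P (fun w => (\1_A w * ito_incr j w) ^+ 2) /\
  Ex P (fun w => \1_A w * ito_incr j w) = 0 /\
  Ex P (fun w => (\1_A w * ito_incr j w) ^+ 2) <=
    Ex P (fun w => \1_A w * (16 * K%:R * B * (tmin t (rho w) - tmin s (rho w)))).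
Proof.
move=> FA.
have [S hS] := ito_approx uF aW cW aI cI mH cH t0 iI.
have hg (m : nat) := @grid_exists R
  [seq sp_time (S m) k | k <- iota 0 (sp_size (S m)).+1] s t m.+1%:R^-1 (ltW st)
  (ltac:(by rewrite invr_gt0 ltr0n)).
have [g hg'] := choice hg; have [N hgN] := choice hg'.
have d0 m : 0 <= m.+1%:R^-1 :> R by rewrite invr_ge0.
have gS m k : (k <= sp_size (S m))%N -> forall i, ~ (g m i < sp_time (S m) k < g m i.+1).
  move=> kS i; have [_ _ _ _] := hgN m; apply.
  by apply/mapP; exists k => //; rewrite mem_iota.
pose X m := approx_incr (S m) (g m) (N m) j A.
pose Q m := approx_energy (S m) (g m) (N m) A.
have mom m : [/\ measurable_fun setT (X m), rint P (fun w => X m w ^+ 2),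
   Ex P (X m) = 0 & Ex P (fun w => X m w ^+ 2) <= 8 * K%:R * Ex P (Q m)].
  have [h1 h2 h3 h4 h5] := hgN m.
  exact: (approx_incr_moments (N m) h3 h4 (gS m) j FA).
pose kap := 2 * B * (t - s) + 1.
have Qb m w : 0 <= Q m w <= kap.
  by have [h1 h2 h3 h4 h5] := hgN m; exact: (approx_energy_le (S m) (N m) h3 A w).
have mQ m : measurable_fun setT (Q m).
  by have [h1 h2 h3 h4 h5] := hgN m; exact: (approx_energy_measurable (N m) h3 h4 (gS m) FA).
have mA := filtration_set_measurable uF s0 FA.
have mtm u : 0 <= u -> measurable_fun setT (fun w => tmin u (rho w)).
  by move=> u0; apply: (Fsmeas_measurable uF u0); exact: (smeas_tmin uF srho).
(* A bound on the energy of the limit: [Q m] need not converge, but its maximum with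
   [q] tends to [q]. *)
pose q w := \1_A w * (2 * B * (tmin t (rho w) - tmin s (rho w))).
have qE w : q w = \1_A w * (2 * B * (clamp s t (rho w) - s)).
  by rewrite /q (@clamp_stop _ _ _ _ R id)// ltW.
have q0 w : 0 <= q w <= kap.
  have /andP[h1 h2] := clamp_le (ltW st) (rho0 w).
  have h3 : 0 <= 2 * B * (clamp s t (rho w) - s) by rewrite !mulr_ge0// subr_ge0.
  have h4 : 2 * B * (clamp s t (rho w) - s) <= kap.
    by rewrite /kap ler_wpDr// ler_wpM2l ?mulr_ge0// lerD2r.
  rewrite qE indicE; case: (_ \in _); rewrite ?mul1r ?mul0r; first by rewrite h3.
  by rewrite lexx (le_trans h3 h4).
have mq : measurable_fun setT q.
  apply: measurable_funM; first exact: measurable_indic.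
  apply: measurable_funM => //; apply: measurable_funB; apply: mtm => //; exact: ltW.
pose Y w := \1_A w * ito_incr j w.
have mY : measurable_fun setT Y.
  apply: measurable_funM; first exact: measurable_indic.
  exact: (Fsmeas_measurable uF (ltW t0) (ito_incr_smeas j)).
have paths : \forall w \ae P, X m w @[m --> \oo] --> Y w /\
    Num.max (Q m w) (q w) @[m --> \oo] --> q w.
  apply: filterS3 hS cI (filterI cH hB) => w hSw cIw [cHw hBw].
  have [M M0 hM] : exists2 M, 0 <= M & forall r, 0 <= r <= t -> enorm (H r w) ^+ 2 <= M.
    have hMij (ab : 'I_J * 'I_K) : exists M, forall r, 0 <= r <= t -> `|H r w ab.1 ab.2| <= M.
      by have [M _ hM] := pcont_bounded t (cHw ab.1 ab.2); exists M.
    have [M hM] := choice hMij.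
    exists (\sum_a \sum_b M (a, b) ^+ 2).
      by rewrite sumr_ge0// => a _; rewrite sumr_ge0// => b _; rewrite sqr_ge0.
    move=> r rt; rewrite enorm_sqr; apply: ler_sum => a _; apply: ler_sum => b _.
    rewrite -[leLHS]real_normK ?num_real//; have := hM (a, b) r rt => /= hab.
    by rewrite lerXn2r ?nnegrE// (le_trans (normr_ge0 _) hab).
  have ev e : 0 < e -> \forall m \near \oo,
      [/\ 2 * M * m.+1%:R^-1 + 2 * e <= 3 * e,
       (\int[lebesgue_measure]_(r in `[0%R, t])
         ((enorm (sp_val (S m) r w - H r w)) ^+ 2)%:E <= e%:E)%E &
       forall r, 0 <= r <= t -> enorm (sp_integral (S m) W r w - I r w) <= e].
    move=> e0; have [N0 hN0] := hSw e e0.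
    have e' : 0 < e / (2 * M + 1) by rewrite divr_gt0// ltr_wpDl// mulr_ge0.
    have /cvgrPdist_lt/(_ _ e') := @cvg_harmonic R; rewrite /= => hh.
    have hN0' : \forall m \near \oo, (N0 <= m)%N by exists N0.
    apply: filterS2 hh hN0' => m /=.
    rewrite sub0r normrN ger0_norm// ltr_pdivlMr ?ltr_wpDl ?mulr_ge0// => hm /hN0[h1 h2].
    split=> //; move: hm (d0 m); set y := m.+1%:R^-1 => hm y0; lra.
  have cl := clamp_le (ltW st) (rho0 w).
  split; last first.
    apply/cvgrPdist_le => e e0.
    pose e1 := Num.min (e / 3) (1 / 3).
    have e10 : 0 < e1 by rewrite lt_min !divr_gt0.
    near=> m.
    have [h1 h2 h3 h4 h5] := hgN m.
    have [k1 k2 k3] : [/\ 2 * M * m.+1%:R^-1 + 2 * e1 <= 3 * e1,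
       (\int[lebesgue_measure]_(r in `[0%R, t])
         ((enorm (sp_val (S m) r w - H r w)) ^+ 2)%:E <= e1%:E)%E &
       forall r, 0 <= r <= t -> enorm (sp_integral (S m) W r w - I r w) <= e1].
      near: m; exact: ev.
    have e13 : 3 * e1 <= e by have h : e1 <= e / 3; [rewrite ge_min lexx|lra].
    have e11 : 3 * e1 <= 1 by have h : e1 <= 1 / 3; [rewrite ge_min lexx orbT|lra].
    have [Qle _] := approx_path (d0 m) h1 h2 h3 h4 (gS m) j A cHw M0 hM hBw k2 (le_trans k1 e11).
    rewrite distrC ger0_norm ?subr_ge0 ?le_max ?lexx ?orbT//.
    rewrite lerBlDr ge_max lerDr (ltW e0) andbT; apply: le_trans Qle _.
    rewrite qE -addrA mulrDr [leRHS]addrC lerD2l.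
    apply: (@le_trans _ _ (1 * (3 * e1))); last by rewrite mul1r.
    by apply: ler_pM => //; rewrite addr_ge0// ?mulr_ge0// ltW.
  apply/cvgrPdist_le => e e0.
  have [d dd0 hd] := pcont_unif t (pcont_entry j ord0 cIw) (divr_gt0 e0 (ltr0n _ 3)).
  pose e1 := Num.min (e / 3) (1 / 3).
  have e10 : 0 < e1 by rewrite lt_min !divr_gt0.
  near=> m.
  have [h1 h2 h3 h4 h5] := hgN m.
  have [k1 k2 k3] : [/\ 2 * M * m.+1%:R^-1 + 2 * e1 <= 3 * e1,
       (\int[lebesgue_measure]_(r in `[0%R, t])
         ((enorm (sp_val (S m) r w - H r w)) ^+ 2)%:E <= e1%:E)%E &
       forall r, 0 <= r <= t -> enorm (sp_integral (S m) W r w - I r w) <= e1].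
    near: m; exact: ev.
  have md : m.+1%:R^-1 < d.
    near: m; have /cvgrPdist_lt/(_ _ dd0) := @cvg_harmonic R.
    by apply: filterS => m /=; rewrite sub0r normrN ger0_norm.
  have e13 : e1 <= e / 3 by rewrite ge_min lexx.
  have e11 : 3 * e1 <= 1 by have h : e1 <= 1 / 3; [rewrite ge_min lexx orbT|lra].
  have [_ [k [gk gkc XE]]] := approx_path (d0 m) h1 h2 h3 h4 (gS m) j A cHw M0 hM hBw k2 (le_trans k1 e11).
  rewrite /X XE /Y /ito_incr.
  rewrite (@clamp_stop _ _ _ _ R (fun r => I r w j ord0))//; last exact: ltW.
  rewrite -mulrBr normrM -[leRHS]mul1r; apply: ler_pM => //.
    by rewrite indicE; case: (_ \in _); rewrite ?normr1 ?normr0.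
  have /andP[sg gt] := gk.
  have I1 : `|I (g m k) w j ord0 - I (clamp s t (rho w)) w j ord0| < e / 3.
    apply: hd; first exact: le_trans sg.
      by case/andP: cl => sc ->; rewrite (le_trans s0 sc).
    exact: le_lt_trans md.
  have ent r : 0 <= r <= t -> `|sp_integral (S m) W r w j ord0 - I r w j ord0| <= e / 3.
    move=> rt; have -> : sp_integral (S m) W r w j ord0 - I r w j ord0 =
      (sp_integral (S m) W r w - I r w) j ord0 by rewrite !mxE.
    by apply: le_trans (entry_le_enorm _ _ _) _; apply: le_trans (k3 r rt) _.
  have I2 : `|sp_integral (S m) W (g m k) w j ord0 - I (g m k) w j ord0| <= e / 3.
    by apply: ent; rewrite (le_trans s0 sg).
  have I3 : `|sp_integral (S m) W s w j ord0 - I s w j ord0| <= e / 3.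
    by apply: ent; rewrite s0 ltW.
  move: I1 I2 I3; rewrite ltr_norml !ler_norml => /andP[a1 a2] /andP[b1 b2] /andP[c1 c2].
  by apply/andP; split; lra.
have XY : \forall w \ae P, X m w @[m --> \oo] --> Y w by apply: filterS paths => w [].
have mMax m : measurable_fun setT (fun w => Num.max (Q m w) (q w)).
  exact: measurable_maxr.
have Qq : Ex P (fun w => Num.max (Q m w) (q w)) @[m --> \oo] --> Ex P q.
  apply: (@Ex_dominated _ _ _ P _ _ (fun=> kap)) => //.
  - exact: rint_cst.
  - by apply: filterS paths => w [].
  - move=> m; apply: aeW => w.
    have /andP[h1 h2] := Qb m w; have /andP[h3 h4] := q0 w.
    by rewrite ger0_norm ?le_max ?h1// ge_max h2.
have IQ m : rint P (Q m).
  apply: (@rint_bounded _ _ _ P _ kap (mQ m)) => w; have /andP[h1 h2] := Qb m w.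
  by rewrite ger0_norm.
have Iq : rint P q.
  apply: (@rint_bounded _ _ _ P _ kap mq) => w; have /andP[h1 h2] := q0 w.
  by rewrite ger0_norm.
have IM m : rint P (fun w => Num.max (Q m w) (q w)).
  apply: (@rint_bounded _ _ _ P _ kap (mMax m)) => w.
  have /andP[h1 h2] := Qb m w; have /andP[h3 h4] := q0 w.
  by rewrite ger0_norm ?le_max ?h1// ge_max h2.
have [IY2 EY2] : rint P (fun w => Y w ^+ 2) /\ Ex P (fun w => Y w ^+ 2) <= 8 * K%:R * Ex P q.
  apply: (@Ex_fatou _ _ _ P (fun m w => X m w ^+ 2) _
    (fun m => 8 * K%:R * Ex P (fun w => Num.max (Q m w) (q w)))).
  - by move=> m; case: (mom m).
  - by move=> m w; rewrite sqr_ge0.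
  - exact: measurable_funX.
  - by move=> w; rewrite sqr_ge0.
  - by apply: filterS XY => w XYw; under eq_fun do rewrite expr2; rewrite expr2; exact: cvgM.
  - move=> m; have [_ _ _ h] := mom m; apply: le_trans h _; rewrite ler_wpM2l//.
    by apply: Ex_le => // w; rewrite le_max lexx.
  - by apply: cvgMr.
have [_ EY] : rint P (fun w => Y w ^+ 2) /\ Ex P Y = 0.
  apply: (@Ex_eq0_L2_limit _ _ _ P X Y (8 * K%:R * kap)) => //.
  - by move=> m; case: (mom m).
  - by move=> m; case: (mom m).
  - move=> m; have [_ _ _ h] := mom m; apply: le_trans h _; rewrite ler_wpM2l//.
    rewrite -[leRHS](Ex_cst P); apply: Ex_le => //; first exact: rint_cst.
    by move=> w; case/andP: (Qb m w).
  - by move=> m; case: (mom m).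
split=> //; split=> //; apply: le_trans EY2 _; rewrite -ExZ//.
rewrite le_eqVlt; apply/orP; left; apply/eqP; congr Ex; apply/funext => w.
by rewrite /q; ring.
Unshelve. all: by end_near. Qed.

End ItoIncrement.

Lemma eq_rint {R : realType} {disp : measure_display} {Omega : measurableType disp}
    (P : probability Omega R) (f g : Omega -> R) : rint P f -> (forall w, f w = g w) -> rint P g.
Proof. by move=> If fg; have -> : g = f by apply/funext => w. Qed.

Section ItoConditional.
Context {R : realType} {disp : measure_display} {Omega : measurableType disp}.
Variables (P : probability Omega R) (F : R -> set (set Omega)).
Hypothesis uF : usual_filtration P F.
Variables (J K : nat) (W : R -> Omega -> 'cV[R]_K).
Hypothesis bW : brownian_motion P F W.
Variables (H : R -> Omega -> 'M[R]_(J, K)) (I : R -> Omega -> 'cV[R]_J).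
Hypothesis iI : ito_integral P F W H I.
Hypothesis mH : forall t i j, 0 <= t -> measurable_fun setT (fun w => H t w i j).
Hypothesis cH : \forall w \ae P, forall i j, pcont (fun t => H t w i j : R^o).
Variable rho : Omega -> \bar R.
Hypothesis srho : stopping_time F rho.
Variables (s t B : R).
Hypothesis s0 : 0 <= s.
Hypothesis st : s < t.
Hypothesis B0 : 0 <= B.
Hypothesis hB : \forall w \ae P, forall u, s <= u <= t -> (u%:E < rho w)%E ->
  enorm (H u w) ^+ 2 <= B.

Let X := ito_incr I rho s t.

Lemma ito_incr_sq j : rint P (fun w => X j w ^+ 2).
Proof.
have [h _] := ito_incr_moments uF bW iI mH cH srho s0 st B0 hB j
  (subsigmaT (filtration_sigma uF s0)).
apply: (eq_rint (g := fun w => X j w ^+ 2) h) => w.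
by rewrite indicE mem_set// mul1r.
Qed.

Lemma ito_incr_measurable j : measurable_fun setT (X j).
Proof.
have t0 : 0 <= t by apply: le_trans s0 (ltW st).
by apply: (Fsmeas_measurable uF t0); exact: (ito_incr_smeas uF iI srho s0 st).
Qed.

(** The weight [h] is known at time [s] and may be any bounded function, such as a
    derivative of the test function at the position at time [s]. *)
Lemma ito_incr_cond_mean j (h : Omega -> R) C : smeas (F s) h -> (forall w, `|h w| <= C) ->
  rint P (fun w => h w * X j w) /\ Ex P (fun w => h w * X j w) = 0.
Proof.
move=> mh hC; have mh' := Fsmeas_measurable uF s0 mh; have mX := ito_incr_measurable j.
have IX := rint_sq mX (ito_incr_sq j).
have IhX : rint P (fun w => h w * X j w).
  apply: rint_sqM => //; last exact: ito_incr_sq.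
  apply: (@rint_bounded _ _ _ P _ (C ^+ 2)); first exact: measurable_funX.
  by move=> w; rewrite normrX lerXn2r// nnegrE (le_trans _ (hC w)).
split=> //; apply: (cond_Ex_eq0 (filtration_sigma uF s0) (filtration_measurable uF s0) mh IX _ IhX).
move=> A FA.
by have [_ [-> _]] := ito_incr_moments uF bW iI mH cH srho s0 st B0 hB j FA.
Qed.

Lemma tmin_diff_bound w : 0 <= tmin t (rho w) - tmin s (rho w) <= t - s.
Proof.
have r0 := stopping_ge0 srho w.
rewrite (@clamp_stop _ _ _ _ R id)//; last exact: ltW.
have /andP[h1 h2] := clamp_le (ltW st) r0; rewrite subr_ge0 h1/= lerD2r//.
Qed.

Lemma ito_incr_cond_sq j (h : Omega -> R) C : smeas (F s) h -> (forall w, 0 <= h w <= C) ->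
  rint P (fun w => h w * X j w ^+ 2) /\
  Ex P (fun w => h w * X j w ^+ 2) <=
    16 * K%:R * B * Ex P (fun w => h w * (tmin t (rho w) - tmin s (rho w))).
Proof.
move=> mh hC; have mX := ito_incr_measurable j.
have st' := ltW st; have t0 : 0 <= t by apply: le_trans s0 st'.
pose c := 16 * K%:R * B : R.
have c0 : 0 <= c by rewrite !mulr_ge0.
pose D w := tmin t (rho w) - tmin s (rho w).
have mD : measurable_fun setT D.
  apply: measurable_funB.
    by apply: (Fsmeas_measurable uF t0); exact: (smeas_tmin uF srho).
  by apply: (Fsmeas_measurable uF s0); exact: (smeas_tmin uF srho).
have mh' := Fsmeas_measurable uF s0 mh.
have ID : rint P D.
  apply: (@rint_bounded _ _ _ P _ (t - s)) => // w.
  by have /andP[h1 h2] := tmin_diff_bound w; rewrite ger0_norm.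
have IhD : rint P (fun w => h w * D w).
  apply: (@rint_bounded _ _ _ P _ (C * (t - s))); first exact: measurable_funM.
  move=> w; have /andP[h1 h2] := tmin_diff_bound w; have /andP[h3 h4] := hC w.
  by rewrite ger0_norm ?mulr_ge0// ler_pM.
have IchD : rint P (fun w => h w * (c * D w)).
  by apply: (eq_rint (f := fun w => c * (h w * D w))); [exact: rintZ|move=> w; ring].
have [] := @cond_Ex_le _ _ _ P (F s) (filtration_sigma uF s0) (filtration_measurable uF s0)
  h (fun w => X j w ^+ 2) (fun w => c * D w) mh _ (ito_incr_sq j) (rintZ c ID) _ _ _ IchD.
- by move=> w; case/andP: (hC w).
- by move=> w; rewrite sqr_ge0.
- by move=> w; rewrite mulr_ge0//; case/andP: (tmin_diff_bound w).
- move=> A FA; have [_ [_ hle]] := ito_incr_moments uF bW iI mH cH srho s0 st B0 hB j FA.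
  have eA : (fun w => \1_A w * X j w ^+ 2) = (fun w => (\1_A w * X j w) ^+ 2).
    apply/funext => w; rewrite exprMn indicE; case: (_ \in _); rewrite ?expr1n//.
    by rewrite expr0n /= !mul0r.
  by rewrite eA.
move=> h1 h2; split=> //; apply: le_trans h2 _; rewrite -ExZ//.
by rewrite le_eqVlt; apply/orP; left; apply/eqP; congr Ex; apply/funext => w; rewrite /c /D; ring.
Qed.

End ItoConditional.

(** * Topology and measurability of the state space *)
Section StateSpace.
Context {R : realType}.

Lemma open_near (V : normedModType R) (O : set V) x : open O -> O x ->
  exists2 d, 0 < d & forall y, `|y - x| < d -> O y.
Proof.
move=> oO Ox; have /nbhs_ballP[d /= d0 h] : nbhs x O by apply: open_nbhs_nbhs.
by exists d => // y yx; apply: h; rewrite -ball_normE /= distrC.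
Qed.

Lemma nbhs_norm_lt (V : normedModType R) (x : V) d : 0 < d ->
  \forall y \near x, `|y - x| < d.
Proof. by move=> d0; apply/nbhs_ballP; exists d => //= y; rewrite -ball_normE /= distrC. Qed.

Lemma closed_seqP (V : normedModType R) (A : set V) :
  (forall x, ~ A x -> exists2 d, 0 < d & forall y, `|y - x| < d -> ~ A y) -> closed A.
Proof.
move=> h; rewrite -openC openE => x /h[d d0 hd].
by apply: filterS (nbhs_norm_lt x d0) => y /hd.
Qed.

Lemma continuous_eps (V : normedModType R) (f : V -> R) :
  (forall x e, 0 < e -> exists2 d, 0 < d & forall y, `|y - x| < d -> `|f y - f x| < e) ->
  continuous f.
Proof.
move=> h x; apply/cvgrPdist_lt => e e0; have [d d0 hd] := h x e e0.
by apply: filterS (nbhs_norm_lt x d0) => y yx; rewrite distrC hd.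
Qed.

(** The tube lemma in metric form. *)
Lemma tube (X Y : normedModType R) (K : set Y) x (Q : X -> Y -> Prop) : compact K ->
  (forall v, K v -> exists2 e, 0 < e & forall y u, `|y - x| < e -> `|u - v| < e -> Q y u) ->
  exists2 e, 0 < e & forall y v, `|y - x| < e -> K v -> Q y v.
Proof.
move=> /compact_near_coveringP cK hK.
have /nbhs_ballP[e /= e0 h] : \forall y \near x, K `<=` Q y.
  apply: cK => v /hK[e e0 h].
  exists ([set u | `|u - v| < e], [set y | `|y - x| < e]).
    by split; exact: nbhs_norm_lt.
  by move=> [u y] [/= h1 h2]; exact: h.
exists e => // y v yx Kv; apply: (h y) => //.
by rewrite -ball_normE /= distrC.
Qed.

Lemma mx_norm_lt m n (A : 'M[R]_(m, n)) c : (forall i j, `|A i j| <= c / 2) -> 0 < c -> `|A| < c.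
Proof.
move=> h c0; have c2 : 0 <= c / 2 by rewrite divr_ge0// ltW.
by apply: (@le_lt_trans _ _ (c / 2)); [apply/mx_norm_leP|rewrite ltr_pdivrMr// mulr2n mulrDr !mulr1 ltrDl].
Qed.

Lemma cV_compact n (A : set 'cV[R]_n) M : closed A -> (forall x, A x -> enorm x <= M) ->
  compact A.
Proof.
move=> cA bA.
pose B : set 'rV[R]_n := [set v | forall i, `[- M, M]%classic (v ord0 i)].
have cB : compact B by apply: (@rV_compact _ _ (fun=> `[- M, M]%classic)) => i; exact: segment_compact.
have tc : continuous (fun v : 'rV[R]_n => v^T).
  move=> v U /nbhs_ballP[e /= e0 hU].
  apply: filterS (nbhs_norm_lt v (divr_gt0 e0 (ltr0n _ 2))) => u uv.
  apply: hU; rewrite -ball_normE /=.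
  apply: mx_norm_lt => // i j; rewrite !mxE distrC.
  have := entry_le_norm (u - v) j i; rewrite !mxE => h; exact: le_trans h (ltW uv).
have cB' : compact ((fun v : 'rV[R]_n => v^T) @` B).
  by apply: continuous_compact => //; exact: continuous_subspaceT.
apply: subclosed_compact cA cB' _ => x Ax; exists x^T; last by rewrite trmxK.
move=> i; rewrite /= in_itv /= mxE -ler_norml.
by apply: le_trans (entry_le_enorm x i ord0) (bA x Ax).
Qed.

Lemma edot_lipschitz n (p v u : 'cV[R]_n) : `|edot p v - edot p u| <= enorm p * enorm (v - u).
Proof. by rewrite -edotBr; exact: cauchy_schwarz_norm. Qed.

End StateSpace.

Lemma mid_swap {R : realType} (a b c : R) : a - c < b < a + c -> b - c < a < b + c.
Proof. by move=> /andP[h1 h2]; apply/andP; split; lra. Qed.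

Lemma mid_dist {R : realType} (x y q c d : R) : q - c < y < q + c -> x - c < q < x + c ->
  c < d / 4 -> `|y - x| <= d / 2.
Proof.
move=> /andP[h1 h2] /andP[h3 h4] h5; rewrite ler_norml; apply/andP; split; lra.
Qed.

Section StateMeasurability.
Context {R : realType} {disp : measure_display} {Omega : measurableType disp}.
Variable G : set (set Omega).
Hypothesis sG : sigma_algebra setT G.

Lemma smeas_ray (f : Omega -> R) : (forall c, G [set w | c < f w]) -> smeas G f.
Proof.
move=> h; apply: (measurability _ (RGenOInfty.measurableE R)).
move=> _ [_ [x ->] <-]; rewrite setTI; apply/measurable_subsigma => //.
have -> : f @^-1` `]x, +oo[%classic = [set w | x < f w].
  by apply/seteqP; split=> w /=; rewrite in_itv /= andbT.
exact: h.
Qed.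

Lemma smeas_set_lt (f : Omega -> R) a b : smeas G f -> G [set w | a < f w < b].
Proof.
move=> /(smeasP sG)/(_ `]a, b[%classic (measurable_itv _)).
have -> // : f @^-1` `]a, b[%classic = [set w | a < f w < b].
by apply/seteqP; split=> w; rewrite /= in_itv.
Qed.

Variables (n : nat) (X : Omega -> 'cV[R]_n).
Hypothesis mX : forall i, smeas G (fun w => X w i ord0).

(** An open set is a countable union of rational boxes. *)
Lemma smeas_open (O : set 'cV[R]_n) : open O -> G (X @^-1` O).
Proof.
move=> oO.
pose box (p : 'cV[rat]_n * nat) : set 'cV[R]_n :=
  [set y | forall i, ratr (p.1 i ord0) - p.2.+1%:R^-1 < y i ord0 < ratr (p.1 i ord0) + p.2.+1%:R^-1].
have -> : X @^-1` O = \bigcup_p (if `[< box p `<=` O >] then X @^-1` (box p) else set0).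
  apply/seteqP; split=> [w Ow|w [p _]]; last by case: asboolP => // h /h.
  have [d d0 hd] := open_near oO Ow.
  have [k hk] : exists k : nat, k.+1%:R^-1 < d / 4 :> R.
    have /cvgrPdist_lt/(_ _ (divr_gt0 d0 (ltr0n _ 4)))[N _ /(_ N (leqnn _))] := @cvg_harmonic R.
    by rewrite /= sub0r normrN ger0_norm ?invr_ge0//; exists N.
  have k0 : 0 < k.+1%:R^-1 :> R by rewrite invr_gt0.
  have hq i : exists q : rat, X w i ord0 - k.+1%:R^-1 < ratr q < X w i ord0 + k.+1%:R^-1.
    by apply: rat_between; rewrite ltrBlDr -addrA ltrDl addr_gt0.
  have [q hq'] := choice hq.
  exists (\col_i q i, k) => //.
  have bw : box (\col_i q i, k) (X w).
    by move=> i; rewrite /= mxE; exact: mid_swap.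
  case: asboolP => // nb; exfalso; apply: nb => y hy; apply: hd.
  apply: mx_norm_lt => // i j; rewrite (ord1 j) !mxE.
  have := hy i; rewrite /= mxE => hyi; exact: (mid_dist hyi (hq' i) hk).
apply: (subsigma_bigcupT sG) => [|p]; first exact: countableP.
case: asboolP => _; last first.
  by rewrite -[set0]setCT; apply: (subsigmaC sG); exact: subsigmaT.
have -> : X @^-1` box p = \bigcap_i [set w | ratr (p.1 i ord0) - p.2.+1%:R^-1 < X w i ord0
    < ratr (p.1 i ord0) + p.2.+1%:R^-1].
  by apply/seteqP; split=> w h i; [move=> _; exact: h|exact: (h i)].
by apply: (subsigma_bigcapT sG) => [|i]; [exact: countableP|exact: smeas_set_lt].
Qed.

Lemma smeas_closed (A : set 'cV[R]_n) : closed A -> G (X @^-1` A).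
Proof.
move=> cA; rewrite -[X in G X]setCK; apply: (subsigmaC sG).
exact: (smeas_open (closed_openC cA)).
Qed.

(** A function continuous relatively to [A] has superlevel sets in [A] that are traces
    of open sets. *)
Lemma smeas_within (A : set 'cV[R]_n) (f : 'cV[R]_n -> R) : G (X @^-1` A) ->
  (forall x, A x -> forall e, 0 < e -> exists2 d, 0 < d &
    forall y, A y -> `|y - x| < d -> `|f y - f x| < e) ->
  smeas G (fun w => \1_A (X w) * f (X w)).
Proof.
move=> GA cf; apply: smeas_ray => c.
pose O : set 'cV[R]_n := [set y | exists x d, [/\ A x, 0 < d, `|y - x| < d &
  forall z, A z -> `|z - x| < d -> c < f z]].
have oO : open O.
  rewrite openE => y [x [d [Ax d0 yx h]]].
  have e0 : 0 < d - `|y - x| by rewrite subr_gt0.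
  apply: filterS (nbhs_norm_lt y e0) => z zy; exists x, d; split=> //.
  rewrite -(subrK y z) -addrA; apply: le_lt_trans (ler_normD _ _) _; lra.
have AO x : A x -> (c < f x) <-> O x.
  move=> Ax; split=> [cfx|[y [d [_ _ xy h]]]]; last exact: h.
  have e0 : 0 < f x - c by rewrite subr_gt0.
  have [d d0 hd] := cf x Ax _ e0; exists x, d; split=> //; first by rewrite subrr normr0.
  by move=> z Az zx; have := hd z Az zx; rewrite ltr_norml => /andP[h _]; lra.
have GO := smeas_open oO.
have [c0|c0] := ltP c 0.
  have -> : [set w | c < \1_A (X w) * f (X w)] = ~` (X @^-1` A `&` ~` (X @^-1` O)).
    apply/seteqP; split=> w /=.
      move=> h [Aw]; apply; apply/(AO _ Aw).
      by move: h; rewrite indicE mem_set// mul1r.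
    move=> h; rewrite indicE; case: (boolP (_ \in _)) => [/set_mem Aw|_]; last by rewrite mul0r.
    by rewrite mul1r; apply/(AO _ Aw); apply: contrapT => nO; apply: h.
  by apply: (subsigmaC sG); apply: (subsigmaI sG) => //; exact: (subsigmaC sG).
have -> : [set w | c < \1_A (X w) * f (X w)] = X @^-1` A `&` X @^-1` O.
  apply/seteqP; split=> w /=; rewrite indicE.
    case: (boolP (_ \in _)) => [/set_mem Aw|_]; last by rewrite mul0r ltNge c0.
    by rewrite mul1r => h; split=> //; apply/(AO _ Aw).
  by move=> [Aw Ow]; rewrite mem_set// mul1r; apply/(AO _ Aw).
exact: (subsigmaI sG).
Qed.

Lemma smeas_continuous (f : 'cV[R]_n -> R) :
  (forall x e, 0 < e -> exists2 d, 0 < d & forall y, `|y - x| < d -> `|f y - f x| < e) ->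
  smeas G (fun w => f (X w)).
Proof.
move=> cf; have := @smeas_within setT f.
have -> : (fun w => \1_[set: 'cV[R]_n] (X w) * f (X w)) = (fun w => f (X w)).
  by apply/funext => w; rewrite indicE mem_set// mul1r.
apply; first by rewrite preimage_setT; exact: subsigmaT.
by move=> x _ e e0; have [d d0 h] := cf x e e0; exists d => // y _; exact: h.
Qed.

End StateMeasurability.

Section Distance.
Context {R : realType} (n : nat).
Implicit Types (V : set 'cV[R]_n) (x y : 'cV[R]_n).

Lemma enorm_small (e : R) : 0 < e -> exists2 d : R, 0 < d &
  forall v : 'cV[R]_n, `|v| < d -> enorm v < e.
Proof.
move=> e0; have c0 : 0 < (n * 1)%:R + 1 :> R by rewrite ltr_wpDl.
exists (e / ((n * 1)%:R + 1)) => [|v]; first by rewrite divr_gt0.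
rewrite ltr_pdivlMr// => h; apply: le_lt_trans (enorm_le_norm v) _.
by apply: le_lt_trans h; rewrite mulrC ler_wpM2l// lerDl.
Qed.

(** The distance to a nonempty set is finite; see [set_distE]. *)
Definition vdist V x : R := fine (set_dist x V).

Lemma set_dist_ge0 V x : (0 <= set_dist x V)%E.
Proof. by apply: le_ereal_inf_tmp => _ [a _ <-]; rewrite lee_fin enorm_ge0. Qed.

Variable V : set 'cV[R]_n.
Hypothesis V0 : V !=set0.

Lemma set_distE x : set_dist x V = (vdist V x)%:E.
Proof.
rewrite /vdist fineK// ge0_fin_numE ?set_dist_ge0//; have [a Va] := V0.
apply: (@le_lt_trans _ _ (enorm (x - a))%:E); last exact: ltry.
by apply: ereal_inf_lbound; exists a.
Qed.

Lemma vdist_ge0 x : 0 <= vdist V x.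
Proof. by rewrite -lee_fin -set_distE set_dist_ge0. Qed.

Lemma vdist_le x a : V a -> vdist V x <= enorm (x - a).
Proof. by move=> Va; rewrite -lee_fin -set_distE; apply: ereal_inf_lbound; exists a. Qed.

Lemma vdist_ge x c : (forall a, V a -> c <= enorm (x - a)) -> c <= vdist V x.
Proof.
move=> h; rewrite -lee_fin -set_distE; apply: le_ereal_inf_tmp => _ [a Va <-].
by rewrite lee_fin h.
Qed.

Lemma vdist_lip x y : `|vdist V x - vdist V y| <= enorm (x - y).
Proof.
have h u v : vdist V u <= enorm (u - v) + vdist V v.
  rewrite -lerBlDl; apply: vdist_ge => a Va; rewrite lerBlDl.
  apply: le_trans (vdist_le u Va) _; rewrite -{1}(subrK v u) -addrA; exact: enormD.
rewrite ler_norml; apply/andP; split; have := h x y; have := h y x; rewrite (enormBC y); lra.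
Qed.

Lemma vdist_cont x e : 0 < e -> exists2 d, 0 < d & forall y, `|y - x| < d ->
  `|vdist V y - vdist V x| < e.
Proof.
move=> e0; have [d d0 h] := enorm_small e0; exists d => // y yx.
by apply: le_lt_trans (vdist_lip _ _) (h _ yx).
Qed.

Lemma vdist_eq0 x : V x -> vdist V x = 0.
Proof.
by move=> Vx; apply/le_anti; rewrite vdist_ge0 -(@enorm0 R n 1) -(subrr x) vdist_le.
Qed.

Lemma vdist_gt0 x : closed V -> ~ V x -> 0 < vdist V x.
Proof.
move=> cV nVx; have [d d0 h] := open_near (closed_openC cV) nVx.
apply: lt_le_trans d0 _; apply: vdist_ge => a Va; rewrite leNgt; apply/negP => xa.
apply: (h a) => //; apply: le_lt_trans (norm_le_enorm _) _.
by rewrite enormBC.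
Qed.

End Distance.

Section FirstTimes.
Context {R : realType}.

Definition first_time {T : Type} (q : R) (X : R -> T -> R) (w : T) : \bar R :=
  ereal_inf [set t%:E | t in [set t : R | q <= t /\ X t w <= 0]].

Lemma first_time_ge T q (X : R -> T -> R) w : (q%:E <= first_time q X w)%E.
Proof. by apply: le_ereal_inf_tmp => _ [t [qt _] <-]; rewrite lee_fin. Qed.

Lemma first_time_lt T q (X : R -> T -> R) w u : q <= u -> (u%:E < first_time q X w)%E ->
  0 < X u w.
Proof.
move=> qu h; rewrite ltNge; apply/negP => Xu; move: h; rewrite ltNge => /negP; apply.
by apply: ereal_inf_lbound; exists u.
Qed.

(** The infimum is attained, the set of nonpositive times being closed. *)
Lemma first_time_leP T q (X : R -> T -> R) w t : 0 <= q -> pcont (X ^~ w : R -> R^o) ->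
  (first_time q X w <= t%:E)%E <-> (exists s, q <= s <= t /\ X s w <= 0).
Proof.
move=> q0 cX; split=> [h|[s [/andP[qs st] Xs]]]; last first.
  by apply: (@le_trans _ _ s%:E); [apply: ereal_inf_lbound; exists s|rewrite lee_fin].
apply: contrapT => no.
have qt : q <= t by rewrite -lee_fin (le_trans (first_time_ge q X w)).
have Xt : 0 < X t w.
  by rewrite ltNge; apply/negP => Xt; apply: no; exists t; rewrite qt lexx.
have [d d0 hd] := cX t (le_trans q0 qt) _ Xt.
suff : ((t + d)%:E <= first_time q X w)%E.
  by move=> /le_trans/(_ h); rewrite lee_fin gerDl leNgt d0.
apply: le_ereal_inf_tmp => _ [s [qs Xs] <-]; rewrite lee_fin leNgt; apply/negP => sd.
have [st|ts] := leP s t; first by apply: no; exists s; rewrite qs st.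
have := hd s (le_trans q0 qs); rewrite gtr0_norm ?subr_gt0// ltrBlDl => /(_ sd).
by rewrite ltr_norml => /andP[]; rewrite ltrBrDl subrr => /lt_le_trans/(_ Xs); rewrite ltxx.
Qed.

Context {disp : measure_display} {Omega : measurableType disp}.
Variables (P : probability Omega R) (F : R -> set (set Omega)).
Hypothesis uF : usual_filtration P F.

Lemma first_time_stopping q (X : R -> Omega -> R) : 0 <= q ->
  (forall t, 0 <= t -> smeas (F t) (X t)) ->
  (\forall w \ae P, pcont (X ^~ w : R -> R^o)) ->
  stopping_time F (first_time q X).
Proof.
move=> q0 aX cX; split=> [w|t t0].
  by apply: le_trans (first_time_ge q X w); rewrite lee_fin.
apply: (subsigma_ae (filtration_sigma uF t0) (filtration_null uF t0)
  (B := [set w | exists s, q <= s <= t /\ X s w <= 0])).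
  apply: (path_hits (filtration_sigma uF t0) (filtration_null uF t0) q0 _ cX).
  move=> s /andP[qs st]; have s0 := le_trans q0 qs.
  exact: (Fsmeas_le uF s0 st (aX s s0)).
by apply: filterS cX => w cXw; exact: first_time_leP.
Qed.

Lemma stopping_min (r1 r2 : Omega -> \bar R) : stopping_time F r1 -> stopping_time F r2 ->
  stopping_time F (fun w => Order.min (r1 w) (r2 w)).
Proof.
move=> [p1 s1] [p2 s2]; split=> [w|t t0]; first by rewrite le_min p1 p2.
have -> : [set w | (Order.min (r1 w) (r2 w) <= t%:E)%E] =
    ~` (~` [set w | (r1 w <= t%:E)%E] `&` ~` [set w | (r2 w <= t%:E)%E]).
  rewrite -setCU setCK; apply/seteqP; split=> w /=; rewrite ge_min.
    by move/orP.
  by move=> h; apply/orP.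
have sF := filtration_sigma uF t0.
apply: (subsigmaC sF); apply: (subsigmaI sF); apply: (subsigmaC sF); [exact: s1|exact: s2].
Qed.

End FirstTimes.

(** * Separation of the cones of reflection directions *)
Section Cones.
Context {R : realType} (n : nat).
Implicit Types (C : set 'cV[R]_n) (p v w x y z : 'cV[R]_n).

Lemma convex_comb C x y (l : R) : convex C -> C x -> C y -> 0 <= l <= 1 ->
  C (l *: x + (1 - l) *: y).
Proof.
move=> cC Cx Cy /andP[l0 l1].
by have := cC x y (Itv01 l0 l1); rewrite !inE; apply.
Qed.

(** The sum is twice the midpoint. *)
Lemma cone_add C x y : convex C -> cone C -> C x -> C y -> C (x + y).
Proof.
move=> vC kC Cx Cy.
have -> : x + y = 2^-1 *: (2 *: x) + (1 - 2^-1) *: (2 *: y).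
  rewrite !scalerA mulVf// scale1r; congr (_ + _).
  by rewrite [(_ * _)](_ : _ = 1) ?scale1r//; field.
apply: convex_comb => //; try (apply: kC => //).
by apply/andP; split; lra.
Qed.

Lemma quad_ge0 (a b : R) : 0 <= b ->
  (forall t, 0 < t <= 1 -> 0 <= 2 * t * a + t ^+ 2 * b) -> 0 <= a.
Proof.
move=> b0 h; rewrite leNgt; apply/negP => a0.
have ba : 0 < b - a by lra.
have := h (- a / (b - a)); rewrite divr_gt0 ?oppr_gt0//= ler_pdivrMr// mul1r lerBrDr.
rewrite addNr => /(_ b0); set t := - a / (b - a).
have t0 : 0 < t by rewrite divr_gt0 ?oppr_gt0.
have tb : t * b <= - a.
  rewrite /t mulrAC ler_pdivrMr//; nra.
have -> : 2 * t * a + t ^+ 2 * b = t * (2 * a + t * b) by ring.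
rewrite pmulr_rge0//; lra.
Qed.

Lemma sub_enorm_continuous z : continuous (fun x => enorm (x - z)).
Proof.
apply: continuous_eps => x e e0; have [d d0 h] := enorm_small n e0.
exists d => // y yx; apply: le_lt_trans (enorm_dist _ _) _.
by rewrite opprB addrA subrK; exact: h.
Qed.

Lemma closed_enorm_le z (c : R) : closed [set x | enorm (x - z) <= c].
Proof.
have -> : [set x | enorm (x - z) <= c] = (fun x => enorm (x - z)) @^-1` [set t | t <= c] by [].
by apply: closed_comp => [x _|]; [exact: sub_enorm_continuous|exact: closed_le].
Qed.

Lemma nearest_point C z : closed C -> C !=set0 ->
  exists2 p, C p & forall q, C q -> enorm (p - z) <= enorm (q - z).
Proof.
move=> cC [a Ca]; pose A := C `&` [set x | enorm (x - z) <= enorm (a - z)].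
have cA : compact A.
  apply: (@cV_compact _ _ _ (enorm (a - z) + enorm z)).
    by apply: closedI => //; exact: closed_enorm_le.
  move=> x [_ /= h]; rewrite -{1}(subrK z x); apply: le_trans (enormD _ _) _.
  by rewrite lerD2r.
have A0 : A !=set0 by exists a; split => //=.
have [p /set_mem[Cp pa] hp] := compact_EVT_min A0 cA
  (continuous_subspaceT (@sub_enorm_continuous z)).
exists p => // q Cq; have [qa|/ltW aq] := leP (enorm (q - z)) (enorm (a - z)).
  by apply: hp; rewrite inE.
exact: le_trans pa aq.
Qed.

(** The vector from [- v] to its projection on the cone lies in the dual cone, by
    minimality of the distance, and it is nonzero since [- v] is not in the cone. *)
Lemma cone_dual_vector C v : closed C -> convex C -> cone C -> C v -> ~ C (- v) ->
  exists p, (forall w, C w -> 0 <= edot p w) /\ 0 < edot p v.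
Proof.
move=> cC vC kC Cv nCv; have [q Cq hq] := nearest_point (- v) cC (ex_intro _ v Cv).
exists (q + v); rewrite opprK in hq.
have sq z : C z -> enorm (q + v) ^+ 2 <= enorm (z + v) ^+ 2.
  by move=> Cz; rewrite lerXn2r ?nnegrE ?enorm_ge0//; exact: hq.
have pw w : C w -> 0 <= edot (q + v) w.
  move=> Cw; apply: (@quad_ge0 _ (enorm w ^+ 2)); first by rewrite sqr_ge0.
  move=> t /andP[t0 t1].
  have /sq : C (q + t *: w) by apply: cone_add => //; apply: kC => //; exact: ltW.
  rewrite [q + t *: w + v]addrAC (enormD_sqr (q + v)) edotZr enormZ exprMn real_normK ?num_real//.
  by rewrite -addrA lerDl mulrA.
have pq : edot (q + v) q <= 0.
  rewrite -oppr_ge0; apply: (@quad_ge0 _ (enorm q ^+ 2)); first by rewrite sqr_ge0.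
  move=> t /andP[t0 t1].
  have /sq : C ((1 - t) *: q) by apply: kC => //; rewrite subr_ge0.
  have -> : (1 - t) *: q + v = (q + v) + (- t) *: q.
    by rewrite scalerBl scale1r scaleNr addrAC.
  rewrite (enormD_sqr (q + v) (- t *: q)) edotZr enormZ exprMn real_normK ?num_real// sqrrN.
  rewrite -addrA lerDl => h; apply: le_trans h _.
  by rewrite le_eqVlt; apply/orP; left; apply/eqP; ring.
split=> //; have e : edot (q + v) v = enorm (q + v) ^+ 2 - edot (q + v) q.
  by rewrite -edotvv -edotBr addrAC subrr add0r.
rewrite e; apply: (@lt_le_trans _ _ (enorm (q + v) ^+ 2)); last by rewrite lerDl oppr_ge0.
rewrite exprn_gt0// lt_def enorm_ge0 andbT; apply/eqP => h; apply: nCv.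
have -> // : - v = q.
apply/eqP; rewrite eq_sym -addr_eq0; apply/eqP; apply/matrixP => i j.
by apply/eqP; rewrite [X in _ == X]mxE -normr_le0 -h; exact: entry_le_enorm.
Qed.

Definition usphere : set 'cV[R]_n := [set v | enorm v = 1].

Lemma usphere_compact : compact usphere.
Proof.
apply: (@cV_compact _ _ _ 1) => [|x /= ->//]; apply: closed_seqP => x nx.
have e0 : 0 < `|enorm x - 1| by rewrite normr_gt0 subr_eq0; apply/eqP.
have [d d0 h] := enorm_small n e0; exists d => // y yx y1.
have := le_lt_trans (enorm_dist _ _) (h _ yx); rewrite y1 distrC ltxx//.
Qed.

Lemma edot_suml (s : seq 'cV[R]_n) (f : 'cV[R]_n -> 'cV[R]_n) v :
  edot (\sum_(i <- s) f i) v = \sum_(i <- s) edot (f i) v.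
Proof.
elim: s => [|a s IH]; last by rewrite !big_cons edotDl IH.
by rewrite !big_nil /edot big1// => i _; rewrite mxE mul0r.
Qed.

Lemma edot_continuous p : continuous (edot p : 'cV[R]_n -> R).
Proof.
apply: continuous_eps => x e e0.
have c0 : 0 < enorm p + 1 by rewrite ltr_wpDl ?enorm_ge0.
have [d d0 h] := enorm_small n (divr_gt0 e0 c0).
exists d => // y yx; rewrite -edotBr.
apply: le_lt_trans (cauchy_schwarz_norm _ _) _.
have := h _ yx; rewrite ltr_pdivlMr// mulrC; apply: le_lt_trans.
by rewrite ler_wpM2r ?enorm_ge0// lerDl.
Qed.

(** The unit vectors of [C] form a compact set, covered by finitely many half-spaces
    given by [cone_dual_vector]; the sum of the corresponding dual vectors is positive
    on all of them. *)
Lemma pointed_cone_dual C : closed C -> convex C -> cone C ->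
  (forall v, usphere v -> C v -> ~ C (- v)) ->
  exists p (c : R), 0 < c /\ forall v, usphere v -> C v -> c <= edot p v.
Proof.
move=> cC vC kC pt; pose K := C `&` usphere.
have cK : compact K.
  by rewrite /K setIC; apply: compact_closedI => //; exact: usphere_compact.
have hp v : exists p, K v -> (forall w, C w -> 0 <= edot p w) /\ 0 < edot p v.
  have [[Cv uv]|nK] := pselect (K v); last by exists 0.
  by have [p hp] := cone_dual_vector cC vC kC Cv (pt v uv Cv); exists p.
have [p {}hp] := choice hp.
have := cK; rewrite compact_cover => /(_ _ K (fun v => [set u | 0 < edot (p v) u])) [].
- move=> v _; have -> : [set u | 0 < edot (p v) u] = edot (p v) @^-1` [set t | 0 < t] by [].
  by apply: open_comp => [u _|]; [exact: edot_continuous|exact: open_gt].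
- by move=> v Kv; exists v => //; have [] := hp v Kv.
move=> D' DK cov; pose q := \sum_(i <- finmap.enum_fset D') p i.
have qpos v : K v -> 0 < edot q v.
  move=> Kv; have [i /= iD iv] := cov v Kv; rewrite /q edot_suml.
  rewrite (big_rem i)//=; apply: ltr_pwDl => //.
  rewrite big_seq; apply: sumr_ge0 => j /mem_rem jD.
  by have [h _] := hp j (set_mem (DK j jD)); apply: h; case: Kv.
have [K0|K0] := pselect (K !=set0); last first.
  by exists 0, 1; split=> // v uv Cv; exfalso; apply: K0; exists v.
have [v /set_mem Kv hv] := compact_EVT_min K0 cK (continuous_subspaceT (@edot_continuous q)).
exists q, (edot q v); split=> [|u uu Cu]; first exact: qpos.
by apply: hv; rewrite inE.
Qed.

(** By the triangle inequality, the condition defines a closed convex set. *)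
Lemma hull_halfspace (A : set 'cV[R]_n) p (c : R) : 0 <= c ->
  (forall v, A v -> c * enorm v <= edot p v) ->
  forall w, closed_convex_hull A w -> c * enorm w <= edot p w.
Proof.
move=> c0 hA; suff : closed_convex_hull A `<=` [set w | c * enorm w <= edot p w] by [].
apply: smallest_sub => //; split.
  apply: closed_seqP => x /= /negP; rewrite -ltNge => hx.
  have c1 : 0 < enorm p + c + 1 by rewrite ltr_wpDl// addr_ge0// enorm_ge0.
  have e0 : 0 < (c * enorm x - edot p x) / (enorm p + c + 1).
    by rewrite divr_gt0 ?subr_gt0.
  have [d d0 h] := enorm_small n e0; exists d => // y /h.
  rewrite ltr_pdivlMr// => hy hy'.
  have := edot_lipschitz p y x; have := enorm_dist y x.
  rewrite !ler_norml => /andP[h1 h2] /andP[h3 h4].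
  have h5 : c * (enorm x - enorm y) <= c * enorm (y - x) by rewrite ler_wpM2l//; lra.
  have h6 : 0 <= enorm (y - x) by exact: enorm_ge0.
  lra.
move=> x y l; rewrite !inE /= => hx hy.
change (c * enorm (l%:num *: (x : 'cV[R]_n) + (1 - l%:num) *: (y : 'cV[R]_n)) <=
  edot p (l%:num *: (x : 'cV[R]_n) + (1 - l%:num) *: (y : 'cV[R]_n))).
have l0 : 0 <= l%:num by [].
have l1 : 0 <= 1 - l%:num by rewrite subr_ge0.
rewrite edotDr !edotZr.
apply: (@le_trans _ _ (c * (l%:num * enorm x + (1 - l%:num) * enorm y))).
  rewrite ler_wpM2l//; apply: le_trans (enormD _ _) _.
  by rewrite !enormZ !ger0_norm.
rewrite mulrDr; apply: lerD; rewrite mulrCA ler_wpM2l//.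
Qed.

End Cones.

Section ReflectionCones.
Context {R : realType} (J : nat).
Variables (G : set 'cV[R]_J) (d : 'cV[R]_J -> set 'cV[R]_J).
Hypothesis hE : ESP G d.

Lemma ESP_closed : closed G.
Proof. by case: hE => [[U [_ _ ->]] _ _ _]; exact: closed_closure. Qed.

Lemma bdry_sub x : bdry G x -> G x.
Proof. by move=> [+ _]; apply: ESP_closed. Qed.

Lemma ESP_cases x : G x -> G° x \/ bdry G x.
Proof.
move=> Gx; have [h|h] := pselect (G° x); first by left.
by right; split=> //; exact: subset_closure.
Qed.

Lemma graph_away x v : ~ (G x /\ d x v) -> exists2 e, 0 < e &
  forall y u, `|y - x| < e -> `|u - v| < e -> ~ (G y /\ d y u).
Proof.
move=> nxv; case: hE => _ _ _ /closed_openC; rewrite openE => /(_ (x, v) nxv).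
move=> /nbhs_ballP[e /= e0 h]; exists e => // y u yx uv; apply: (h (y, u)).
by split; rewrite -ball_normE /= distrC.
Qed.

(** The existence of a line in the cone passes to limits because the graph of [d] is
    closed and unit vectors form a compact set. *)
Lemma Vset_closed : closed (Vset G d).
Proof.
apply: closed_seqP => x nV; have [Gx|nG] := pselect (G x); last first.
  have [e e0 h] := open_near (closed_openC ESP_closed) nG.
  by exists e => // y /h nGy [/bdry_sub].
have [Gi|bx] := ESP_cases Gx.
  have [e e0 h] := open_near (@open_interior _ G) Gi.
  by exists e => // y /h Gy [[_]].
have [v uv|e e0 h] := @tube R _ _ _ x (fun y v => ~ (G y /\ d y v) \/ ~ (G y /\ d y (- v)))
  (@usphere_compact R J).
  have [dv|ndv] := pselect (d x v); last first.
    have [|e e0 h] := @graph_away x v; first by case.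
    by exists e => // y u yx uv'; left; exact: h.
  have [|e e0 h] := @graph_away x (- v).
    move=> [_ dnv]; apply: nV; split=> //; exists v => //.
    by split; split=> //=; rewrite enormN.
  exists e => // y u yx uv'; right; apply: h => //.
  by rewrite -opprD normrN.
exists e => // y yx [/bdry_sub Gy [v uv [[d1 _] [d2 _]]]].
by case: (h y v yx uv); apply.
Qed.

(** In the interior the cone is trivial; elsewhere one normalizes [v]. *)
Lemma cone_homogeneous u p (c : R) : G u -> (forall v, d1 d u v -> bdry G u -> c <= edot p v) ->
  forall v, d u v -> c * enorm v <= edot p v.
Proof.
move=> Gu h v dv; have [->|v0] := eqVneq v 0.
  by rewrite enorm0 mulr0 /edot big1// => i _; rewrite mxE mulr0.
have nv : 0 < enorm v.
  rewrite lt_def enorm_ge0 andbT; apply: contra_neq v0 => h0.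
  apply/matrixP => i j; apply/eqP; rewrite [X in _ == X]mxE -normr_le0 -h0.
  exact: entry_le_enorm.
have [Gi|bu] := ESP_cases Gu.
  by move: dv; case: hE => _ _ -> // _ /= v00; rewrite v00 eqxx in v0.
have kd : cone (d u) by case: hE => _ /(_ u bu)[].
have uv : d1 d u ((enorm v)^-1 *: v).
  split; first by apply: kd => //; rewrite invr_ge0 ltW.
  by rewrite /= enormZ gtr0_norm ?invr_gt0// mulVf// gt_eqF.
by have := h _ uv bu; rewrite edotZr ler_pdivlMl// mulrC.
Qed.

(** Outside [Vset] the cone [d x] contains no line and has a strictly positive dual
    vector. Half of its lower bound survives for the cones at nearby points: unit
    vectors outside [d x] stay outside them, since the graph of [d] is closed. *)
Lemma cone_separation x : G x -> ~ Vset G d x -> exists p (c e : R),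
  [/\ 0 < c, 0 < e & forall y, `|y - x| < e -> G y ->
    forall v, d y v -> c * enorm v <= edot p v].
Proof.
move=> Gx nV; have [Gi|bx] := ESP_cases Gx.
  have [e e0 h] := open_near (@open_interior _ G) Gi.
  exists 0, 1, e; split=> // y /h Gy _ v.
  case: hE => _ _ -> // _ /= ->; rewrite enorm0 mulr0 /edot big1// => i _.
  by rewrite mxE mul0r.
case: hE => _ /(_ x bx)[_ _ cC vC kC] dint _.
have [|p [c [c0 hp]]] := pointed_cone_dual cC vC kC.
  move=> v uv dv dnv; apply: nV; split=> //; exists v => //.
  by split; split=> //=; rewrite enormN.
have [v uv|e e0 h] := @tube R _ _ _ x (fun y v => G y -> d y v -> c / 2 <= edot p v)
  (@usphere_compact R J).
  have [dv|ndv] := pselect (d x v); last first.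
    have [|e e0 h] := @graph_away x v; first by case.
    by exists e => // y u yx uv' Gy dy; exfalso; exact: (h y u).
  have c2 : 0 < c / 2 / (enorm p + 1) by rewrite !divr_gt0// ltr_wpDl// enorm_ge0.
  have [e e0 h] := enorm_small J c2; exists e => // y u _ /h.
  rewrite ltr_pdivlMr ?ltr_wpDl ?enorm_ge0// => hu _ _.
  have := edot_lipschitz p u v; rewrite ler_norml => /andP[h1 _].
  have := hp v uv dv; have := enorm_ge0 (u - v); nra.
exists p, (c / 2), e; split=> //; first by rewrite divr_gt0.
move=> y yx Gy v dv; apply: (cone_homogeneous Gy _ dv) => v' [dv' uv'] _.
exact: (h y v' yx uv' Gy dv').
Qed.

End ReflectionCones.

(** * Second order expansion of the test function *)
Section Taylor.
Context {R : realType} (n : nat).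
Implicit Types (x y z : 'cV[R]_n) (f g : 'cV[R]_n -> R).

Lemma line_is_derive f z (i : 'I_n) s : derivable f (z + s *: delta_mx i ord0) (delta_mx i ord0) ->
  is_derive s (1 : R) (fun t : R => f (z + t *: delta_mx i ord0))
    (partial i f (z + s *: delta_mx i ord0)).
Proof.
move=> df; have e (h : R) : z + (h *: (1 : R) + s) *: delta_mx i ord0 =
    h *: delta_mx i ord0 + (z + s *: delta_mx i ord0).
  by rewrite scalerDl addrCA -scalerA scale1r.
have E : (fun h : R => h^-1 *: (((fun t : R => f (z + t *: delta_mx i ord0)) \o shift s)
      (h *: (1 : R)) - f (z + s *: delta_mx i ord0))) =
    (fun h : R => h^-1 *: ((f \o shift (z + s *: delta_mx i ord0)) (h *: delta_mx i ord0) -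
      f (z + s *: delta_mx i ord0))).
  by apply/funext => h; rewrite /= e.
by apply: DeriveDef; [rewrite /derivable E|rewrite /derive E].
Qed.

Lemma coordinate_mvt f z (i : 'I_n) (h : R) :
  (forall s, `|s| <= `|h| -> derivable f (z + s *: delta_mx i ord0) (delta_mx i ord0)) ->
  exists2 s, `|s| <= `|h| &
    f (z + h *: delta_mx i ord0) - f z = partial i f (z + s *: delta_mx i ord0) * h.
Proof.
move=> df; pose F (t : R) := f (z + t *: delta_mx i ord0).
have F0 : F 0 = f z by rewrite /F scale0r addr0.
have dF s : `|s| <= `|h| -> is_derive s (1 : R) F (partial i f (z + s *: delta_mx i ord0)).
  by move=> /df; exact: line_is_derive.
have mvt a b : a <= b -> `|a| <= `|h| -> `|b| <= `|h| ->
    exists2 s, `|s| <= `|h| & F b - F a = partial i f (z + s *: delta_mx i ord0) * (b - a).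
  move=> ab ah bh.
  have inab s : s \in `[a, b] -> `|s| <= `|h|.
    rewrite in_itv /= => /andP[as_ sb]; move: ah bh; rewrite !ler_norml => /andP[h1 h2] /andP[h3 h4].
    by apply/andP; split; lra.
  have [||s sab e] := @MVT_segment R F (fun s => partial i f (z + s *: delta_mx i ord0)) a b ab.
  - by move=> s sab; apply/dF/inab; exact: subset_itv_oo_cc sab.
  - apply: derivable_within_continuous => s sab.
    by have [] := dF s (inab s sab).
  by exists s => //; exact: inab.
rewrite -F0; have [h0|/ltW h0] := leP 0 h.
  by have [||s sh e] := mvt 0 h h0; rewrite ?normr0//; exists s => //; rewrite e subr0.
have [||s sh e] := mvt h 0 h0; rewrite ?normr0//; exists s => //.
by rewrite -[LHS]opprB e sub0r mulrN opprK.
Qed.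

Definition in_box x y z := forall i, `|z i ord0 - x i ord0| <= `|y i ord0 - x i ord0|.

Definition hybrid x y (k : nat) : 'cV[R]_n := \col_i (if (i < k)%N then y i ord0 else x i ord0).

Lemma hybridS x y (k : 'I_n) :
  hybrid x y k.+1 = hybrid x y k + (y k ord0 - x k ord0) *: delta_mx k ord0.
Proof.
apply/matrixP => i j; rewrite (ord1 j) !mxE eqxx andbT ltnS leq_eqVlt.
have [->|ik] := eqVneq i k; first by rewrite eqxx ltnn mulr1 addrC subrK.
by rewrite (negbTE (_ : val i != val k))// mulr0 addr0.
Qed.

(** The path through the points [hybrid x y k] moves one coordinate at a time, so that
    only partial derivatives are involved. *)
Lemma coordinatewise_mvt f x y :
  (forall z, in_box x y z -> forall i, derivable f z (delta_mx i ord0)) ->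
  exists xi : 'I_n -> 'cV[R]_n, (forall i, in_box x y (xi i)) /\
    f y - f x = \sum_i partial i f (xi i) * (y i ord0 - x i ord0).
Proof.
move=> df.
have box k (kn : 'I_n) s : val kn = k -> `|s| <= `|y kn ord0 - x kn ord0| ->
    in_box x y (hybrid x y k + s *: delta_mx kn ord0).
  move=> <- hs i; rewrite !mxE eqxx andbT.
  have [->|ik] := eqVneq i kn; first by rewrite ltnn mulr1 addrAC subrr add0r.
  by rewrite mulr0 addr0; case: ifP => // _; rewrite subrr normr0.
have step (k : 'I_n) : exists z, in_box x y z /\
    f (hybrid x y k.+1) - f (hybrid x y k) = partial k f z * (y k ord0 - x k ord0).
  rewrite hybridS; have [|s hs e] := @coordinate_mvt f (hybrid x y k) k (y k ord0 - x k ord0).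
    by move=> s hs; apply: df; exact: box.
  by exists (hybrid x y k + s *: delta_mx k ord0); split => //; exact: box.
have [xi hxi] := choice step; exists xi; split=> [i|]; first by case: (hxi i).
have -> : y = hybrid x y n by apply/matrixP => i j; rewrite (ord1 j) mxE ltn_ord.
have -> : f x = f (hybrid x y 0).
  by congr f; apply/matrixP => i j; rewrite (ord1 j) mxE.
rewrite -(telescope_sumr (fun k => f (hybrid x y k)))// big_mkord; apply: eq_bigr => i _.
by rewrite mxE ltn_ord; case: (hxi i).
Qed.

Lemma box_norm x y z : in_box x y z -> `|z - x| <= `|y - x|.
Proof.
move=> h; apply/mx_norm_leP => // i j; rewrite (ord1 j).
have := h i; rewrite !mxE => h'; apply: le_trans h' _.
by have := entry_le_norm (y - x) i ord0; rewrite !mxE.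
Qed.

(** The mean value theorem along coordinates is applied to [g], and then to its partial
    derivatives between [x] and the intermediate points. *)
Lemma taylor2 g x y (c : 'I_n -> 'I_n -> R) :
  (forall z, in_box x y z -> forall i, derivable g z (delta_mx i ord0)) ->
  (forall z, in_box x y z -> forall i j, derivable (partial j g) z (delta_mx i ord0)) ->
  (forall z, in_box x y z -> forall i j, `|partial i (partial j g) z| <= c i j) ->
  `|g y - g x - edot (grad g x) (y - x)| <= (\sum_i \sum_j c i j) * enorm (y - x) ^+ 2.
Proof.
move=> dg ddg hc; have [xi [xib ->]] := coordinatewise_mvt dg.
have -> : edot (grad g x) (y - x) = \sum_i partial i g x * (y i ord0 - x i ord0).
  by apply: eq_bigr => i _; rewrite !mxE.
rewrite -sumrB exchange_big /= mulr_suml; apply: le_trans (ler_norm_sum _ _ _) _.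
apply: ler_sum => j _; rewrite -mulrBl.
have sub z : in_box x (xi j) z -> in_box x y z.
  by move=> h i; apply: le_trans (h i) (xib j i).
have [|eta [etab ->]] := @coordinatewise_mvt (partial j g) x (xi j).
  by move=> z /sub zb i; exact: ddg.
have ent i : `|y i ord0 - x i ord0| <= enorm (y - x).
  by have := entry_le_enorm (y - x) i ord0; rewrite !mxE.
rewrite normrM expr2 mulrA.
apply: (@le_trans _ _ ((\sum_i c i j * enorm (y - x)) * enorm (y - x))); last first.
  by rewrite -mulr_suml.
apply: ler_pM => //; apply: le_trans (ler_norm_sum _ _ _) _; apply: ler_sum => i _.
rewrite normrM; apply: ler_pM => //; first exact: hc (sub _ (etab i)) _ _.
exact: le_trans (xib j i) (ent i).
Qed.

End Taylor.

(** * Lower integrals, and integrals of continuous paths *)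
Section LowerIntegral.
Context {R : realType}.

(** The integral of a nonnegative function is a supremum over simple functions,
    hence monotone even without measurability. *)
Lemma le_lower_integral d (T : measurableType d) (mu : {measure set T -> \bar R})
    (D : set T) (f g : T -> \bar R) : (forall x, D x -> 0 <= f x)%E ->
  (forall x, D x -> f x <= g x)%E -> (\int[mu]_(x in D) f x <= \int[mu]_(x in D) g x)%E.
Proof.
move=> f0 fg; have g0 x : D x -> (0 <= g x)%E by move=> Dx; rewrite (le_trans (f0 x Dx)) ?fg.
rewrite !ge0_integralE//; apply: le_ereal_sup => _ [h hf <-]; exists h => // x.
apply: le_trans (hf x) _; rewrite /patch; case: ifPn => // /set_mem; exact: fg.
Qed.

End LowerIntegral.

Section FatouBound.
Context {R : realType} {disp : measure_display} {Omega : measurableType disp}.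
Variable P : probability Omega R.

Lemma limn_einf_ub (u : nat -> \bar R) c N : (forall n, (N <= n)%N -> u n <= c)%E ->
  (limn_einf u <= c)%E.
Proof.
move=> h; apply: le_trans (limn_einf_sup u) _; rewrite limn_esup_lim.
apply: lime_le; first exact: is_cvg_esups.
exists N => // n Nn; apply: ge_ereal_sup => _ [m /= nm <-].
by apply: h; exact: leq_trans nm.
Qed.

Lemma limn_einf_lb (u : nat -> \bar R) c N : (forall n, (N <= n)%N -> c <= u n)%E ->
  (c <= limn_einf u)%E.
Proof.
move=> h; rewrite limn_einf_lim; apply: lime_ge; first exact: is_cvg_einfs.
exists N => // n Nn; apply: le_ereal_inf_tmp => _ [m /= nm <-].
by apply: h; exact: leq_trans nm.
Qed.

(** Fatou's lemma, in a form that can be iterated over several indices. *)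
Lemma fatou_bound (f : nat -> Omega -> \bar R) (c : \bar R) N :
  (forall n, measurable_fun setT (f n)) -> (forall n w, 0 <= f n w)%E ->
  (forall n, (N <= n)%N -> \int[P]_w f n w <= c)%E ->
  [/\ measurable_fun setT (fun w => limn_einf (f ^~ w)),
      forall w, (0 <= limn_einf (f ^~ w))%E &
      (\int[P]_w limn_einf (f ^~ w) <= c)%E].
Proof.
move=> mf f0 fc; split.
- rewrite (_ : (fun w => _) = (fun w => limn (einfs (f ^~ w)))); last first.
    by apply/funext => w; rewrite limn_einf_lim.
  apply: (emeasurable_fun_cvg (fun n w => einfs (f ^~ w) n)) => [n|w _].
    exact: measurable_fun_einfs.
  exact: is_cvg_einfs.
- by move=> w; apply: (@limn_einf_lb _ _ 0%N) => n _.
- apply: le_trans (fatou _ _ _ _) _ => //.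
  exact: limn_einf_ub fc.
Qed.

Lemma ae_finite (f : Omega -> \bar R) (c : R) : measurable_fun setT f ->
  (forall w, 0 <= f w)%E -> (\int[P]_w f w <= c%:E)%E ->
  \forall w \ae P, exists M : R, (f w <= M%:E)%E.
Proof.
move=> mf f0 fc.
have If : P.-integrable setT f.
  apply/integrableP; split => //; under eq_integral do rewrite gee0_abs//.
  by apply: le_lt_trans fc _; rewrite ltry.
have := integrable_ae measurableT If; apply: filterS => w /(_ I) h.
by exists (fine (f w)); rewrite fineK.
Qed.

End FatouBound.

Section Drift.
Context {R : realType}.

Definition drift (f : R -> R) (t : R) : R := Rintegral lebesgue_measure `[0, t] f.

Lemma pcont_integrable (f : R -> R^o) s t : 0 <= s -> pcont f ->
  lebesgue_measure.-integrable `[s, t] (EFin \o f).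
Proof.
move=> s0 /within_pcont cf; apply: continuous_compact_integrable.
  exact: segment_compact.
apply: continuous_subspaceW cf => r; rewrite /= !in_itv /= andbT => /andP[h _].
exact: le_trans h.
Qed.

Lemma drift_increment (f : R -> R^o) s t c e : pcont f -> 0 <= s -> s <= t ->
  (forall u, s <= u <= t -> `|f u - c| <= e) ->
  `|drift f t - drift f s - c * (t - s)| <= e * (t - s).
Proof.
move=> cf s0 st hf.
have If := pcont_integrable t (lexx 0) cf.
have Is := pcont_integrable t s0 cf.
have mst : measurable (`[s, t]%classic : set R) by exact: measurable_itv.
have Ic (k : R) : lebesgue_measure.-integrable `[s, t] (EFin \o (fun=> k)).
  by apply: (@pcont_integrable (fun=> k : R^o)) => //; exact: pcont_cst.
have lst : fine (lebesgue_measure (`[s, t]%classic : set R)) = t - s.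
  rewrite lebesgue_measure_itv /= lte_fin; case: ifPn => // h.
  have -> : t = s by apply/le_anti; rewrite st leNgt h.
  by rewrite subrr.
have -> : drift f t - drift f s = Rintegral lebesgue_measure `[s, t] f.
  rewrite /drift Rintegral_itvB//=.
  rewrite Rintegral_itv_obnd_cbnd//.
  apply: integrableS Is; [exact: measurable_itv|exact: measurable_itv|].
  by apply: subset_itvr; rewrite bnd_simp.
have eqc k : Rintegral lebesgue_measure `[s, t] (fun=> k : R) = k * (t - s).
  by rewrite Rintegral_cst// lst.
rewrite -[c * _]eqc -RintegralB//.
rewrite -[leRHS]eqc.
have IB : lebesgue_measure.-integrable `[s, t] (EFin \o (fun u => f u - c)).
  by apply: (@pcont_integrable (fun u => f u - c : R^o)) => //; apply: pcontB => //; exact: pcont_cst.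
rewrite ler_norml; apply/andP; split.
  rewrite -[leLHS](_ : Rintegral lebesgue_measure `[s, t] (fun=> - e) = _); last first.
    by rewrite !eqc mulNr.
  apply: le_Rintegral => // u; rewrite /= in_itv /= => /hf.
  by rewrite ler_norml => /andP[].
apply: le_Rintegral => // u; rewrite /= in_itv /= => /hf.
by rewrite ler_norml => /andP[].
Qed.

Lemma drift_lipschitz (f : R -> R^o) s t c : pcont f -> 0 <= s -> s <= t ->
  (forall u, s <= u <= t -> `|f u| <= c) -> `|drift f t - drift f s| <= c * (t - s).
Proof.
move=> cf s0 st hf; have := @drift_increment f s t 0 c cf s0 st.
rewrite mul0r subr0; apply => u ust; rewrite subr0; exact: hf.
Qed.

Lemma drift0 f : drift f 0 = 0.
Proof. by rewrite /drift set_itv1 Rintegral_set1. Qed.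

Lemma pcont_drift (f : R -> R^o) : pcont f -> pcont (drift f : R -> R^o).
Proof.
move=> cf t t0 e e0; have [M M0 hM] := pcont_bounded (t + 1) cf.
exists (Num.min 1 (e / (M + 1))) => [|s s0].
  by rewrite lt_min ltr01 divr_gt0// ltr_wpDl.
rewrite lt_min => /andP[st1]; rewrite ltr_pdivlMr ?ltr_wpDl// => st2.
have hb a b : 0 <= a -> a <= b -> b <= t + 1 -> `|drift f b - drift f a| <= M * (b - a).
  move=> a0 ab bt; apply: drift_lipschitz => // u /andP[au ub].
  by apply: hM; rewrite (le_trans a0 au) (le_trans ub).
have t1 : t <= t + 1 by rewrite lerDl.
have lt_e x : 0 <= x -> x * (M + 1) < e -> M * x < e.
  by move=> x0; apply: le_lt_trans; rewrite mulrC ler_wpM2l// lerDl.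
have [h|h] := leP t s.
  have h' : s <= t + 1.
    by move: st1; rewrite ger0_norm ?subr_ge0// => /ltW; rewrite lerBlDl.
  apply: le_lt_trans (hb t s t0 h h') _.
  by move: st2; rewrite ger0_norm ?subr_ge0//; apply: lt_e; rewrite subr_ge0.
rewrite distrC; apply: le_lt_trans (hb s t s0 (ltW h) t1) _.
by move: st2; rewrite distrC ger0_norm ?subr_ge0 ?(ltW h)//; apply: lt_e; rewrite subr_ge0 ltW.
Qed.

End Drift.

Section DriftMeasurability.
Context {R : realType} {disp : measure_display} {Omega : measurableType disp}.
Variables (P : probability Omega R) (G : set (set Omega)).
Hypothesis sG : sigma_algebra setT G.
Hypothesis GN : forall N, P.-negligible N -> G N.

(** The drift is a limit of Riemann sums of variables measurable for [G]. *)
Lemma drift_smeas (f : R -> Omega -> R) t : 0 <= t ->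
  (forall s, 0 <= s <= t -> smeas G (f s)) ->
  (\forall w \ae P, pcont (f ^~ w : R -> R^o)) ->
  smeas G (fun w => drift (f ^~ w) t).
Proof.
move=> t0 mf cf.
have hg (m : nat) := @grid_exists R [::] 0 t m.+1%:R^-1 t0 (ltac:(by rewrite invr_gt0 ltr0n)).
have [g hg'] := choice hg; have [N hgN] := choice hg'.
pose Y m w := \sum_(i < N m) f (g m i) w * (g m i.+1 - g m i).
apply: (smeas_cvg_ae sG GN (f := Y)).
  move=> m; have [_ _ _ gt _] := hgN m.
  by apply: smeas_sum => i; apply: smeasM; [exact: mf|exact: smeas_cst].
apply: filterS cf => w cfw; apply/cvgrPdist_le => e e0.
have t1 : 0 < t + 1 by rewrite ltr_wpDl.
have [d d0 hd] := pcont_unif t cfw (divr_gt0 e0 t1).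
have /cvgrPdist_lt/(_ d d0) := @cvg_harmonic R; apply: filterS => m /=.
rewrite sub0r normrN ger0_norm ?invr_ge0// => md.
have [g0 gN gd gt _] := hgN m.
have -> : drift (f ^~ w) t = \sum_(i < N m) (drift (f ^~ w) (g m i.+1) - drift (f ^~ w) (g m i)).
  rewrite -(big_mkord xpredT (fun i => drift (f ^~ w) (g m i.+1) - drift (f ^~ w) (g m i))).
  by rewrite (telescope_sumr (fun i => drift (f ^~ w) (g m i)))// g0 gN drift0 subr0.
rewrite -sumrB; apply: le_trans (ler_norm_sum _ _ _) _.
apply: (@le_trans _ _ (\sum_(i < N m) e / (t + 1) * (g m i.+1 - g m i))).
  apply: ler_sum => i _; have [gi gid] := gd i.
  have /andP[gi0 git] := gt i; have /andP[gi0' git'] := gt i.+1.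
  apply: drift_increment => // u /andP[h1 h2]; apply: ltW; apply: hd.
  - exact: le_trans h1.
  - exact: gt.
  - rewrite ger0_norm ?subr_ge0//; apply: le_lt_trans md.
    by apply: le_trans gid; rewrite lerD2r.
rewrite -mulr_sumr -(big_mkord xpredT (fun i => g m i.+1 - g m i)).
rewrite telescope_sumr// g0 gN subr0 mulrAC ler_pdivrMr// ler_wpM2l ?(ltW e0)//.
by rewrite lerDl.
Qed.

End DriftMeasurability.

(** * One step of the test function along a reflected path *)
Section UniformFamilies.
Context {R : realType}.

Lemma uniform_radius (I : finType) (Q : I -> R -> Prop) :
  (forall i e e', Q i e -> e' <= e -> Q i e') ->
  (forall i, exists2 e, 0 < e & Q i e) -> exists2 e, 0 < e & forall i, Q i e.
Proof.
move=> mono hQ.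
have hQ' i : exists e : R, 0 < e /\ Q i e by have [e e0 Qe] := hQ i; exists e.
have [r hr] := choice hQ'.
pose s := 1 + \sum_i (r i)^-1.
have r0 i : 0 < (r i)^-1 by rewrite invr_gt0; case: (hr i).
have s0 : 0 < s by rewrite ltr_pwDl// sumr_ge0// => i _; exact: ltW.
exists s^-1 => [|i]; first by rewrite invr_gt0.
have [ri0 Qi] := hr i; apply: mono Qi _.
rewrite -[leRHS]invrK lef_pV2 ?posrE//.
rewrite /s (bigD1 i)//= addrCA lerDl addr_ge0// sumr_ge0// => j _; exact: ltW.
Qed.

Lemma compact_open_radius (V : normedModType R) (A O : set V) : compact A -> open O ->
  A `<=` O -> exists2 e : R, 0 < e & forall x y, A x -> `|y - x| < e -> O y.
Proof.
move=> cA oO AO.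
have [x Ax|d d0 hd] := @compact_modulus R V R^o A setT (\1_O : V -> R^o) cA _ 1 ltr01.
  split=> // e e0; have [d d0 h] := open_near oO (AO x Ax); exists d => // y _ /h Oy.
  by rewrite !indicE (mem_set Oy) (mem_set (AO x Ax)) subrr normr0.
exists d => // x y Ax yx; have := hd x y Ax I yx.
rewrite !indicE (mem_set (AO x Ax)); case: (boolP (y \in O)) => [/set_mem//|_].
by rewrite sub0r normrN normr1 ltxx.
Qed.

Lemma for_continuous_eps (V : normedModType R) (f : V -> R) x : {for x, continuous f} ->
  forall e, 0 < e -> exists2 d, 0 < d & forall y, `|y - x| < d -> `|f y - f x| < e.
Proof.
move=> /cvgrPdist_lt cf e e0; have /nbhs_ballP[d /= d0 h] := cf e e0.
exists d => // y yx; rewrite distrC; apply: h; by rewrite -ball_normE /= distrC.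
Qed.

End UniformFamilies.

Section OneStep.
Context {R : realType} (J : nat).
Variables (G : set 'cV[R]_J) (d : 'cV[R]_J -> set 'cV[R]_J).
Hypothesis hE : ESP G d.
Let V := Vset G d.
Hypothesis V0 : V !=set0.

Variables (g : 'cV[R]_J -> R) (O : set 'cV[R]_J) (L theta r beta : R).
Hypothesis L0 : 0 <= L.
Hypothesis theta0 : 0 < theta.
Hypothesis r0 : 0 < r.
Hypothesis beta0 : 0 < beta.
Hypothesis oO : open O.
Hypothesis GO : forall x, G x -> ~ V x -> O x.
Hypothesis dg : forall x, O x -> forall i, derivable g x (delta_mx i ord0).
Hypothesis cdg : forall x, O x -> forall i, {for x, continuous (partial i g)}.
Hypothesis ddg : forall x, O x -> forall i j, derivable (partial j g) x (delta_mx i ord0).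
Hypothesis cddg : forall x, O x -> forall i j, {for x, continuous (partial i (partial j g))}.
Hypothesis gL : forall x, G x -> ~ V x -> `|g x| <= L.
Hypothesis gradL : forall x, G x -> ~ V x -> enorm (grad g x) <= L.
Hypothesis g2 : forall x, G x -> ~ V x ->
  \sum_i \sum_j `|partial i (partial j g) x| <= 2 * L * (vdist V x `^ beta)^-1.
Hypothesis gtheta : forall x v, bdry G x -> ~ V x -> vdist V x <= r -> d1 d x v ->
  theta <= edot (grad g x) v.

(** A bound on the second derivatives of [g] at [x]; the term [1] leaves room for their
    oscillation over one step. *)
Definition curvature x : R := 1 + 2 * L * (vdist V x `^ beta)^-1.

(** These compact sets exhaust the punctured neighbourhood of [V] in [G] as [k] grows. The
    radius [r / 2] keeps the points within reach of one step below [r], where [g] gains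
    [theta]. *)
Definition shell (k : R) : set 'cV[R]_J :=
  [set x | [/\ G x, k^-1 <= vdist V x, vdist V x <= r / 2 & enorm x <= k]].

Let cV : closed V := Vset_closed hE.

Lemma vdist_continuous : continuous (vdist V).
Proof. by apply: continuous_eps => x e e0; exact: vdist_cont. Qed.

Lemma shell_closed k : closed (shell k).
Proof.
have -> : shell k = G `&` (vdist V @^-1` [set t | k^-1 <= t]) `&`
    (vdist V @^-1` [set t | t <= r / 2]) `&` [set x | enorm (x - 0) <= k].
  apply/seteqP; split=> x; rewrite /= subr0; first by case.
  by move=> [[[? ?] ?] ?].
apply: closedI; last exact: closed_enorm_le.
apply: closedI; last first.
  by apply: closed_comp => [x _|]; [exact: vdist_continuous|exact: closed_le].
apply: closedI; first exact: ESP_closed hE.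
by apply: closed_comp => [x _|]; [exact: vdist_continuous|exact: closed_ge].
Qed.

Lemma shell_compact k : compact (shell k).
Proof. by apply: (@cV_compact _ _ _ k); [exact: shell_closed|move=> x []]. Qed.

Lemma vdist_notin x : 0 < vdist V x -> ~ V x.
Proof. by move=> h /(vdist_eq0 V0) e; rewrite e ltxx in h. Qed.

Lemma shell_notin k x : 0 < k -> shell k x -> ~ V x.
Proof.
by move=> k0 [_ h _ _]; apply: vdist_notin; apply: lt_le_trans h; rewrite invr_gt0.
Qed.

Lemma curvature_ge1 x : 1 <= curvature x.
Proof. by rewrite lerDl !mulr_ge0// invr_ge0 powR_ge0. Qed.

Lemma curvature_le k x : 0 < k -> shell k x -> curvature x <= 1 + 2 * L * (k^-1 `^ beta)^-1.
Proof.
move=> k0 [_ h _ _]; rewrite lerD2l ler_wpM2l ?mulr_ge0//.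
have k0' : 0 < k^-1 by rewrite invr_gt0.
rewrite lef_pV2 ?posrE ?powR_gt0//; last exact: lt_le_trans h.
by apply: ge0_ler_powR => //; rewrite ?nnegrE ?vdist_ge0 ?(ltW beta0) ?(ltW k0').
Qed.

Lemma shell_near k : 0 < k -> exists2 e, 0 < e & forall x y, shell k x -> enorm (y - x) <= e ->
  [/\ 0 < vdist V y, vdist V y <= 2 * vdist V x & vdist V y < r].
Proof.
move=> k0; have k1 : 0 < k^-1 by rewrite invr_gt0.
exists (Num.min (k^-1 / 2) (r / 4)); first by rewrite lt_min !divr_gt0.
move=> x y [_ h1 h2 _]; rewrite le_min => /andP[h3 h4].
have := vdist_lip V0 y x; rewrite ler_norml => /andP[h5 h6].
by split; lra.
Qed.

(** [x] and [x'] are the positions before and after one time step; the increment is made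
    of a drift [db], a stochastic integral [dI] and a push [dY] generated by the
    directions [A] taken from points of [G] near [x]. *)
Definition step_bound (e : R) (k : R) := forall x x' (db dI dY : 'cV[R]_J) (A : set 'cV[R]_J),
  shell k x -> G x' -> enorm (x' - x) <= e -> enorm dY <= e -> x' - x = db + dI + dY ->
  (forall v, A v -> exists u, [/\ G u, enorm (u - x) <= e & d u v]) ->
  closed_convex_hull A dY ->
  theta / 4 * enorm dY <= g x' - g x - edot (grad g x) dI + L * enorm db +
    curvature x * (4 * enorm dI ^+ 2 + 4 * enorm db ^+ 2).

(** On the compact shell, [e] is chosen so small that the gradient keeps half of its gain
    [theta] on the cones met during the step, that the second derivatives vary little, and
    that the quadratic term in [dY], at most [2 * curvature x * e * enorm dY], uses up at
    most another quarter of [theta]. *)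
Lemma near_step k : 0 < k -> exists2 e, 0 < e & step_bound e k.
Proof.
move=> k0; have cK := @shell_compact k.
have KO : shell k `<=` O.
  by move=> x Kx; apply: GO; [case: Kx|exact: shell_notin Kx].
have [e1 e10 h1] := compact_open_radius cK oO KO.
have J1 : 0 < J%:R + 1 :> R by rewrite ltr_wpDl.
have th' : 0 < theta / (2 * (J%:R + 1)) by rewrite divr_gt0// mulr_gt0.
have [e2 e20 h2] : exists2 e, 0 < e & forall i, forall x y, shell k x -> O y -> `|y - x| < e ->
    `|partial i g y - partial i g x| < theta / (2 * (J%:R + 1)).
  apply: (@uniform_radius R 'I_J (fun i e => forall x y, shell k x -> O y -> `|y - x| < e ->
    `|partial i g y - partial i g x| < theta / (2 * (J%:R + 1)))).
    by move=> i e e' h ee' x y Kx Oy yx; apply: h => //; exact: lt_le_trans ee'.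
  move=> i; apply: (@compact_modulus R _ R^o _ _ (partial i g) cK) => // x Kx.
  split; first exact: KO.
  move=> e e0; have [dd dd0 hd] := for_continuous_eps (@cdg x (KO x Kx) i) e0.
  by exists dd => // y _; exact: hd.
have eta0 : 0 < ((J%:R * J%:R) + 1 : R)^-1 by rewrite invr_gt0 ltr_wpDl// mulr_ge0.
pose eta : R := ((J%:R * J%:R) + 1)^-1.
have [e3 e30 h3] : exists2 e, 0 < e & forall ij : 'I_J * 'I_J, forall x y, shell k x -> O y ->
    `|y - x| < e ->
    `|partial ij.1 (partial ij.2 g) y - partial ij.1 (partial ij.2 g) x| < eta.
  apply: (@uniform_radius R ('I_J * 'I_J)%type (fun ij e => forall x y, shell k x -> O y -> `|y - x| < e ->
    `|partial ij.1 (partial ij.2 g) y - partial ij.1 (partial ij.2 g) x| < eta)).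
    by move=> i e e' h ee' x y Kx Oy yx; apply: h => //; exact: lt_le_trans ee'.
  move=> [i j]; apply: (@compact_modulus R _ R^o _ _ (partial i (partial j g)) cK) => // x Kx.
  split; first exact: KO.
  move=> e e0; have [dd dd0 hd] := for_continuous_eps (@cddg x (KO x Kx) i j) e0.
  by exists dd => // y _; exact: hd.
have [e4 e40 h4] := shell_near k0.
pose Ck := 1 + 2 * L * (k^-1 `^ beta)^-1.
have Ck1 : 0 < Ck by rewrite ltr_pwDl// !mulr_ge0// invr_ge0 powR_ge0.
have e50 : 0 < theta / (8 * Ck) by rewrite divr_gt0// mulr_gt0.
(* The last entry makes [2 * curvature x * e] at most [theta / 4] on the shell. *)
pose e := Num.min (Num.min (Num.min e1 (Num.min e2 e3)) e4) (theta / (8 * Ck)) / 2.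
have m0 : 0 < Num.min (Num.min (Num.min e1 (Num.min e2 e3)) e4) (theta / (8 * Ck)).
  by rewrite !lt_min e10 e20 e30 e40.
have e0 : 0 < e by rewrite divr_gt0.
have : e < Num.min (Num.min (Num.min e1 (Num.min e2 e3)) e4) (theta / (8 * Ck)).
  by rewrite /e; lra.
rewrite !lt_min => /andP[/andP[/andP[ee1 /andP[ee2 ee3]] ee4] ee5].
exists e => // x x' db dI dY A Kx Gx' xx' dYe eqx hA hull.
have Gx : G x by case: Kx.
have nVx : ~ V x := shell_notin k0 Kx.
have sup_lt y e' : e < e' -> enorm (y - x) <= e -> `|y - x| < e'.
  by move=> ee' ye; apply: le_lt_trans (norm_le_enorm _) (le_lt_trans ye ee').
have cone_bd v : A v -> theta / 2 * enorm v <= edot (grad g x) v.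
  move=> /hA[u [Gu ux duv]].
  have [u0 _ ur] := h4 x u Kx (le_trans ux (ltW ee4)).
  have gu : theta * enorm v <= edot (grad g u) v.
    apply: (cone_homogeneous hE Gu _ duv) => v' dv' bu; apply: gtheta => //; first exact: vdist_notin.
    exact: ltW.
  have gd : enorm (grad g u - grad g x) <= theta / 2.
    apply: le_trans (enorm_le_sum _) _.
    apply: (@le_trans _ _ (\sum_(i < J) theta / (2 * (J%:R + 1)))).
      apply: ler_sum => i _; rewrite big_ord1 !mxE ltW// h2//; first exact: h1 Kx (sup_lt _ _ ee1 ux).
      exact: sup_lt.
    rewrite sumr_const card_ord.
    have -> : theta / (2 * (J%:R + 1)) *+ J = theta / 2 * (J%:R / (J%:R + 1)).
      by rewrite -mulr_natr; field; rewrite gt_eqF.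
    apply: ler_piMr => //; first by rewrite divr_ge0// ltW.
    by rewrite ler_pdivrMr// mul1r lerDl.
  have := cauchy_schwarz_norm (grad g u - grad g x) v.
  rewrite edotBl ler_norml => /andP[_ h5].
  have := ler_wpM2r (enorm_ge0 v) gd; lra.
have c0 : 0 <= theta / 2 by rewrite divr_ge0// ltW.
have pushY := hull_halfspace c0 cone_bd hull.
have inO z : in_box x x' z -> O z /\ `|z - x| < e3.
  move=> /box_norm zb; split.
    by apply: h1 Kx _; apply: le_lt_trans zb (sup_lt _ _ ee1 xx').
  exact: le_lt_trans zb (sup_lt _ _ ee3 xx').
have tay : `|g x' - g x - edot (grad g x) (x' - x)| <=
    (\sum_i \sum_j (`|partial i (partial j g) x| + eta)) * enorm (x' - x) ^+ 2.
  apply: taylor2 => [z /inO[Oz _]|z /inO[Oz _]|z /inO[Oz zx] i j].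
  - exact: dg.
  - exact: ddg.
  - have := h3 (i, j) x z Kx Oz zx => /= h5.
    rewrite -lerBlDl; apply: le_trans (ltW h5).
    exact: le_trans (lerB_dist _ _) _.
have sumc : \sum_i \sum_j (`|partial i (partial j g) x| + eta) <= curvature x.
  under eq_bigr do rewrite big_split /=.
  rewrite big_split /= addrC; apply: lerD; last exact: g2.
  under eq_bigr do rewrite sumr_const card_ord.
  rewrite sumr_const card_ord -mulrnA -[leLHS]mulr_natr natrM /eta mulrC.
  by rewrite ler_pdivrMr ?ltr_wpDl ?mulr_ge0// mul1r lerDl.
have cx1 := curvature_ge1 x.
have cx0 : 0 <= curvature x by apply: le_trans cx1.
have sq : enorm (x' - x) ^+ 2 <= 4 * enorm db ^+ 2 + 4 * enorm dI ^+ 2 + 2 * enorm dY ^+ 2.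
  rewrite eqx; have := enormD_sqr_le (db + dI) dY; have := enormD_sqr_le db dI; lra.
have dY2 : curvature x * (2 * enorm dY ^+ 2) <= theta / 4 * enorm dY.
  have dY0 := enorm_ge0 dY.
  have cxe : curvature x * e <= theta / 8.
    apply: (@le_trans _ _ (Ck * (theta / (8 * Ck)))); last first.
      by rewrite le_eqVlt; apply/orP; left; apply/eqP; field; rewrite gt_eqF.
    apply: ler_pM => //; [exact: ltW|exact: curvature_le|exact: ltW].
  have h5 : curvature x * enorm dY <= theta / 8.
    by apply: le_trans cxe; rewrite ler_wpM2l.
  have := ler_wpM2r dY0 h5; rewrite expr2; lra.
have tay' : edot (grad g x) (x' - x) <= g x' - g x + curvature x * enorm (x' - x) ^+ 2.
  have h5 := ler_wpM2r (sqr_ge0 (enorm (x' - x))) sumc.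
  move: tay; rewrite ler_norml => /andP[h6 _]; lra.
have sq' := ler_wpM2l cx0 sq.
have db' : - edot (grad g x) db <= L * enorm db.
  apply: le_trans (ler_norm _) _; rewrite normrN; apply: le_trans (cauchy_schwarz_norm _ _) _.
  by rewrite ler_wpM2r ?enorm_ge0// gradL.
move: tay'; rewrite {1}eqx !edotDr => tay'; lra.
Qed.

End OneStep.

(** * Expected variation of the pushing term near the irregular set *)
Section PrefixSums.
Context {R : realType}.

(** A failure [~~ s i] ends the activity [A], so there is at most one. *)
Lemma prefix_bad_once (A s : nat -> bool) (f : nat -> R) n (c : R) :
  (forall i, A i.+1 -> A i && s i) -> 0 <= c -> (forall i, A i -> ~~ s i -> f i <= c) ->
  \sum_(i < n) (if A i && ~~ s i then f i else 0) <= c.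
Proof.
move=> hA c0 hf.
suff [] : \sum_(i < n) (if A i && ~~ s i then f i else 0) <= c /\
  (A n -> \sum_(i < n) (if A i && ~~ s i then f i else 0) = 0) by [].
elim: n => [|n [IH1 IH2]]; first by rewrite big_ord0.
rewrite big_ord_recr /=; split; last by move=> /hA/andP[An sn]; rewrite IH2// An sn addr0.
case: ifP => [/andP[An sn]|_]; last by rewrite addr0.
by rewrite IH2// add0r hf.
Qed.

Lemma prefix_telescope (p : pred nat) (x : nat -> R) n (c : R) : (forall i, p i.+1 -> p i) ->
  0 <= c -> (forall i, p i -> `|x i| <= c /\ `|x i.+1| <= c) ->
  \sum_(i < n) (if p i then x i.+1 - x i else 0) <= 2 * c.
Proof.
move=> hp c0 hx; have [k [kn pk _ ->]] := stopped_sum x n hp.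
case: k kn pk => [|k] kn pk; first by rewrite subrr mulr_ge0.
have [h0 _] := hx 0%N (pk 0%N (ltn0Sn _)); have [_ hk] := hx k (pk k (leqnn _)).
move: h0 hk; rewrite !ler_norml => /andP[h1 h2] /andP[h3 h4]; lra.
Qed.

End PrefixSums.

Section LowerExpectation.
Context {R : realType} {disp : measure_display} {Omega : measurableType disp}.
Variable P : probability Omega R.

(** The integral of [f] is here a lower integral, [f] not being assumed measurable. *)
Lemma Ex_le_lower (X : Omega -> R) (f : Omega -> \bar R) c : rint P X -> (forall w, 0 <= X w) ->
  (forall w, 0 <= f w)%E -> (\forall w \ae P, ((X w)%:E <= f w)%E) ->
  (\int[P]_w f w <= c%:E)%E -> Ex P X <= c.
Proof.
move=> IX X0 f0 [N [mN PN sub]] fc.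
have mN' : measurable (~` N) by exact: measurableC.
have IX' := rint_indicM mN' IX.
apply: (@le_trans _ _ (Ex P (fun w => \1_(~` N) w * X w))).
  apply: Ex_ae => //; exists N; split => // w /= h; apply: contrapT => nN; apply: h.
  by rewrite indicE mem_set// mul1r.
rewrite -lee_fin -ExE//; apply: le_trans fc; apply: le_lower_integral => w _.
  by rewrite lee_fin mulr_ge0.
rewrite indicE; case: (boolP (_ \in _)) => [/set_mem nN|_]; last by rewrite mul0r.
by rewrite mul1r; apply: contrapT => h; apply: nN; exact: sub.
Qed.

End LowerExpectation.

Section NearEstimate.
Context {R : realType} {disp : measure_display} {Omega : measurableType disp}.
Variables (P : probability Omega R) (F : R -> set (set Omega)).
Hypothesis uF : usual_filtration P F.
Variables (J K : nat) (W : R -> Omega -> 'cV[R]_K).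
Hypothesis bW : brownian_motion P F W.
Variables (G : set 'cV[R]_J) (d : 'cV[R]_J -> set 'cV[R]_J).
Hypothesis hE : ESP G d.
Let V := Vset G d.
Hypothesis V0 : V !=set0.
Variables (g : 'cV[R]_J -> R) (O : set 'cV[R]_J) (L theta r beta rad : R).
Hypothesis L0 : 0 <= L.
Hypothesis theta0 : 0 < theta.
Hypothesis r0 : 0 < r.
Hypothesis rrad : r <= rad.
Hypothesis beta0 : 0 < beta.
Hypothesis oO : open O.
Hypothesis GO : forall x, G x -> ~ V x -> O x.
Hypothesis cdg : forall x, O x -> forall i, {for x, continuous (partial i g)}.
Hypothesis gL : forall x, G x -> ~ V x -> `|g x| <= L.
Hypothesis gradL : forall x, G x -> ~ V x -> enorm (grad g x) <= L.

Variables (b : 'cV[R]_J -> 'cV[R]_J) (sigma : 'cV[R]_J -> 'M[R]_(J, K)) (B : R).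
Hypothesis B0 : 0 <= B.
Hypothesis bB : forall x, G x -> vdist V x <= rad -> enorm (b x) <= B.
Hypothesis sigmaB : forall x, G x -> vdist V x <= rad -> enorm (sigma x) ^+ 2 <= B.

Variables (Z I Y : R -> Omega -> 'cV[R]_J).
Hypothesis aZ : forall t i, 0 <= t -> smeas (F t) (fun w => Z t w i ord0).
Hypothesis aY : forall t i, 0 <= t -> smeas (F t) (fun w => Y t w i ord0).
Hypothesis iI : ito_integral P F W (fun t w => sigma (Z t w)) I.
Hypothesis mH : forall t i j, 0 <= t -> measurable_fun setT (fun w => sigma (Z t w) i j).
Hypothesis cH : \forall w \ae P, forall i j, pcont (fun t => sigma (Z t w) i j : R^o).

(** What holds for almost every path of a solution. *)
Definition good_path w : Prop :=
  [/\ pcont (Z ^~ w), forall i, pcont (fun t => b (Z t w) i ord0 : R^o),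
   forall t, 0 <= t -> G (Z t w),
   forall s t, 0 <= s -> s < t -> Z t w - Z s w =
     \col_i (drift (fun u => b (Z u w) i ord0) t - drift (fun u => b (Z u w) i ord0) s) +
     (I t w - I s w) + (Y t w - Y s w) &
   forall s t, 0 <= s -> s < t ->
     closed_convex_hull (\bigcup_(u in [set u | s < u <= t]) d (Z u w)) (Y t w - Y s w)].
Hypothesis gp : \forall w \ae P, good_path w.

Variable tau0 : Omega -> \bar R.
Hypothesis stau : stopping_time F tau0.
Hypothesis tauE : tau0 = hitting_time V Z.
Let weight w : R -> \bar R := fun s => singular_weight rad beta (set_dist (Z s w) V).

Variables (q t C0 : R).
Hypothesis q0 : 0 <= q.
Hypothesis qt : q < t.
Hypothesis hC0 : (\int[P]_w \int[lebesgue_measure]_(s in `[0%R, tmin t (tau0 w)]) weight w s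
  <= C0%:E)%E.

Let t0 : 0 < t. Proof. exact: le_lt_trans qt. Qed.

(** The stochastic integral is stopped when the path leaves a neighbourhood of [V],
    where the diffusion coefficient is bounded. *)
Definition leave : Omega -> \bar R := first_time q (fun t w => r - vdist V (Z t w)).

Let vdistZ_smeas s : 0 <= s -> smeas (F s) (fun w => vdist V (Z s w)).
Proof.
move=> s0; apply: (smeas_continuous (filtration_sigma uF s0)) => [i|x e e0]; first exact: aZ.
exact: vdist_cont.
Qed.

Let vdistZ_pcont : \forall w \ae P, pcont (fun s => vdist V (Z s w) : R^o).
Proof.
apply: filterS gp => w [cZ _ _ _ _] s s0 e e0.
have [c c0 hc] := vdist_cont V0 (Z s w) e0; have [c' c'0 hc'] := cZ s s0 c c0.
by exists c' => // u u0 us; apply: hc; exact: hc'.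
Qed.

Lemma leave_stopping : stopping_time F leave.
Proof.
apply: (first_time_stopping uF q0) => [s s0|].
  by apply: smeasB; [exact: smeas_cst|exact: vdistZ_smeas].
by apply: filterS vdistZ_pcont => w c; apply: pcontB => //; exact: pcont_cst.
Qed.

Let sigma_bound : \forall w \ae P, forall s, q <= s -> (s%:E < leave w)%E ->
  enorm (sigma (Z s w)) ^+ 2 <= B.
Proof.
apply: filterS gp => w [_ _ GZ _ _] s qs sl; have s0 := le_trans q0 qs.
apply: sigmaB; first exact: GZ.
by have := first_time_lt qs sl; rewrite subr_gt0 => /ltW h; apply: le_trans h rrad.
Qed.

(** A time grid of [N.+1] steps from [q] to [t], fine enough for the shell of index [k]
    and the step size [e] of [near_step]. *)
Section OneGrid.
Variables (k e : R) (N : nat).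
Hypothesis k0 : 0 < k.
Hypothesis e0 : 0 < e.
Hypothesis sb : step_bound G d g L theta r beta e k.
Hypothesis sn : forall x y, shell G d r k x -> enorm (y - x) <= e ->
  [/\ 0 < vdist V y, vdist V y <= 2 * vdist V x & vdist V y < r].
Let m : R := (t - q) / N.+1%:R.
Let Ck : R := 1 + 2 * L * (k^-1 `^ beta)^-1.
Hypothesis m1 : m <= 1.
Hypothesis mC : Ck * m <= 1.

Definition mesh (i : nat) : R := q + i%:R * m.

Let m0 : 0 < m. Proof. by rewrite divr_gt0// subr_gt0. Qed.
Let meshS i : mesh i.+1 = mesh i + m. Proof. by rewrite /mesh -addn1 natrD mulrDl mul1r addrA. Qed.
Let mesh_lt i : mesh i < mesh i.+1. Proof. by rewrite meshS ltrDl. Qed.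
Let mesh_ge i : q <= mesh i. Proof. by rewrite lerDl mulr_ge0// ltW. Qed.
Let mesh_ge0 i : 0 <= mesh i. Proof. exact: le_trans (mesh_ge i). Qed.
Let mesh_diff i : mesh i.+1 - mesh i = m. Proof. by rewrite meshS addrAC subrr add0r. Qed.
Let mesh_le i j : (i <= j)%N -> mesh i <= mesh j.
Proof. by move=> ij; rewrite lerD2l ler_wpM2r ?ler_nat// ltW. Qed.
Let mesh_last i : (i < N.+1)%N -> mesh i.+1 <= t.
Proof.
move=> iN; apply: le_trans (mesh_le iN) _.
by rewrite /mesh /m mulrC divfK ?pnatr_eq0// addrC subrK.
Qed.

(** A step is good if its increments are small enough for [step_bound]. *)
Definition step_good w i : bool :=
  `[< (forall u, mesh i <= u <= mesh i.+1 -> enorm (Z u w - Z (mesh i) w) <= e) /\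
      enorm (Y (mesh i.+1) w - Y (mesh i) w) <= e >].

(** Activity at step [i] is known at the time [mesh i], so that it may multiply
    conditional moments; goodness is known only at the end of the step. After the first
    bad step, or once the path is outside the shell, activity ceases for good. *)
Fixpoint active w i : bool :=
  match i with
  | 0 => (q%:E < tau0 w)%E && `[< shell G d r k (Z q w) >]
  | i'.+1 => [&& active w i', step_good w i' & `[< shell G d r k (Z (mesh i'.+1) w) >]]
  end.

Let activeS w i : active w i.+1 -> active w i && step_good w i.
Proof. by move=> /and3P[h1 h2 _]; apply/andP. Qed.

Let active_shell w i : active w i -> shell G d r k (Z (mesh i) w).
Proof.
case: i => [/andP[_ /asboolP]|i /and3P[_ _ /asboolP//]].
by rewrite /mesh mul0r addr0.
Qed.

Let active_tau w i : active w i -> (q%:E < tau0 w)%E.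
Proof. by elim: i => [/andP[]|i IH /activeS/andP[/IH]]. Qed.

Let near_prefix w i : active w i -> step_good w i -> forall u, q <= u <= mesh i.+1 ->
  0 < vdist V (Z u w) < r.
Proof.
elim: i => [|i IH] Ai si u /andP[qu ui].
  have [h _] := asboolP _ si; have sh := active_shell Ai.
  have [|h1 _ h2] := sn sh (y := Z u w); last by rewrite h1.
  by apply: h; rewrite /mesh mul0r addr0 qu.
have /andP[Ai' si'] := activeS Ai.
have [uu|uu] := leP u (mesh i.+1); first by apply: (IH Ai' si'); rewrite qu.
have [h _] := asboolP _ si; have sh := active_shell Ai.
have [|h1 _ h2] := sn sh (y := Z u w); last by rewrite h1.
by apply: h; rewrite (ltW uu).
Qed.

Let leave_ge w i : active w i -> step_good w i -> ((mesh i.+1)%:E <= leave w)%E.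
Proof.
move=> Ai si; apply: le_ereal_inf_tmp => _ [u [qu hu] <-]; rewrite lee_fin leNgt.
apply/negP => ui; have /andP[_] := near_prefix Ai si (u := u) (ltac:(by rewrite qu ltW)).
by rewrite ltNge -subr_le0 hu.
Qed.

Let tau_ge w i : active w i -> step_good w i -> ((mesh i.+1)%:E <= tau0 w)%E.
Proof.
move=> Ai si; rewrite tauE; apply: le_ereal_inf_tmp => _ [u [u0 Vu] <-]; rewrite lee_fin leNgt.
apply/negP => ui; have [qu|uq] := leP q u.
  have /andP[+ _] := near_prefix Ai si (u := u) (ltac:(by rewrite qu ltW)).
  by rewrite (vdist_eq0 V0 Vu) ltxx.
have := active_tau Ai; rewrite tauE ltNge => /negP; apply.
by apply: (@le_trans _ _ u%:E); [apply: ereal_inf_lbound; exists u|rewrite lee_fin ltW].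
Qed.

Let Zdiff_smeas s u i : 0 <= s -> s <= u -> smeas (F u) (fun w => (Z u w - Z s w) i ord0).
Proof.
move=> s0 su; have -> : (fun w => (Z u w - Z s w) i ord0) = fun w => Z u w i ord0 - Z s w i ord0.
  by apply/funext => w; rewrite !mxE.
by apply: smeasB; [apply: aZ; exact: le_trans su|apply: (Fsmeas_le uF s0 su); exact: aZ].
Qed.

Let enorm_smeas u (X : Omega -> 'cV[R]_J) : 0 <= u ->
  (forall i, smeas (F u) (fun w => X w i ord0)) -> smeas (F u) (fun w => enorm (X w)).
Proof.
move=> u0 mX; apply: (smeas_continuous (filtration_sigma uF u0)) => // x c c0.
have [c' c'0 h] := enorm_small J c0; exists c' => // y /h.
exact: le_lt_trans (enorm_dist _ _).
Qed.

Let DY i w := enorm (Y (mesh i.+1) w - Y (mesh i) w).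

Let DY_smeas i : smeas (F (mesh i.+1)) (DY i).
Proof.
apply: enorm_smeas => // j.
have -> : (fun w => (Y (mesh i.+1) w - Y (mesh i) w) j ord0) =
    fun w => Y (mesh i.+1) w j ord0 - Y (mesh i) w j ord0.
  by apply/funext => w; rewrite !mxE.
by apply: smeasB; [exact: aY|apply: (Fsmeas_le uF (mesh_ge0 i) (ltW (mesh_lt i))); exact: aY].
Qed.

Let set_le_smeas u (f : Omega -> R) c : 0 <= u -> smeas (F u) f -> F u [set w | f w <= c].
Proof.
move=> u0 /(smeasP (filtration_sigma uF u0))/(_ `]-oo, c]%classic (measurable_itv _)).
have -> // : f @^-1` `]-oo, c]%classic = [set w | f w <= c].
by apply/seteqP; split=> w; rewrite /= in_itv.
Qed.

Let step_good_F i : F (mesh i.+1) [set w | step_good w i].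
Proof.
have u1 := mesh_ge0 i.+1; have sF := filtration_sigma uF u1.
have -> : [set w | step_good w i] =
    ~` [set w | exists u, mesh i <= u <= mesh i.+1 /\ e < enorm (Z u w - Z (mesh i) w)] `&`
    [set w | DY i w <= e].
  apply/seteqP; split=> w /=.
    by move=> /asboolP[h1 h2]; split=> // -[u [hu]]; rewrite ltNge h1.
  move=> [h1 h2]; apply/asboolP; split=> // u hu; rewrite leNgt; apply/negP => h.
  by apply: h1; exists u.
apply: (subsigmaI sF); last by apply: set_le_smeas.
apply: (subsigmaC sF).
apply: (@path_exceeds _ _ _ _ _ sF (filtration_null uF u1)
  (fun u w => enorm (Z u w - Z (mesh i) w)) _ _ _ (mesh_ge0 i)).
  move=> u /andP[iu ui]; have u0 := le_trans (mesh_ge0 i) iu.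
  apply: (Fsmeas_le uF u0 ui); apply: enorm_smeas => // j.
  exact: Zdiff_smeas.
apply: filterS gp => w [cZ _ _ _ _]; apply: pcont_enorm => j.
have -> : (fun u => (Z u w - Z (mesh i) w) j ord0) = fun u => Z u w j ord0 - Z (mesh i) w j ord0.
  by apply/funext => u; rewrite !mxE.
by apply: pcontB; [exact: pcont_entry|exact: pcont_cst].
Qed.

Let shell_F u : 0 <= u -> F u [set w | `[< shell G d r k (Z u w) >]].
Proof.
move=> u0; have -> : [set w | `[< shell G d r k (Z u w) >]] = Z u @^-1` shell G d r k.
  by apply/seteqP; split=> w /= /asboolP.
by apply: (smeas_closed (filtration_sigma uF u0)); [move=> j; exact: aZ|exact: shell_closed].
Qed.

Let active_F i : F (mesh i) [set w | active w i].
Proof.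
elim: i => [|i IH].
  have -> : [set w | active w 0] = [set w | (q%:E < tau0 w)%E] `&`
      [set w | `[< shell G d r k (Z q w) >]].
    by apply/seteqP; split=> w /=; [move=> /andP[]|move=> [-> ->]].
  rewrite /mesh mul0r addr0; apply: (subsigmaI (filtration_sigma uF q0)).
    exact: (stopping_lt uF stau).
  exact: shell_F.
have sF := filtration_sigma uF (mesh_ge0 i.+1).
have -> : [set w | active w i.+1] = [set w | active w i] `&` ([set w | step_good w i] `&`
    [set w | `[< shell G d r k (Z (mesh i.+1) w) >]]).
  by apply/seteqP; split=> w /=; [move=> /and3P[]|move=> [-> [-> ->]]].
apply: (subsigmaI sF); first exact: (filtration_le uF (mesh_ge0 i) (ltW (mesh_lt i))).
by apply: (subsigmaI sF); [exact: step_good_F|exact: shell_F].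
Qed.

Let bool_smeas u (p : Omega -> bool) : 0 <= u -> F u [set w | p w] ->
  smeas (F u) (fun w => (p w)%:R : R).
Proof.
move=> u0 Fp; have -> : (fun w => (p w)%:R : R) = \1_[set w | p w].
  by apply/funext => w; rewrite indicE; congr ((_ : bool)%:R); apply/idP/idP; rewrite inE.
exact: (smeas_indic (filtration_sigma uF u0)).
Qed.

Let ivd w i : R := (vdist V (Z (mesh i) w) `^ beta)^-1.

Let ivd_smeas i : smeas (F (mesh i)) (fun w => ivd w i).
Proof.
have -> : (fun w => ivd w i) = (fun w => vdist V (Z (mesh i) w) `^ (- beta)).
  by apply/funext => w; rewrite powRN.
by apply: (@smeas_comp _ _ _ _ (fun y => y `^ (- beta))); [exact: measurable_powR|exact: vdistZ_smeas].
Qed.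

Let h i w : R := (active w i)%:R * curvature G d L beta (Z (mesh i) w).

Let h_smeas i : smeas (F (mesh i)) (h i).
Proof.
apply: smeasM; first by apply: bool_smeas => //; exact: active_F.
by apply: smeasD; [exact: smeas_cst|apply: smeasM; [exact: smeas_cst|exact: ivd_smeas]].
Qed.

Let h_bound i w : 0 <= h i w <= Ck.
Proof.
have Ck0 : 0 <= Ck by rewrite addr_ge0// !mulr_ge0// invr_ge0 powR_ge0.
rewrite /h; case: (boolP (active w i)) => [Ai|_]; last by rewrite mul0r lexx.
rewrite mul1r (curvature_le V0 L0 beta0 k0 (active_shell Ai)) andbT.
by apply: le_trans (curvature_ge1 _ _ _ L0 _).
Qed.

Let kg i j w : R := (active w i)%:R * partial j g (Z (mesh i) w).

Let kg_smeas i j : smeas (F (mesh i)) (kg i j).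
Proof.
have sF := filtration_sigma uF (mesh_ge0 i).
have -> : kg i j = fun w => (active w i)%:R * (\1_O (Z (mesh i) w) * partial j g (Z (mesh i) w)).
  apply/funext => w; rewrite /kg; case: (boolP (active w i)) => [Ai|_]; last by rewrite !mul0r.
  have sh := active_shell Ai; rewrite indicE mem_set ?mul1r//.
  by apply: GO; [case: sh|exact: shell_notin sh].
apply: smeasM; first by apply: bool_smeas => //; exact: active_F.
apply: (smeas_within sF) => [l||x Ox c c0]; first exact: aZ.
  by apply: (smeas_open sF) => // l; exact: aZ.
have [c' c'0 hc] := for_continuous_eps (@cdg x Ox j) c0.
by exists c' => // y _; exact: hc.
Qed.

Let kg_bound i j w : `|kg i j w| <= L.
Proof.
rewrite /kg; case: (boolP (active w i)) => [Ai|_]; last by rewrite mul0r normr0.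
have sh := active_shell Ai; rewrite mul1r.
apply: le_trans (gradL (x := Z (mesh i) w) _ _); last 2 first.
- by case: sh.
- exact: shell_notin sh.
by have := entry_le_enorm (grad g (Z (mesh i) w)) j ord0; rewrite mxE.
Qed.

(** A Riemann sum of the singular weight along the good steps. *)
Let X w : R := \sum_(i < N.+1) (if active w i && step_good w i then ivd w i * m else 0).

Let step_meas i : measurable_fun setT (fun w => (active w i && step_good w i)%:R : R).
Proof.
apply: (Fsmeas_measurable uF (mesh_ge0 i.+1)); apply: bool_smeas => //.
have sF := filtration_sigma uF (mesh_ge0 i.+1).
have -> : [set w | active w i && step_good w i] = [set w | active w i] `&` [set w | step_good w i].
  by apply/seteqP; split=> w /=; [move=> /andP[]|move=> [-> ->]].
apply: (subsigmaI sF); last exact: step_good_F.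
by apply: (filtration_le uF (mesh_ge0 i) (ltW (mesh_lt i))); exact: active_F.
Qed.

Let ivd_bound w i : active w i -> 0 <= ivd w i <= (k^-1 `^ beta)^-1.
Proof.
move=> /active_shell[_ h1 _ _]; rewrite invr_ge0 powR_ge0 /=.
have k0' : 0 < k^-1 by rewrite invr_gt0.
rewrite lef_pV2 ?posrE ?powR_gt0//; last exact: lt_le_trans h1.
by apply: ge0_ler_powR => //; rewrite ?nnegrE ?(vdist_ge0 V0) ?(ltW beta0) ?(ltW k0').
Qed.

Let X_rint : rint P X /\ forall w, 0 <= X w.
Proof.
have X0 w : 0 <= X w.
  apply: sumr_ge0 => i _; case: ifP => // /andP[Ai _].
  by have /andP[h1 _] := ivd_bound Ai; rewrite mulr_ge0// ltW.
split=> //; apply: (@rint_bounded _ _ _ P _ (\sum_(i < N.+1) (k^-1 `^ beta)^-1 * m)).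
  have -> : X = fun w => \sum_(i < N.+1) (active w i && step_good w i)%:R * (ivd w i * m).
    by apply/funext => w; apply: eq_bigr => i _; case: ifP; rewrite ?mul1r ?mul0r.
  apply: measurable_sum => i; apply: measurable_funM => //; apply: measurable_funM => //.
  by apply: (Fsmeas_measurable uF (mesh_ge0 i)); exact: ivd_smeas.
move=> w; rewrite ger0_norm//; apply: ler_sum => i _.
case: ifP => [/andP[Ai _]|_]; last by rewrite mulr_ge0 ?invr_ge0 ?powR_ge0// ltW.
by rewrite ler_wpM2r ?(ltW m0)//; case/andP: (ivd_bound Ai).
Qed.

(** During a good step the distance to [V] at most doubles, so that the weight at the
    beginning of the step is at most [2 `^ beta] times the weight at later times. *)
Let X_weight w : (((2 `^ beta)^-1 * X w)%R%:E <=
  \int[lebesgue_measure]_(s in `[0%R, tmin t (tau0 w)]) weight w s)%E.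
Proof.
pose a i := if active w i && step_good w i then (2 `^ beta)^-1 * ivd w i else 0.
have a0 i : 0 <= a i.
  rewrite /a; case: ifP => // /andP[Ai _]; rewrite mulr_ge0 ?invr_ge0 ?powR_ge0//.
have -> : (2 `^ beta)^-1 * X w = \sum_(i < N.+1) a i * (mesh i.+1 - mesh i).
  rewrite mulr_sumr; apply: eq_bigr => i _; rewrite mesh_diff /a.
  by case: ifP => _; rewrite ?mulrA ?mulr0 ?mul0r.
have tau0w : (0 <= tau0 w)%E by case: stau.
rewrite -(@integral_steps R `[0, tmin t (tau0 w)]%classic)//; last 2 first.
- by move=> i; exact: ltW.
- move=> i iN; rewrite /a; case: ifP => [/andP[Ai si] _|]; last by rewrite eqxx.
  move=> u; rewrite /= !in_itv /= => /andP[iu ui].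
  rewrite (le_trans (mesh_ge0 i) (ltW iu)) /= (le_trans ui)//.
  have [h1|/ltW h1] := leP t%:E (tau0 w); first by rewrite tminE//; exact: mesh_last.
  by rewrite -lee_fin (tminE_lt tau0w h1); exact: tau_ge.
apply: le_lower_integral => u _; first by rewrite lee_fin sumr_ge0// => i _; rewrite mulr_ge0.
have w0 : (0 <= weight w u)%E.
  by rewrite /weight /singular_weight; case: ifP => // _; rewrite inve_ge0 poweR_ge0.
have [[i ui]|no] := pselect (exists i : 'I_N.+1, u \in `]mesh i, mesh i.+1]); last first.
  rewrite big1// => i _; rewrite indicE memNset ?mulr0//= => h'.
  by apply: no; exists i.
rewrite (bigD1 i)//= big1 ?addr0; last first.
  move=> l; rewrite neq_lt => il; rewrite indicE memNset ?mulr0//= in_itv /=.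
  move: ui; rewrite in_itv /= => /andP[h1 h2] /andP[h3 h4].
  case/orP: il => il.
    by have := lt_le_trans h1 (le_trans h4 (mesh_le il)); rewrite ltxx.
  by have := lt_le_trans h3 (le_trans h2 (mesh_le il)); rewrite ltxx.
rewrite indicE mem_set ?mulr1//; move: ui; rewrite in_itv /= => /andP[iu ui].
rewrite /a; case: ifP => [/andP[Ai si]|_] //.
have [hs _] := asboolP _ si.
have [|v0 v2 vr] := sn (active_shell Ai) (y := Z u w); first by apply: hs; rewrite (ltW iu).
have vi0 : 0 < vdist V (Z (mesh i) w) by lra.
rewrite /weight /singular_weight (set_distE V0) lte_fin lee_fin v0 (le_trans (ltW vr) rrad) /=.
rewrite inver gt_eqF ?powR_gt0// lee_fin /ivd -invfM -powRM ?(ltW vi0)//.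
rewrite lef_pV2 ?posrE ?powR_gt0 ?mulr_gt0//.
by apply: ge0_ler_powR => //; rewrite ?nnegrE ?(ltW beta0) ?(ltW v0)// mulr_ge0// ltW.
Qed.

Let X_Ex : Ex P X <= 2 `^ beta * C0.
Proof.
have [IX X0] := X_rint; have p2 : 0 < 2 `^ beta :> R by rewrite powR_gt0.
rewrite -ler_pdivrMl// -ExZ//.
apply: (Ex_le_lower (rintZ _ IX) _ _ _ hC0).
- by move=> w; rewrite mulr_ge0// invr_ge0 ltW.
- move=> w; apply: integral_ge0 => s _; rewrite /weight /singular_weight.
  by case: ifP => // _; rewrite inve_ge0 poweR_ge0.
- by apply: aeW; exact: X_weight.
Qed.

Let h_rint i : rint P (h i).
Proof.
apply: (@rint_bounded _ _ _ P _ Ck); first exact: (Fsmeas_measurable uF (mesh_ge0 i)).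
by move=> w; have /andP[h1 h2] := h_bound i w; rewrite ger0_norm.
Qed.

Let C1 : R := (t - q) + 1 + 2 * L * (2 `^ beta * C0).

(** The last step of activity may be bad, and is then not seen by [X]; it contributes at
    most [Ck * m], hence at most [1]. *)
Let h_sum : \sum_(i < N.+1) Ex P (h i) * m <= C1.
Proof.
have [IX _] := X_rint.
under eq_bigr do rewrite mulrC -ExZ//.
rewrite -Ex_sum; last by move=> i _; exact: rintZ.
have -> : C1 = Ex P (fun=> (t - q) + 1) + 2 * L * (2 `^ beta * C0) by rewrite Ex_cst.
apply: (@le_trans _ _ (Ex P (fun w => ((t - q) + 1) + 2 * L * X w))); last first.
  rewrite ExD ?ExZ//; [|exact: rint_cst|exact: rintZ].
  by rewrite lerD2l; apply: ler_wpM2l X_Ex; exact: mulr_ge0.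
apply: Ex_le => [|| w].
- by apply: rint_sum => i _; exact: rintZ.
- by apply: rintD; [exact: rint_cst|exact: rintZ].
have split_ (i : 'I_N.+1) : m * h i w <= m + 2 * L * (if active w i && step_good w i then ivd w i * m else 0) +
    (if active w i && ~~ step_good w i then Ck * m else 0).
  rewrite /h; case: (boolP (active w i)) => Ai /=; last by rewrite mul0r !mulr0 !addr0 ltW.
  case: (step_good w i) => /=; rewrite mul1r /curvature ?addr0.
    by rewrite mulrDr mulr1 lerD2l -/(ivd w i) mulrC mulrA.
  rewrite mulr0 addr0 mulrC; apply: ler_wpDl; first exact: ltW.
  by rewrite ler_wpM2r ?(ltW m0)//; exact: (curvature_le V0 L0 beta0 k0 (active_shell Ai)).
apply: le_trans (ler_sum _ (fun i _ => split_ i)) _.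
rewrite !big_split /= sumr_const card_ord -mulr_sumr.
have -> : m *+ N.+1 = t - q by rewrite -mulr_natr /m divfK// pnatr_eq0.
have bad : \sum_(i < N.+1) (if active w i && ~~ step_good w i then Ck * m else 0) <= 1.
  apply: (@prefix_bad_once _ (active w) (step_good w) (fun=> Ck * m)) => //.
  exact: activeS.
rewrite -/(X w); lra.
Qed.

Let EI i w : 'cV[R]_J := \col_j ito_incr I leave (mesh i) (mesh i.+1) j w.

Let EI_eq w i : active w i -> step_good w i -> EI i w = I (mesh i.+1) w - I (mesh i) w.
Proof.
move=> Ai si; apply/matrixP => j l; rewrite (ord1 l) !mxE /ito_incr.
have h1 := leave_ge Ai si.
by rewrite !tminE//; apply: le_trans h1; rewrite lee_fin ltW.
Qed.

Let db i w : 'cV[R]_J := \col_j (drift (fun u => b (Z u w) j ord0) (mesh i.+1) -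
  drift (fun u => b (Z u w) j ord0) (mesh i)).

Let Cb : R := J%:R * B.
Let Cb0 : 0 <= Cb. Proof. by rewrite mulr_ge0. Qed.

Let db_bound w i : good_path w -> active w i -> step_good w i -> enorm (db i w) <= Cb * m.
Proof.
move=> [_ cb GZ _ _] Ai si; apply: le_trans (enorm_le_sum _) _.
apply: (@le_trans _ _ (\sum_(j < J) B * m)); last first.
  by rewrite sumr_const card_ord -mulr_natl mulrA.
apply: ler_sum => j _; rewrite big_ord1 mxE -(mesh_diff i).
apply: drift_lipschitz => // [|u /andP[iu ui]]; first exact: ltW.
have /andP[_ hr] := near_prefix Ai si (u := u) (ltac:(by rewrite (le_trans (mesh_ge i)))).
apply: le_trans (entry_le_enorm _ _ _) _; apply: bB; first by apply: GZ; exact: le_trans iu.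
by rewrite (le_trans (ltW hr)).
Qed.

Definition near_variation w : R :=
  \sum_(i < N.+1) (if active w i && step_good w i then
    enorm (Y (mesh i.+1) w - Y (mesh i) w) else 0).

(** Its last sum has expectation zero, and its first sum is controlled by [h_sum]. *)
Let path_bound w : R := 3 * L + L * Cb * (t - q) +
  \sum_(i < N.+1) h i w * ((4 + L) * \sum_j ito_incr I leave (mesh i) (mesh i.+1) j w ^+ 2
    + 4 * Cb ^+ 2 * m)
  - \sum_(i < N.+1) \sum_j kg i j w * ito_incr I leave (mesh i) (mesh i.+1) j w.

Let EI_sq i w : enorm (EI i w) ^+ 2 = \sum_j ito_incr I leave (mesh i) (mesh i.+1) j w ^+ 2.
Proof. by rewrite enorm_cV; apply: eq_bigr => j _; rewrite mxE. Qed.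

Let kg_dot i w : \sum_j kg i j w * ito_incr I leave (mesh i) (mesh i.+1) j w =
  (active w i)%:R * edot (grad g (Z (mesh i) w)) (EI i w).
Proof. by rewrite mulr_sumr; apply: eq_bigr => j _; rewrite !mxE mulrA. Qed.

(** [near_step] is summed over the good steps. The stochastic integrals are taken over
    all active steps, because their moments are only known for weights
    fixed at the beginning of the step; the one active step that may be bad costs at
    most [L], besides a multiple of the square of its stochastic integral. *)
Let pointwise w : good_path w -> theta / 4 * near_variation w <= path_bound w.
Proof.
move=> gw; have [cZ cb GZ inc hull] := gw.
have one (i : 'I_N.+1) : theta / 4 * (if active w i && step_good w i then DY i w else 0) <=
   (if active w i && step_good w i then g (Z (mesh i.+1) w) - g (Z (mesh i) w) else 0) +
   L * Cb * m + h i w * ((4 + L) * enorm (EI i w) ^+ 2 + 4 * Cb ^+ 2 * m) -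
   (active w i)%:R * edot (grad g (Z (mesh i) w)) (EI i w) +
   (if active w i && ~~ step_good w i then L else 0).
  have LCb : 0 <= L * Cb * m := mulr_ge0 (mulr_ge0 L0 Cb0) (ltW m0).
  have c1 := curvature_ge1 G d beta L0 (Z (mesh i) w).
  rewrite /h; case: (boolP (active w i)) => Ai /=; last first.
    by rewrite !mul0r mulr0 subr0 !addr0 add0r.
  have Cm : 0 <= 4 * Cb ^+ 2 * m by apply: mulr_ge0 (ltW m0); rewrite mulr_ge0 ?sqr_ge0.
  have EI0 := sqr_ge0 (enorm (EI i w)).
  case: (boolP (step_good w i)) => si /=; rewrite ?mul1r; last first.
    rewrite mulr0 add0r.
    have e1 := cauchy_schwarz (grad g (Z (mesh i) w)) (EI i w).
    have sh := active_shell Ai.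
    have e2 : enorm (grad g (Z (mesh i) w)) <= L.
      by apply: gradL; [case: sh|exact: shell_notin sh].
    have e3 := ler_wpM2r (enorm_ge0 (EI i w)) e2.
    have e4 : enorm (EI i w) <= 1 + enorm (EI i w) ^+ 2.
      by have := sqr_ge0 (enorm (EI i w) - 1); have := enorm_ge0 (EI i w); rewrite sqrrB; lra.
    have e5 := ler_wpM2l L0 e4.
    have e6 : L * enorm (EI i w) ^+ 2 <= curvature G d L beta (Z (mesh i) w) *
        ((4 + L) * enorm (EI i w) ^+ 2 + 4 * Cb ^+ 2 * m).
      rewrite -[leLHS]mul1r; apply: ler_pM => //; first exact: mulr_ge0.
      by rewrite -[leLHS]addr0 lerD// ler_wpM2r// lerDr.
    lra.
  have [hs hY] := asboolP _ si.
  have mm : mesh i < mesh i.+1 by [].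
  have near_cone v : (\bigcup_(u in [set u | mesh i < u <= mesh i.+1]) d (Z u w)) v ->
      exists u, [/\ G u, enorm (u - Z (mesh i) w) <= e & d u v].
    move=> [u /andP[iu ui] duv]; exists (Z u w); split=> //.
      by apply: GZ; apply: le_trans (ltW iu).
    by apply: hs; rewrite (ltW iu).
  have xx' : enorm (Z (mesh i.+1) w - Z (mesh i) w) <= e by apply: hs; rewrite (ltW mm) lexx.
  have := sb (active_shell Ai) (GZ _ (mesh_ge0 i.+1)) xx' hY (inc _ _ (mesh_ge0 i) mm) near_cone
    (hull _ _ (mesh_ge0 i) mm).
  rewrite -/(db i w) -(EI_eq Ai si) addr0 => key.
  have d1 := db_bound gw Ai si; have d0 := enorm_ge0 (db i w).
  have d2 : enorm (db i w) ^+ 2 <= Cb ^+ 2 * m.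
    apply: (@le_trans _ _ ((Cb * m) ^+ 2)).
      by rewrite lerXn2r// nnegrE// mulr_ge0// ltW.
    rewrite exprMn ler_wpM2l ?sqr_ge0// expr2 ger_pMr//.
  have d3 := ler_wpM2l L0 d1.
  have d4 : curvature G d L beta (Z (mesh i) w) * (4 * enorm (EI i w) ^+ 2 + 4 * enorm (db i w) ^+ 2) <=
      curvature G d L beta (Z (mesh i) w) * ((4 + L) * enorm (EI i w) ^+ 2 + 4 * Cb ^+ 2 * m).
    rewrite ler_wpM2l//; first exact: le_trans c1.
    have := mulr_ge0 L0 EI0; lra.
  move: d3 d4 key; rewrite /DY mulrA => d3 d4 key; lra.
rewrite /near_variation mulr_sumr; apply: le_trans (ler_sum _ (fun i _ => one i)) _.
rewrite !big_split /= sumr_const card_ord sumrN.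
have -> : L * Cb * m *+ N.+1 = L * Cb * (t - q).
  by rewrite -mulr_natr -mulrA /m divfK// pnatr_eq0.
have pm i : active w i.+1 && step_good w i.+1 -> active w i && step_good w i.
  by move=> /andP[/activeS].
have tel : \sum_(i < N.+1) (if active w i && step_good w i then
    g (Z (mesh i.+1) w) - g (Z (mesh i) w) else 0) <= 2 * L.
  apply: (@prefix_telescope _ (fun i => active w i && step_good w i)
    (fun i => g (Z (mesh i) w))) => // i /andP[Ai si].
  have nV u : q <= u <= mesh i.+1 -> `|g (Z u w)| <= L.
    move=> qu; apply: gL; first by apply: GZ; case/andP: qu => h1 _; exact: le_trans h1.
    by apply: vdist_notin => //; case/andP: (near_prefix Ai si qu).
  by split; apply: nV; rewrite mesh_ge ?lexx//= ltW.
have bad : \sum_(i < N.+1) (if active w i && ~~ step_good w i then L else 0) <= L.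
  by apply: (@prefix_bad_once _ (active w) (step_good w) (fun=> L)) => // i; exact: activeS.
rewrite /path_bound; under [X in _ <= _ - X]eq_bigr do rewrite kg_dot.
under [X in _ <= _ + X - _]eq_bigr do rewrite -EI_sq.
lra.
Qed.

Let hB i : \forall w \ae P, forall u, mesh i <= u <= mesh i.+1 -> (u%:E < leave w)%E ->
  enorm (sigma (Z u w)) ^+ 2 <= B.
Proof.
apply: filterS sigma_bound => w hw u /andP[iu _]; apply: hw.
exact: le_trans iu.
Qed.

Let Cstar : R := 3 * L + L * Cb * (t - q) +
  ((4 + L) * (J%:R * (16 * K%:R * B)) + 4 * Cb ^+ 2) * C1.

(** The bound [Cstar] involves neither [k] nor [e] nor [N]. *)
Lemma near_variation_Ex :
  [/\ rint P near_variation, forall w, 0 <= near_variation w &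
      theta / 4 * Ex P near_variation <= Cstar].
Proof.
have nv0 w : 0 <= near_variation w.
  by apply: sumr_ge0 => i _; case: ifP => // _; exact: enorm_ge0.
have Inv : rint P near_variation.
  apply: (@rint_bounded _ _ _ P _ (\sum_(i < N.+1) e)).
    have -> : near_variation = fun w => \sum_(i < N.+1) (active w i && step_good w i)%:R * DY i w.
      by apply/funext => w; apply: eq_bigr => i _; case: ifP; rewrite ?mul1r ?mul0r.
    apply: measurable_sum => i; apply: measurable_funM => //.
    by apply: (Fsmeas_measurable uF (mesh_ge0 i.+1)); exact: DY_smeas.
  move=> w; rewrite ger0_norm//; apply: ler_sum => i _.
  by case: ifP => [/andP[_ si]|_]; [have [_] := asboolP _ si|exact: ltW].
have sl := leave_stopping.
have sq i j := ito_incr_cond_sq uF bW iI mH cH sl (mesh_ge0 i) (mesh_lt i) B0 (hB i) j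
  (@h_smeas i) (h_bound i).
have mn i j := ito_incr_cond_mean uF bW iI mH cH sl (mesh_ge0 i) (mesh_lt i) B0 (hB i) j
  (@kg_smeas i j) (kg_bound i j).
pose sqs i w := \sum_j h i w * ito_incr I leave (mesh i) (mesh i.+1) j w ^+ 2.
pose mns i w := \sum_j kg i j w * ito_incr I leave (mesh i) (mesh i.+1) j w.
have Isqs i : rint P (sqs i) by apply: rint_sum => j _; case: (sq i j).
have Imns i : rint P (mns i) by apply: rint_sum => j _; case: (mn i j).
have ebound : path_bound = fun w => 3 * L + L * Cb * (t - q) +
    (\sum_(i < N.+1) ((4 + L) * sqs i w + 4 * Cb ^+ 2 * m * h i w) +
     -1 * \sum_(i < N.+1) mns i w).
  apply/funext => w; rewrite /path_bound mulN1r addrA; congr (_ + _ - _); apply: eq_bigr => i _.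
  by rewrite /sqs -mulr_sumr; ring.
have I1 i : rint P (fun w => (4 + L) * sqs i w + 4 * Cb ^+ 2 * m * h i w).
  by apply: rintD; exact: rintZ.
have I1s : rint P (fun w => \sum_(i < N.+1) ((4 + L) * sqs i w + 4 * Cb ^+ 2 * m * h i w)).
  by apply: rint_sum.
have I2s : rint P (fun w => \sum_(i < N.+1) mns i w) by apply: rint_sum.
have I2s' := rintZ (-1) I2s.
have Ibound : rint P path_bound.
  by rewrite ebound; apply: rintD; [exact: rint_cst|exact: rintD].
split=> //; rewrite -ExZ//.
apply: (@le_trans _ _ (Ex P path_bound)).
  apply: Ex_ae => //; first exact: rintZ.
  by apply: filterS gp => w; exact: pointwise.
rewrite ebound ExD ?Ex_cst//; [|exact: rint_cst|exact: rintD].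
rewrite ExD// ExZ// lerD2l.
have -> : Ex P (fun w => \sum_(i < N.+1) mns i w) = 0.
  rewrite Ex_sum// big1// => i _; rewrite /mns Ex_sum; last by move=> j _; case: (mn i j).
  by rewrite big1// => j _; case: (mn i j).
rewrite mulr0 addr0 Ex_sum//.
apply: (@le_trans _ _ (\sum_(i < N.+1)
    ((4 + L) * (J%:R * (16 * K%:R * B)) + 4 * Cb ^+ 2) * (Ex P (h i) * m))); last first.
  rewrite -mulr_sumr ler_wpM2l ?h_sum// addr_ge0//; last by rewrite mulr_ge0// sqr_ge0.
  by rewrite !mulr_ge0// addr_ge0.
apply: ler_sum => i _; rewrite ExD ?ExZ//; [|exact: rintZ|exact: rintZ].
rewrite [leRHS]mulrDl; apply: lerD; last by rewrite le_eqVlt; apply/orP; left; apply/eqP; ring.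
rewrite -!mulrA ler_wpM2l// ?addr_ge0//.
rewrite /sqs Ex_sum; last by move=> j _; case: (sq i j).
rewrite (_ : J%:R * (16 * (K%:R * (B * (Ex P (h i) * m)))) =
  \sum_(j < J) 16 * (K%:R * (B * (Ex P (h i) * m)))); last first.
  by rewrite sumr_const card_ord -[RHS]mulr_natl.
apply: ler_sum => j _; have [_ hsq] := sq i j; apply: le_trans hsq _.
rewrite -!mulrA; do 3 apply: ler_wpM2l => //.
rewrite mulrC -ExZ//.
have hd w : 0 <= h i w * (tmin (mesh i.+1) (leave w) - tmin (mesh i) (leave w)) <= m * h i w.
  have /andP[h1 _] := h_bound i w; have := tmin_diff_bound sl (mesh_lt i) w.
  rewrite mesh_diff => /andP[h2 h3]; rewrite mulr_ge0//= mulrC ler_wpM2r//.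
apply: Ex_le => [|| w]; [|exact: rintZ|by case/andP: (hd w)].
apply: (rint_le _ _ (rintZ m (h_rint i))); last first.
  by move=> w; have /andP[h1 h2] := hd w; rewrite ger0_norm.
apply: measurable_funM; first exact: (Fsmeas_measurable uF (mesh_ge0 i)).
apply: measurable_funB.
  by apply: (Fsmeas_measurable uF (mesh_ge0 i.+1)); exact: (smeas_tmin uF sl).
by apply: (Fsmeas_measurable uF (mesh_ge0 i)); exact: (smeas_tmin uF sl).
Qed.

End OneGrid.
Hypothesis cY : \forall w \ae P, pcont (Y ^~ w).
Hypothesis steps : forall k, 0 < k -> exists e, [/\ 0 < e, step_bound G d g L theta r beta e k &
  forall x y, shell G d r k x -> enorm (y - x) <= e ->
    [/\ 0 < vdist V y, vdist V y <= 2 * vdist V x & vdist V y < r]].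

(** Each point of the partition [p] is moved to the last grid point before it, which
    changes the increments of [y] little; grid increments then refine those between
    the moved points. *)
Lemma grid_variation (y : R -> 'cV[R]_J) (u eps : R) (p : nat -> R) l : pcont y -> 0 < eps ->
  q <= u <= t -> (forall j, p j <= p j.+1) -> (forall j, q <= p j <= u) ->
  exists2 c : R, 0 < c & forall N, (t - q) / N.+1%:R < c -> exists2 n, (n <= N.+1)%N &
    mesh N n <= u /\
    \sum_(j < l) enorm (y (p j.+1) - y (p j)) - eps <=
    \sum_(i < n) enorm (y (mesh N i.+1) - y (mesh N i)).
Proof.
move=> cy eps0 /andP[qu ut] pm pb.
have e'0 : 0 < eps / (2 * (l%:R + 1)) by rewrite divr_gt0// mulr_gt0// ltr_wpDl.
have [c1 c10 h1] := enorm_small J e'0.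
have [c c0 hc] := pcont_unif t cy c10.
exists c => // N mc; set m := (t - q) / N.+1%:R in mc.
have m0 : 0 < m by rewrite divr_gt0// subr_gt0.
pose ka x := Num.truncn ((x - q) / m).
have kaP x : q <= x -> mesh N (ka x) <= x < mesh N (ka x) + m.
  move=> qx; have x0 : 0 <= (x - q) / m by rewrite divr_ge0 ?subr_ge0// ltW.
  have /andP[h2 h3] := truncn_itv x0.
  rewrite /mesh -/m; apply/andP; split.
    by rewrite -lerBrDl -ler_pdivlMr.
  by move: h3; rewrite ltr_pdivrMr// -natr1 mulrDl mul1r ltrBlDl addrA.
have mle i j : (i <= j)%N -> mesh N i <= mesh N j.
  by move=> ij; rewrite /mesh lerD2l ler_wpM2r ?ler_nat// ltW.
have mlt i j : mesh N i < mesh N j -> (i < j)%N.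
  by move=> h2; rewrite ltnNge; apply/negP => /mle; rewrite leNgt h2.
have kam j : (ka (p j) <= ka (p j.+1))%N.
  have /andP[qp _] := pb j; have /andP[h2 _] := kaP _ qp.
  have /andP[qp' _] := pb j.+1; have /andP[_ h3] := kaP _ qp'.
  rewrite -ltnS; apply: mlt; apply: le_lt_trans h2 _; apply: le_lt_trans (pm j) _.
  have -> // : mesh N (ka (p j.+1)).+1 = mesh N (ka (p j.+1)) + m.
  by rewrite /mesh -/m -natr1 mulrDl mul1r addrA.
have /andP[qpl plu] := pb l; have /andP[kl1 _] := kaP _ qpl.
exists (ka (p l)).
  rewrite -ltnS; apply: mlt; apply: le_lt_trans kl1 _; apply: le_lt_trans plu _.
  apply: le_lt_trans ut _; rewrite /mesh -/m -natr1 mulrDl mul1r.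
  have -> : N.+1%:R * m = t - q by rewrite mulrC /m divfK ?pnatr_eq0.
  by rewrite addrA [q + _]addrC subrK ltrDl.
split; first exact: le_trans kl1 plu.
have close j : enorm (y (p j) - y (mesh N (ka (p j)))) < eps / (2 * (l%:R + 1)).
  have /andP[qp pu] := pb j; have /andP[h2 h3] := kaP _ qp.
  apply: h1; apply: hc.
  - exact: le_trans qp.
  - rewrite (le_trans h2 (le_trans pu ut)) andbT /mesh addr_ge0// mulr_ge0//.
    exact: ltW.
  - rewrite ger0_norm ?subr_ge0//; apply: lt_trans mc; rewrite ltrBlDl//.
pose D i := enorm (y (mesh N i.+1) - y (mesh N i)).
have D0 i : 0 <= D i := enorm_ge0 _.
have tri a n : enorm (y (mesh N (a + n)) - y (mesh N a)) <= \sum_(a <= i < a + n) D i.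
  elim: n => [|n IH]; first by rewrite addn0 subrr enorm0 big_geq.
  rewrite addnS big_nat_recr ?leq_addr//= -{1}(subrK (y (mesh N (a + n))) (y _)) -addrA addrC.
  by apply: le_trans (enormD _ _) (lerD IH (lexx _)).
have step j : enorm (y (p j.+1) - y (p j)) - eps / (l%:R + 1) <=
    \sum_(ka (p j) <= i < ka (p j.+1)) D i.
  have := tri (ka (p j)) (ka (p j.+1) - ka (p j))%N; rewrite subnKC// => h2.
  apply: le_trans h2; rewrite lerBlDr.
  have -> : y (p j.+1) - y (p j) = (y (mesh N (ka (p j.+1))) - y (mesh N (ka (p j)))) +
      ((y (p j.+1) - y (mesh N (ka (p j.+1)))) + (y (mesh N (ka (p j))) - y (p j))).
    by apply/matrixP => a b'; rewrite !mxE; ring.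
  apply: le_trans (enormD _ _) _; rewrite lerD2l.
  apply: le_trans (enormD _ _) _; rewrite [X in _ + X]enormBC.
  have -> : eps / (l%:R + 1) = eps / (2 * (l%:R + 1)) + eps / (2 * (l%:R + 1)).
    by field; rewrite gt_eqF// ltr_wpDl.
  by apply: lerD; exact: ltW.
have tot n : \sum_(j < n) \sum_(ka (p j) <= i < ka (p j.+1)) D i = \sum_(ka (p 0%N) <= i < ka (p n)) D i.
  elim: n => [|n IH]; first by rewrite big_ord0 big_geq.
  rewrite big_ord_recr /= IH -big_cat_nat//.
  by elim: n {IH} => // n IH; exact: leq_trans IH (kam n).
apply: (@le_trans _ _ (\sum_(ka (p 0%N) <= i < ka (p l)) D i)); last first.
  rewrite -(big_mkord xpredT D) (@big_cat_nat _ _ _ (ka (p 0%N)) 0 (ka (p l)))//=; last first.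
    by elim: l {tot close step e'0 h1 c1 c10 hc qpl plu kl1} => // n IH; exact: leq_trans IH (kam n).
  by rewrite lerDr sumr_ge0.
rewrite -tot; apply: le_trans (ler_sum _ (fun j _ => step (j : 'I_l))).
rewrite sumrB lerD2l lerN2 sumr_const card_ord.
have l1 : 0 < l%:R + 1 :> R by rewrite ltr_wpDl.
have -> : eps / (l%:R + 1) *+ l = eps * (l%:R / (l%:R + 1)).
  by rewrite -[LHS]mulr_natr; field; rewrite gt_eqF.
by apply: ler_piMr; [exact: ltW|rewrite ler_pdivrMr// mul1r lerDl].
Qed.

(** The bound [M] is a lower limit, as [k] grows, of lower limits along refined grids; by
    Fatou's lemma it is finite. On a compact stretch of time where the path is near [V]
    without meeting it, the path lies in a shell and moves little during one step: all steps of a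
    fine grid are active and good, so that the grid sees the whole variation, up to
    [eps]. *)
Lemma near_bounded : \forall w \ae P, exists M : R, forall u, q <= u <= t -> (q%:E < tau0 w)%E ->
  (forall v, q <= v <= u -> 0 < vdist V (Z v w) <= r / 2) ->
  forall (p : nat -> R) l, (forall j, p j <= p j.+1) -> (forall j, q <= p j <= u) ->
  \sum_(j < l) enorm (Y (p j.+1) w - Y (p j) w) <= M.
Proof.
have hk (n : nat) : 0 < n.+1%:R :> R by [].
have [e he] := choice (fun n : nat => steps (hk n)).
have hN (n : nat) : exists N0 : nat, forall N, (N0 <= N)%N -> (t - q) / N.+1%:R <= 1 /\
    (1 + 2 * L * (n.+1%:R^-1 `^ beta)^-1) * ((t - q) / N.+1%:R) <= 1.
  pose c := 1 + 2 * L * (n.+1%:R^-1 `^ beta)^-1 : R.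
  have c1 : 1 <= c by rewrite lerDl !mulr_ge0// invr_ge0 powR_ge0.
  have tq : 0 < t - q by rewrite subr_gt0.
  exists (Num.truncn (c * (t - q))).+1 => N hN.
  have h1 : c * (t - q) <= N.+1%:R.
    apply: ltW; apply: lt_le_trans (truncnS_gt _) _; rewrite ler_nat.
    by apply: leq_trans hN _.
  split; last by rewrite mulrA ler_pdivrMr// mul1r.
  rewrite ler_pdivrMr// mul1r; apply: le_trans h1.
  by rewrite ler_peMl// ltW.
have [N0 hN0] := choice hN.
pose nv n N := near_variation n.+1%:R (e n) (N0 n + N).
have nvE n N := near_variation_Ex (hk n) (let: And3 a _ _ := he n in a) (let: And3 _ b _ := he n in b)
  (let: And3 _ _ c := he n in c) (proj1 (hN0 n (N0 n + N)%N (leq_addr _ _)))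
  (proj2 (hN0 n (N0 n + N)%N (leq_addr _ _))).
pose Cs : R := 3 * L + L * (J%:R * B) * (t - q) +
  ((4 + L) * (J%:R * (16 * K%:R * B)) + 4 * (J%:R * B) ^+ 2) *
  (t - q + 1 + 2 * L * (2 `^ beta * C0)).
have CsE n N : Ex P (nv n N) <= 4 / theta * Cs.
  have [_ _ h] := nvE n N; rewrite -ler_pdivrMl ?divr_gt0//.
  by rewrite invf_div; exact: h.
pose f n N w := (nv n N w)%:E.
have mf n N : measurable_fun setT (f n N).
  by have [h _ _] := nvE n N; apply/measurable_EFinP; exact: rint_measurable h.
have f0 n N w : (0 <= f n N w)%E by have [_ h _] := nvE n N; rewrite lee_fin h.
have fE n N : (0 <= N)%N -> (\int[P]_w f n N w <= (4 / theta * Cs)%:E)%E.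
  by move=> _; have [h _ _] := nvE n N; rewrite ExE// lee_fin.
have F1 n := fatou_bound (mf n) (f0 n) (fE n).
pose F2 n w := limn_einf (fun N => f n N w).
have [m2 p2 i2] : [/\ measurable_fun setT (fun w => limn_einf (F2 ^~ w)),
    forall w, (0 <= limn_einf (F2 ^~ w))%E &
    (\int[P]_w limn_einf (F2 ^~ w) <= (4 / theta * Cs)%:E)%E].
  apply: (@fatou_bound _ _ _ P F2 _ 0%N) => [n|n w|n _].
  - by have [h _ _] := F1 n.
  - by have [_ h _] := F1 n; exact: h.
  - by have [_ _ h] := F1 n.
have := ae_finite m2 p2 i2; apply: filterS3 gp cY => w gw cYw [M hM]; exists M.
move=> u qut qtau nearV p l pm pb; have /andP[qu ut] := qut.
have [cZ cb GZ inc hull] := gw.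
rewrite leNgt; apply/negP => big.
set S := \sum_(j < l) _ in big.
pose eps := (S - M) / 2.
have eps0 : 0 < eps by rewrite divr_gt0// subr_gt0.
suff : ((S - eps)%:E <= limn_einf (F2 ^~ w))%E.
  by move=> /le_trans/(_ hM); rewrite lee_fin /eps; lra.
have u0 : 0 <= u := le_trans q0 qu.
have [MZ MZ0 hMZ] := pcont_bounded u cZ.
have [mV mV0 hmV] : exists2 c : R, 0 < c & forall v, q <= v <= u -> c <= vdist V (Z v w).
  have cVZ : pcont (fun s => vdist V (Z s w) : R^o).
    move=> s s0 e' e'0.
    have [c c0 hc] := vdist_cont V0 (Z s w) e'0; have [c' c'0 hc'] := cZ s s0 c c0.
    by exists c' => // v v0 vs; apply: hc; exact: hc'.
  have cw : {within `[q, u], continuous (fun s => vdist V (Z s w))}.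
    have /within_pcont := cVZ; apply: continuous_subspaceW => v.
    by rewrite /= !in_itv /= andbT => /andP[h _]; exact: le_trans h.
  have [c cqu hc] := EVT_min qu cw.
  exists (vdist V (Z c w)).
    by have /andP[] := nearV c (ltac:(by move: cqu; rewrite in_itv)).
  by move=> v vqu; apply: hc; rewrite in_itv.
(* From the index [n0] on, the shell contains the path on [[q, u]]: [mV] bounds its
   distance to [V] from below and [MZ] its norm from above. *)
pose n0 := maxn (Num.truncn ((J * 1)%:R * MZ)).+1 (Num.truncn mV^-1).+1.
have shellZ n v : (n0 <= n)%N -> q <= v <= u -> shell G d r n.+1%:R (Z v w).
  rewrite geq_max => /andP[h1 h2] vqu; have /andP[qv vu] := vqu.
  have v0 : 0 <= v := le_trans q0 qv.
  split.
  - exact: GZ.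
  - apply: le_trans (hmV v vqu); rewrite -[leRHS]invrK lef_pV2 ?posrE ?invr_gt0//.
    apply: ltW; apply: lt_le_trans (truncnS_gt _) _; rewrite ler_nat.
    by apply: leq_trans h2 _.
  - by case/andP: (nearV v vqu).
  - apply: le_trans (enorm_le_norm _) _.
    apply: (@le_trans _ _ ((J * 1)%:R * MZ)).
      by rewrite ler_wpM2l// hMZ// v0.
    apply: ltW; apply: lt_le_trans (truncnS_gt _) _; rewrite ler_nat.
    by apply: leq_trans h1 _.
apply: (@limn_einf_lb _ _ _ n0) => n n0n.
have [en0 _ _] := he n.
have [c1 c10 hc1] := enorm_small J en0.
have [c2 c20 hc2] := pcont_unif t cZ c10.
have [c3 c30 hc3] := pcont_unif t cYw c10.
have [c4 c40 hc4] := grid_variation l cYw eps0 qut pm pb.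
pose c := Num.min c2 (Num.min c3 c4).
have c0 : 0 < c by rewrite !lt_min c20 c30.
apply: (@limn_einf_lb _ _ _ (Num.truncn ((t - q) / c)).+1) => N hNc.
have tq : 0 < t - q by rewrite subr_gt0.
have mc : (t - q) / (N0 n + N).+1%:R < c.
  rewrite ltr_pdivrMr// mulrC -ltr_pdivrMr//.
  apply: lt_le_trans (truncnS_gt _) _; rewrite ler_nat.
  by rewrite ltnS; apply: leq_trans (ltnW hNc) _; exact: leq_addl.
move: mc; rewrite !lt_min => /andP[mc2 /andP[mc3 mc4]].
have [k kN [ku hk']] := hc4 _ mc4.
rewrite lee_fin; apply: le_trans hk' _.
set NN := (N0 n + N)%N in kN ku mc2 mc3 mc4 *.
pose m := (t - q) / NN.+1%:R.
have m0 : 0 < m by rewrite divr_gt0.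
have mS i : mesh NN i.+1 = mesh NN i + m.
  by rewrite /mesh -/m -natr1 mulrDl mul1r addrA.
have mle i j : (i <= j)%N -> mesh NN i <= mesh NN j.
  by move=> ij; rewrite /mesh lerD2l ler_wpM2r ?ler_nat// ltW.
have mq i : q <= mesh NN i by rewrite /mesh lerDl mulr_ge0// -/m ltW.
(* The mesh is below the moduli of continuity of [Z] and [Y] for the size [e n]. *)
have good i : (i < k)%N -> step_good (e n) NN w i.
  move=> ik; have iu : mesh NN i.+1 <= u := le_trans (mle _ _ ik) ku.
  have i0 : 0 <= mesh NN i := le_trans q0 (mq i).
  have it : 0 <= mesh NN i <= t.
    by rewrite i0 (le_trans _ ut)// (le_trans _ iu)// mS lerDl ltW.
  apply/asboolP; split=> [v /andP[iv vi]|].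
    apply: ltW; apply: hc1; apply: hc2 => //; first exact: le_trans iv.
    rewrite ger0_norm ?subr_ge0//; apply: le_lt_trans mc2.
    by rewrite lerBlDl -mS.
  apply: ltW; apply: hc1; apply: hc3 => //; first exact: le_trans q0 (mq _).
  by rewrite mS addrAC subrr add0r gtr0_norm.
have act i : (i <= k)%N -> active n.+1%:R (e n) NN w i.
  elim: i => [_|i IH ik] /=.
    by rewrite qtau; apply/asboolP; apply: shellZ => //; rewrite lexx.
  rewrite IH 1?ltnW// good//=; apply/asboolP; apply: shellZ => //.
  by rewrite mq (le_trans (mle _ _ ik) ku).
have -> : \sum_(i < k) enorm (Y (mesh NN i.+1) w - Y (mesh NN i) w) =
    \sum_(i < k) (if active n.+1%:R (e n) NN w i && step_good (e n) NN w i then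
      enorm (Y (mesh NN i.+1) w - Y (mesh NN i) w) else 0).
  by apply: eq_bigr => i _; rewrite act 1?ltnW// good.
pose D i := if active n.+1%:R (e n) NN w i && step_good (e n) NN w i then
  enorm (Y (mesh NN i.+1) w - Y (mesh NN i) w) else 0.
rewrite /nv /near_variation -!(big_mkord xpredT D) (@big_cat_nat _ _ _ k 0 NN.+1)//=.
by rewrite lerDl sumr_ge0// => i _; rewrite /D; case: ifP => // _; exact: enorm_ge0.
Qed.

End NearEstimate.

(** * Bounded variation of the reflection term *)
Section PathVariation.
Context {R : realType} (n : nat).
Implicit Types (y : R -> 'cV[R]_n) (p : nat -> R).

(** Bounded variation in the Euclidean norm, along monotone sequences rather than
    partitions: endpoints need not be reached and points may repeat, which makes
    restriction and concatenation easy. *)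
Definition bv_on y (a b : R) : Prop := exists M : R, forall p l,
  (forall j, p j <= p j.+1) -> (forall j, a <= p j <= b) ->
  \sum_(j < l) enorm (y (p j.+1) - y (p j)) <= M.

Lemma min_mono (x z b : R) : x <= z -> Num.min x b <= Num.min z b.
Proof. by move=> xz; rewrite le_min !ge_min xz lexx orbT. Qed.

Lemma max_mono (x z b : R) : x <= z -> Num.max x b <= Num.max z b.
Proof. by move=> xz; rewrite ge_max !le_max xz lexx orbT. Qed.

Lemma bv_onW y a b a' b' : a <= a' -> b' <= b -> bv_on y a b -> bv_on y a' b'.
Proof.
move=> aa bb [M hM]; exists M => p l pm pb; apply: hM => // j.
by have /andP[h1 h2] := pb j; rewrite (le_trans aa h1) (le_trans h2).
Qed.

Lemma bv_on_cat y a b c : a <= b -> b <= c -> bv_on y a b -> bv_on y b c -> bv_on y a c.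
Proof.
move=> ab bc [M1 h1] [M2 h2]; exists (M1 + M2) => p l pm pb.
have dec x : y x = y (Num.min x b) + y (Num.max x b) - y b.
  have [xb|bx] := leP x b; first by rewrite addrK.
  by rewrite addrAC subrr add0r.
apply: (@le_trans _ _ (\sum_(j < l) (enorm (y (Num.min (p j.+1) b) - y (Num.min (p j) b)) +
    enorm (y (Num.max (p j.+1) b) - y (Num.max (p j) b))))).
  apply: ler_sum => j _; rewrite (dec (p j.+1)) (dec (p j)).
  apply: le_trans (enormD _ _); rewrite le_eqVlt; apply/orP; left; apply/eqP; congr enorm.
  by apply/matrixP => i k; rewrite !mxE; ring.
rewrite big_split /=; apply: lerD.
  apply: (h1 (fun j => Num.min (p j) b)) => j; first exact: min_mono.
  by have /andP[h3 h4] := pb j; rewrite le_min h3 ab /= ge_min lexx orbT.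
apply: (h2 (fun j => Num.max (p j) b)) => j; first exact: max_mono.
by have /andP[h3 h4] := pb j; rewrite le_max lexx orbT ge_max h4 bc.
Qed.

(** The supremum of the times up to which the variation is bounded cannot be less than
    [t]. *)
Lemma bv_on_local y t : 0 <= t ->
  (forall s, 0 <= s <= t -> exists2 e, 0 < e & bv_on y (Num.max 0 (s - e)) (Num.min (s + e) t)) ->
  bv_on y 0 t.
Proof.
move=> t0 hloc; pose S : set R := [set s | 0 <= s <= t /\ bv_on y 0 s].
have S0 : S 0.
  split; first by rewrite lexx.
  exists 0 => p l pm pb; rewrite big1// => j _.
  have p0 i : p i = 0 by apply/le_anti; rewrite andbC; exact: pb.
  by rewrite !p0 subrr enorm0.
have hS : has_sup S by split; [exists 0|exists t => s [/andP[]]].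
have sup0 : 0 <= sup S by apply: sup_upper_bound.
have supt : sup S <= t by apply: ge_sup => [|s [/andP[]]]; first by exists 0.
have [e e0 he] := hloc (sup S) (ltac:(by rewrite sup0 supt)).
have [s [/andP[s0 st] bs] hs] := sup_adherent e0 hS.
have ss : s <= sup S by apply: sup_upper_bound => //; split => //; rewrite s0.
have : bv_on y 0 (Num.min (sup S + e) t).
  have sm : s <= Num.min (sup S + e) t.
    by rewrite le_min st andbT (le_trans ss)// lerDl ltW.
  apply: (bv_on_cat s0 sm bs); apply: bv_onW he => //.
  by rewrite ge_max s0 ltW.
have [h|h] := leP t (sup S + e) => //.
move=> hb; have : S (sup S + e).
  by split=> //; rewrite (le_trans sup0) ?lerDl ?(ltW e0)//= ltW.
by move=> /(sup_upper_bound hS); rewrite gerDl leNgt e0.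
Qed.

(** The variation is at most [c^-1] times the telescoping sum of the pairings with [q]. *)
Lemma bv_on_cone y a b (q : 'cV[R]_n) (c : R) : 0 < c -> 0 <= a -> pcont y ->
  (forall s t, a <= s -> s < t -> t <= b -> c * enorm (y t - y s) <= edot q (y t - y s)) ->
  bv_on y a b.
Proof.
move=> c0 a0 cy hc; have [M M0 hM] := pcont_bounded b cy.
exists (c^-1 * (enorm q * (2 * ((n * 1)%:R * M)))) => p l pm pb.
rewrite ler_pdivlMl// mulr_sumr.
have ple i : p 0%N <= p i by elim: i => // i IH; exact: le_trans (pm i).
apply: (@le_trans _ _ (\sum_(j < l) (edot q (y (p j.+1)) - edot q (y (p j))))).
  apply: ler_sum => j _; rewrite -edotBr.
  have := pm j; rewrite le_eqVlt => /predU1P[->|h].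
    by rewrite subrr enorm0 mulr0 /edot big1// => i _; rewrite mxE mulr0.
  have /andP[h1 _] := pb j; have /andP[_ h2] := pb j.+1; exact: hc.
rewrite -(big_mkord xpredT (fun j => edot q (y (p j.+1)) - edot q (y (p j)))).
rewrite (telescope_sumr (fun j => edot q (y (p j))))// -edotBr.
apply: le_trans (cauchy_schwarz _ _) _; rewrite ler_wpM2l ?enorm_ge0//.
apply: le_trans (enormD _ _) _; rewrite enormN mulr2n mulrDl mul1r.
have bd i : enorm (y (p i)) <= (n * 1)%:R * M.
  apply: le_trans (enorm_le_norm _) _; rewrite ler_wpM2l// hM//.
  by have /andP[h1 ->] := pb i; rewrite (le_trans a0).
by apply: lerD; exact: bd.
Qed.

(** A partition of [[a, s]] is moved to [[a, u]] with [u < s] close to [s], at a small cost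
    by continuity of [y]. *)
Lemma bv_on_closed y a s M : 0 <= a -> a < s -> pcont y ->
  (forall u, a <= u < s -> forall p l, (forall j, p j <= p j.+1) -> (forall j, a <= p j <= u) ->
    \sum_(j < l) enorm (y (p j.+1) - y (p j)) <= M) -> bv_on y a s.
Proof.
move=> a0 as_ cy h; exists M => p l pm pb.
apply/ler_addgt0Pr => e e0.
have e'0 : 0 < e / (4 * (l%:R + 1)) by rewrite divr_gt0// mulr_gt0// ltr_wpDl.
have [c1 c10 h1] := enorm_small n e'0.
have s0 : 0 <= s := le_trans a0 (ltW as_).
have [c c0 hc] := cy s s0 c1 c10.
pose u := Num.max a (s - c / 2).
have us : u < s by rewrite gt_max as_ /=; lra.
have au : a <= u by rewrite le_max lexx.
pose p' j := Num.min (p j) u.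
have close j : enorm (y (p j) - y (p' j)) <= 2 * (e / (4 * (l%:R + 1))).
  rewrite /p'; have [pu|up] := leP (p j) u.
    by rewrite subrr enorm0 mulr_ge0// ltW.
  have near x : u <= x <= s -> enorm (y x - y s) <= e / (4 * (l%:R + 1)).
    move=> /andP[ux xs]; apply: ltW; apply: h1; apply: hc.
      exact: le_trans (le_trans a0 au) ux.
    rewrite distrC ger0_norm ?subr_ge0//.
    have : s - c / 2 <= u by rewrite le_max lexx orbT.
    lra.
  have /andP[_ ps] := pb j.
  have -> : y (p j) - y u = (y (p j) - y s) - (y u - y s).
    by apply/matrixP => i k; rewrite !mxE; ring.
  apply: le_trans (enormD _ _) _; rewrite enormN mulr2n mulrDl mul1r.
  by apply: lerD; apply: near; rewrite ?lexx ?(ltW us)// (ltW up).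
have aus : a <= u < s by rewrite au.
have p'm j : p' j <= p' j.+1 by exact: min_mono.
have p'b j : a <= p' j <= u.
  by have /andP[h2 h3] := pb j; rewrite le_min h2 au ge_min lexx orbT.
have hp' := h u aus p' l p'm p'b.
apply: (@le_trans _ _ (\sum_(j < l) (enorm (y (p' j.+1) - y (p' j)) + 4 * (e / (4 * (l%:R + 1)))))).
  apply: ler_sum => j _.
  have -> : y (p j.+1) - y (p j) = (y (p' j.+1) - y (p' j)) +
      ((y (p j.+1) - y (p' j.+1)) - (y (p j) - y (p' j))).
    by apply/matrixP => i k; rewrite !mxE; ring.
  apply: le_trans (enormD _ _) _; rewrite lerD2l.
  apply: le_trans (enormD _ _) _; rewrite enormN.
  have := close j; have := close j.+1; lra.
rewrite big_split /=; apply: lerD => //; rewrite sumr_const card_ord.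
have l1 : 0 < l%:R + 1 :> R by rewrite ltr_wpDl.
have -> : 4 * (e / (4 * (l%:R + 1))) *+ l = e * (l%:R / (l%:R + 1)).
  by rewrite -[LHS]mulr_natr; field; rewrite gt_eqF.
by apply: ler_piMr; [exact: ltW|rewrite ler_pdivrMr// mul1r lerDl].
Qed.

End PathVariation.

Section Reflection.
Context {R : realType} (J : nat).
Variables (G : set 'cV[R]_J) (d : 'cV[R]_J -> set 'cV[R]_J).
Hypothesis hE : ESP G d.
Let V := Vset G d.
Variables (z y : R -> 'cV[R]_J) (r : R).
Hypothesis cz : pcont z.
Hypothesis cy : pcont y.
Hypothesis Gz : forall t, 0 <= t -> G (z t).
Hypothesis hull : forall s t, 0 <= s -> s < t ->
  closed_convex_hull (\bigcup_(u in [set u | s < u <= t]) d (z u)) (y t - y s).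
Hypothesis r0 : 0 < r.
Variable t : R.
Hypothesis t0 : 0 <= t.
Hypothesis notV : forall s, 0 <= s < t -> ~ V (z s).
Hypothesis near : V (z t) -> forall q : rat, 0 <= (ratr q : R) < t -> exists M : R,
  forall u : R, ratr q <= u < t ->
  (forall v : R, ratr q <= v <= u -> 0 < vdist V (z v) <= r) ->
  forall (p : nat -> R) l, (forall j, p j <= p j.+1) -> (forall j, ratr q <= p j <= u) ->
  \sum_(j < l) enorm (y (p j.+1) - y (p j)) <= M.

(** The increments of [y] near [s] lie in the cone given by [cone_separation]. *)
Lemma bv_away s : 0 <= s <= t -> ~ V (z s) ->
  exists2 e, 0 < e & bv_on y (Num.max 0 (s - e)) (Num.min (s + e) t).
Proof.
move=> /andP[s0 st] nV; have [p [c [e [c0 e0 h]]]] := cone_separation hE (Gz s0) nV.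
have [e' e'0 he'] := cz s0 e0.
exists (e' / 2); first by rewrite divr_gt0.
apply: (@bv_on_cone _ _ _ _ _ p c) => //; first by rewrite le_max lexx.
move=> a b; rewrite ge_max le_min => /andP[a0 sa] ab /andP[bs bt].
apply: hull_halfspace (ltW c0) _ _ (hull a0 ab) => v [u /andP[au ub] duv].
have u0 : 0 <= u := le_trans a0 (ltW au).
apply: (h (z u)) => //; last exact: Gz.
apply: he' => //; rewrite ltr_norml; apply/andP; split; lra.
Qed.

(** Just before [t] the path is close to [V] and not in it, so that the assumed bound
    applies; it extends to [t] by continuity. *)
Lemma bv_at_hit : V (z t) ->
  exists2 e, 0 < e & bv_on y (Num.max 0 (t - e)) (Num.min (t + e) t).
Proof.
move=> Vt; have V0 : V !=set0 by exists (z t).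
have cV : closed V := Vset_closed hE.
have [t00|tpos] := leP t 0.
  exists 1 => //; exists 0 => p l _ pb; rewrite big1// => j _.
  have p0 i : p i = 0.
    have /andP[] := pb i; rewrite ge_max le_min => /andP[h1 _] /andP[_ h2].
    by apply/le_anti; rewrite h1 (le_trans h2).
  by rewrite !p0 subrr enorm0.
have [c c0 hc] := vdist_cont V0 (z t) r0.
have [e e0 he] := cz t0 c0.
have [q /andP[q1 q2]] : exists q : rat, Num.max 0 (t - e) < (ratr q : R) < t.
  by apply: rat_between; rewrite gt_max tpos ltrBlDr ltrDl.
move: q1; rewrite gt_max => /andP[q0 qe].
have qt : 0 <= (ratr q : R) < t by rewrite (ltW q0).
have [M hM] := near Vt qt.
exists (t - ratr q); first by rewrite subr_gt0.
apply: (@bv_onW _ _ _ (ratr q) t).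
- by rewrite le_max opprB addrCA subrr addr0 lexx orbT.
- by rewrite ge_min lexx orbT.
apply: (bv_on_closed (M := M) (ltW q0) q2 cy) => u qut; apply: hM => // v /andP[qv vu].
have vt : v < t by case/andP: qut => _; apply: le_lt_trans.
have v0 : 0 <= v := le_trans (ltW q0) qv.
rewrite (vdist_gt0 V0 cV); last by apply: notV; rewrite v0.
have vtl : `|v - t| < e by rewrite distrC gtr0_norm ?subr_gt0//; move: qe qv; lra.
have := hc (z v) (he v v0 vtl); rewrite (vdist_eq0 V0 Vt) subr0.
by rewrite (ger0_norm (vdist_ge0 V0 _)) => /ltW.
Qed.

Lemma reflection_bv : bv_on y 0 t.
Proof.
apply: bv_on_local => // s /andP[s0 st].
have [Vs|nVs] := pselect (V (z s)); last by apply: bv_away => //; rewrite s0.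
have est : s = t.
  apply/le_anti; rewrite st leNgt /=; apply/negP => h.
  by apply: (notV _ Vs); rewrite s0.
by rewrite est in Vs *; exact: bv_at_hit.
Qed.

End Reflection.

Section BoundedVariation.
Context {R : realType} (n : nat).

(** The time change [m] stops both the Lipschitz part [beta] and the part [y]; partitions
    are mapped to monotone sequences, possibly with repetitions. *)
Lemma bounded_variation_stopped (y : R -> 'cV[R]_n) (f beta : R -> R) (m : R -> R) (i : 'I_n)
    (c t T : R) :
  (forall s u, 0 <= s -> s <= u -> u <= t -> m s <= m u) -> (forall s, 0 <= s <= t -> 0 <= m s <= T) ->
  0 <= c ->
  (forall s u, 0 <= s -> s <= u -> u <= T -> `|beta u - beta s| <= c * (u - s)) ->
  bv_on y 0 T -> (forall s, 0 <= s <= t -> f s = beta (m s) + y (m s) i ord0) ->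
  bounded_variation 0 t f.
Proof.
move=> mm mb c0 hbeta [M hM] fE; exists (c * T + M) => _ [p [pp /eqP pl] <-].
pose q j := nth t (0 :: p) j.
have qS j : q j <= q j.+1.
  rewrite /q; have [js|sj] := ltnP j (size p).
    by apply: ltW; exact: (pathP t pp).
  move: sj; rewrite leq_eqVlt => /predU1P[<-|sj].
    by rewrite [leRHS]nth_default//= -last_nth pl.
  by rewrite [leLHS]nth_default//= nth_default// ltnW.
have q0 : q 0%N = 0 by [].
have qle a b : (a <= b)%N -> q a <= q b.
  elim: b => [|b IH]; first by rewrite leqn0 => /eqP ->.
  by rewrite leq_eqVlt => /predU1P[->//|/IH h]; exact: le_trans (qS b).
have qt j : 0 <= q j <= t.
  rewrite -{1}q0 qle//=; apply: le_trans (qle _ (j + (size p).+1)%N (leq_addr _ _)) _.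
  by rewrite /q nth_default//= addnS ltnS leq_addl.
rewrite /variation big_mkord.
have mq j : 0 <= m (q j) <= T by exact: mb.
have mqS j : m (q j) <= m (q j.+1).
  by have /andP[h1 _] := qt j; have /andP[_ h2] := qt j.+1; exact: mm.
apply: (@le_trans _ _ (\sum_(j < size p) (c * (m (q j.+1) - m (q j)) + enorm (y (m (q j.+1)) - y (m (q j)))))).
  apply: ler_sum => j _; change (`|f (q j.+1) - f (q j)| <= c * (m (q j.+1) - m (q j)) +
    enorm (y (m (q j.+1)) - y (m (q j)))).
  rewrite (fE _ (qt j.+1)) (fE _ (qt j)).
  have -> : beta (m (q j.+1)) + y (m (q j.+1)) i ord0 - (beta (m (q j)) + y (m (q j)) i ord0) =
    (beta (m (q j.+1)) - beta (m (q j))) + (y (m (q j.+1)) - y (m (q j))) i ord0.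
    by rewrite !mxE; ring.
  apply: le_trans (ler_normD _ _) _; apply: lerD; last exact: entry_le_enorm.
  by have /andP[h1 _] := mq j; have /andP[_ h2] := mq j.+1; exact: hbeta.
rewrite big_split /=; apply: lerD.
  rewrite -mulr_sumr ler_wpM2l//.
  rewrite -(big_mkord xpredT (fun j => m (q j.+1) - m (q j))).
  rewrite (telescope_sumr (fun j => m (q j)))//.
  have /andP[_ h1] := mq (size p); have /andP[h2 _] := mq 0%N.
  by apply: le_trans h1; rewrite gerBl.
exact: (hM (fun j => m (q j))).
Qed.

End BoundedVariation.

(** * The stopped solution *)
Section PathLemmas.
Context {R : realType}.

Lemma pcont_eq (V : normedModType R) (f h : R -> V) : (forall t, 0 <= t -> f t = h t) ->
  pcont h -> pcont f.
Proof.
move=> fh ch t t0 e e0; have [c c0 hc] := ch t t0 e e0; exists c => // s s0 st.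
by rewrite !fh//; exact: hc.
Qed.

Lemma pcont_cV n (f : R -> 'cV[R]_n) : (forall i, pcont (fun t => f t i ord0 : R^o)) -> pcont f.
Proof.
move=> cf t t0 e e0.
have [c c0 hc] : exists2 c, 0 < c & forall i, forall s, 0 <= s -> `|s - t| < c ->
    `|f s i ord0 - f t i ord0| <= e / 2.
  apply: (@uniform_radius R 'I_n (fun i c => forall s, 0 <= s -> `|s - t| < c ->
    `|f s i ord0 - f t i ord0| <= e / 2)).
    by move=> i c c' h cc s s0 st; apply: h => //; exact: lt_le_trans cc.
  move=> i; have [c c0 hc] := cf i t t0 (e / 2) (divr_gt0 e0 (ltr0n _ 2)).
  by exists c => // s s0 st; apply: ltW; exact: hc.
exists c => // s s0 st; apply: mx_norm_lt => // i j; rewrite (ord1 j) !mxE.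
exact: hc.
Qed.

Lemma pcont_lipschitz n (G : set 'cV[R]_n) (f : 'cV[R]_n -> R) (z : R -> 'cV[R]_n) (c : R) :
  (forall x y, G x -> G y -> `|f x - f y| <= c * enorm (x - y)) ->
  (forall t, 0 <= t -> G (z t)) -> pcont z -> pcont (fun t => f (z t) : R^o).
Proof.
move=> hf Gz cz t t0 e e0.
have c0 : 0 < `|c| + 1 by rewrite ltr_wpDl.
have [c1 c10 h1] := enorm_small n (divr_gt0 e0 c0).
have [c2 c20 h2] := cz t t0 c1 c10; exists c2 => // s s0 st.
apply: le_lt_trans (hf _ _ (Gz s s0) (Gz t t0)) _.
have := h1 _ (h2 s s0 st); rewrite ltr_pdivlMr// => h.
apply: le_lt_trans h; rewrite mulrC ler_wpM2l ?enorm_ge0//.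
by rewrite (le_trans (ler_norm c))// lerDl.
Qed.

Lemma tmin_lip (s t : R) (x : \bar R) : (0 <= x)%E -> s <= t -> tmin t x - tmin s x <= t - s.
Proof.
move=> x0 st; have [h|h] := leP s%:E x.
  by rewrite (tminE h) lerD2r; exact: tmin_le.
have tx : (x <= t%:E)%E by apply: le_trans (ltW h) _; rewrite lee_fin.
have -> : tmin t x = tmin s x by apply: EFin_inj; rewrite !tminE_lt// ltW.
by rewrite subrr subr_ge0.
Qed.

Lemma pcont_tmin (V : normedModType R) (f : R -> V) (x : \bar R) : (0 <= x)%E -> pcont f ->
  pcont (fun t => f (tmin t x)).
Proof.
move=> x0 cf t t0 e e0; have [c c0 hc] := cf (tmin t x) (tmin_ge0 t0 x0) e e0.
exists c => // s s0 st; apply: hc; first exact: tmin_ge0.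
apply: le_lt_trans st; have [h|/ltW h] := leP s t.
  rewrite distrC [leRHS]distrC !ger0_norm ?subr_ge0 ?tmin_mono//; exact: tmin_lip.
rewrite !ger0_norm ?subr_ge0 ?tmin_mono//; exact: tmin_lip.
Qed.

Lemma tmin_tmin (t : R) (x y : \bar R) : (0 <= x)%E -> (0 <= y)%E ->
  tmin (tmin t x) y = tmin t (Order.min x y).
Proof.
move=> x0 y0; have [h|/ltW h] := leP t%:E x.
  rewrite (tminE h) /tmin; congr fine; rewrite minA; congr (Order.min _ y).
  by rewrite min_l.
rewrite /tmin; congr fine; rewrite -/(tmin t x) (tminE_lt x0 h).
have [xy|/ltW yx] := leP x y; first by rewrite min_r.
by rewrite min_r// (le_trans yx).
Qed.

Lemma pcont_cadlag (f : R -> R^o) : pcont f ->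
  (forall t, 0 <= t -> f s @[s --> t^'+] --> f t) /\
  (forall t, 0 < t -> cvg (f s @[s --> t^'-])).
Proof.
move=> cf; split=> t t0.
  apply/cvgrPdist_lt => e e0; have [c c0 hc] := cf t t0 e e0.
  near=> s; rewrite distrC; have ts : t < s by near: s; exact: nbhs_right_gt.
  apply: hc; first exact: le_trans (ltW ts).
  rewrite gtr0_norm ?subr_gt0// ltrBlDl; near: s; apply: nbhs_right_lt.
  by rewrite ltrDl.
apply/cvg_ex; exists (f t).
apply/cvgrPdist_lt => e e0; have [c c0 hc] := cf t (ltW t0) e e0.
near=> s; rewrite distrC; have ts : s < t by near: s; exact: nbhs_left_lt.
apply: hc.
  apply: ltW; near: s; exact: nbhs_left_gt.
rewrite distrC gtr0_norm ?subr_gt0// ltrBlDl -ltrBlDr; near: s; apply: nbhs_left_gt.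
by rewrite ltrBlDr ltrDl.
Unshelve. all: by end_near. Qed.

End PathLemmas.

Section TestFunction.
Context {R : realType} (J : nat).
Variables (G : set 'cV[R]_J) (d : 'cV[R]_J -> set 'cV[R]_J) (L rad beta : R).
Hypothesis hE : ESP G d.
Let V := Vset G d.
Hypothesis V0 : V !=set0.
Hypothesis beta0 : 0 < beta.

(** The consequences of the test function condition used along paths: a bounded [g] with
    bounded gradient, and for each shell a step size for which [step_bound] holds. *)
Lemma test_function_steps : test_function_condition G d L rad beta ->
  exists (g : 'cV[R]_J -> R) (O : set 'cV[R]_J) (L' theta r : R),
  [/\ [/\ 0 <= L', 0 < theta, 0 < r & r <= rad],
      [/\ open O, forall x, G x -> ~ V x -> O x,
        forall x, O x -> forall i, {for x, continuous (partial i g)},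
        forall x, G x -> ~ V x -> `|g x| <= L' &
        forall x, G x -> ~ V x -> enorm (grad g x) <= L'] &
      forall k, 0 < k -> exists e, [/\ 0 < e, step_bound G d g L' theta r beta e k &
        forall x y, shell G d r k x -> enorm (y - x) <= e ->
        [/\ 0 < vdist V y, vdist V y <= 2 * vdist V x & vdist V y < r]]].
Proof.
move=> [g [[U [oU DU] smooth] _ [theta [r [theta0 /andP[r0 rrad] _ hth]]] hsup h2]].
have D x : G x -> ~ V x -> (G° `|` Uset G d) x.
  by move=> Gx nV; have [h|h] := ESP_cases Gx; [left|right].
have supL x : G x -> ~ V x -> Num.max `|g x| (enorm (grad g x)) <= L.
  move=> Gx nV; rewrite -lee_fin; apply: le_trans hsup; apply: ereal_sup_ubound.
  by exists x => //; exact: D.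
exists g, U, `|L|, theta, r.
have gL x : G x -> ~ V x -> `|g x| <= `|L|.
  move=> Gx nV; apply: le_trans (ler_norm L); apply: le_trans (supL x Gx nV).
  by rewrite le_max lexx.
have gradL x : G x -> ~ V x -> enorm (grad g x) <= `|L|.
  move=> Gx nV; apply: le_trans (ler_norm L); apply: le_trans (supL x Gx nV).
  by rewrite le_max lexx orbT.
have GU x : G x -> ~ V x -> U x by move=> Gx nV; apply: DU; exact: D.
have cdg x : U x -> forall i, {for x, continuous (partial i g)}.
  by move=> Ux i; have [_ h _] := smooth x Ux; case: (h i).
have dg x : U x -> forall i, derivable g x (delta_mx i ord0).
  by move=> Ux i; have [_ h _] := smooth x Ux; case: (h i).
have ddg x : U x -> forall i j, derivable (partial j g) x (delta_mx i ord0).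
  by move=> Ux i j; have [_ _ h] := smooth x Ux; case: (h i j).
have cddg x : U x -> forall i j, {for x, continuous (partial i (partial j g))}.
  by move=> Ux i j; have [_ _ h] := smooth x Ux; case: (h i j).
have g2 x : G x -> ~ V x ->
    \sum_i \sum_j `|partial i (partial j g) x| <= 2 * `|L| * (vdist V x `^ beta)^-1.
  move=> Gx nV; have v0 : 0 < vdist V x by apply: vdist_gt0 => //; exact: Vset_closed.
  have := h2 x (D x Gx nV); rewrite -/V (set_distE V0) poweR_EFin inver gt_eqF ?powR_gt0//.
  rewrite -EFinM lee_fin => h.
  have h' : L * (vdist V x `^ beta)^-1 <= `|L| * (vdist V x `^ beta)^-1.
    by rewrite ler_wpM2r ?ler_norm// invr_ge0 powR_ge0.
  by rewrite -mulrA; lra.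
have gth x v : bdry G x -> ~ V x -> vdist V x <= r -> d1 d x v -> theta <= edot (grad g x) v.
  by move=> bx nV vr; apply: hth; split; [split|rewrite /nbhd /= -/V (set_distE V0) lee_fin].
split=> //; first by split=> //; exact: ltW.
move=> k k0.
have [e1 e10 h1] := near_step hE V0 (normr_ge0 L) theta0 r0 beta0 oU GU dg cdg ddg cddg gradL g2 gth k0.
have [e2 e20 h2'] := shell_near V0 r0 k0.
exists (Num.min e1 e2); split.
- by rewrite lt_min e10.
- move=> x x' db dI dY A sx Gx' + + eqx hA hull; rewrite !le_min => /andP[xe _] /andP[ye _].
  apply: (h1 x x' db dI dY A) => // v Av; have [u [Gu + duv]] := hA v Av.
  by rewrite le_min => /andP[ue _]; exists u.
- by move=> x y sx; rewrite le_min => /andP[_ ye]; exact: h2'.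
Qed.

End TestFunction.

Section Coefficients.
Context {R : realType} (J K : nat).
Variables (G : set 'cV[R]_J) (b : 'cV[R]_J -> 'cV[R]_J) (sigma : 'cV[R]_J -> 'M[R]_(J, K)).

(** The squared norm of [sigma x] is the trace of the diffusion matrix. *)
Lemma sigma_sqr x : enorm (sigma x) ^+ 2 <= \sum_i \sum_j `|diffusion_matrix sigma x i j|.
Proof.
rewrite enorm_sqr; apply: ler_sum => i _; rewrite (bigD1 i)//=.
have -> : \sum_j sigma x i j ^+ 2 = diffusion_matrix sigma x i i.
  by rewrite /diffusion_matrix mxE; apply: eq_bigr => j _; rewrite mxE expr2.
by rewrite -[leLHS]addr0 lerD ?ler_norm// sumr_ge0.
Qed.

Lemma coefficients_bound (N : set 'cV[R]_J) :
  (ereal_sup [set (Num.max (\sum_i \sum_j `|diffusion_matrix sigma x i j|) (enorm (b x)))%:E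
     | x in N `&` G] < +oo)%E ->
  exists B : R, [/\ 0 <= B, forall x, G x -> N x -> enorm (b x) <= B &
    forall x, G x -> N x -> enorm (sigma x) ^+ 2 <= B].
Proof.
set s := ereal_sup _ => sy; exists `|fine s|.
have h x : G x -> N x ->
    Num.max (\sum_i \sum_j `|diffusion_matrix sigma x i j|) (enorm (b x)) <= `|fine s|.
  move=> Gx Nx; set y := Num.max _ _.
  have ys : (y%:E <= s)%E by apply: ereal_sup_ubound; exists x.
  apply: le_trans (ler_norm _); rewrite -lee_fin fineK//.
  by rewrite fin_real// (lt_le_trans _ ys) ?ltNyr.
split=> // x Gx Nx; have := h x Gx Nx; rewrite ge_max => /andP[h1 h2] //.
exact: le_trans (sigma_sqr x) h1.
Qed.

End Coefficients.

Section StoppedSolution.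
Context {R : realType} {disp : measure_display} {Omega : measurableType disp}.
Variables (P : probability Omega R) (F : R -> set (set Omega)).
Hypothesis uF : usual_filtration P F.
Variables (J K : nat) (W : R -> Omega -> 'cV[R]_K).
Hypothesis bW : brownian_motion P F W.
Variables (G : set 'cV[R]_J) (d : 'cV[R]_J -> set 'cV[R]_J).
Hypothesis hE : ESP G d.
Let V := Vset G d.
Variables (b : 'cV[R]_J -> 'cV[R]_J) (sigma : 'cV[R]_J -> 'M[R]_(J, K)) (Lt : R).
Hypothesis lip : forall x y, G x -> G y ->
  enorm (sigma x - sigma y) + enorm (b x - b y) <= Lt * enorm (x - y).
Variables (Z I Y : R -> Omega -> 'cV[R]_J).
Hypothesis aZ : adapted F Z.
Hypothesis cZ : continuous_paths P Z.
Hypothesis iI : ito_integral P F W (fun s w => sigma (Z s w)) I.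
Hypothesis eqZ : \forall w \ae P, forall t, 0 <= t ->
  [/\ G (Z t w),
      Z t w = Z 0 w + \col_i drift (fun s => b (Z s w) i ord0) t + I t w + Y t w &
      forall s, 0 <= s -> s < t ->
        closed_convex_hull (\bigcup_(u in [set u | s < u <= t]) d (Z u w)) (Y t w - Y s w)].

Let aZi t i : 0 <= t -> smeas (F t) (fun w => Z t w i ord0).
Proof. by move=> t0; apply/(smeasP (filtration_sigma uF t0)) => B mB; exact: aZ. Qed.

Let aIi t i : 0 <= t -> smeas (F t) (fun w => I t w i ord0).
Proof.
by move=> t0; apply/(smeasP (filtration_sigma uF t0)) => B mB; case: iI => h _ _; exact: h.
Qed.

Let cI : \forall w \ae P, pcont (I ^~ w).
Proof. by case: iI => _ + _; apply: filterS => w /within_pcont. Qed.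

Let cZ' : \forall w \ae P, pcont (Z ^~ w).
Proof. by apply: filterS cZ => w /within_pcont. Qed.

Let GZ : \forall w \ae P, forall t, 0 <= t -> G (Z t w).
Proof. by apply: filterS eqZ => w h t t0; case: (h t t0). Qed.

Let lip_b x y i : G x -> G y -> `|b x i ord0 - b y i ord0| <= Lt * enorm (x - y).
Proof.
move=> Gx Gy; apply: le_trans (lip Gx Gy); rewrite -[leLHS]add0r lerD ?enorm_ge0//.
by have := entry_le_enorm (b x - b y) i ord0; rewrite !mxE.
Qed.

Let lip_sigma x y i j : G x -> G y -> `|sigma x i j - sigma y i j| <= Lt * enorm (x - y).
Proof.
move=> Gx Gy; apply: le_trans (lip Gx Gy); rewrite -[leLHS]addr0 lerD ?enorm_ge0//.
by have := entry_le_enorm (sigma x - sigma y) i j; rewrite !mxE.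
Qed.

(** The coefficients are continuous on [G] only, so they are made to vanish outside [G];
    the path never leaves [G]. *)
Let coef_smeas (f : 'cV[R]_J -> R) t : 0 <= t ->
  (forall x y, G x -> G y -> `|f x - f y| <= Lt * enorm (x - y)) ->
  smeas (F t) (fun w => f (Z t w)).
Proof.
move=> t0 hf; have sF := filtration_sigma uF t0.
apply: (smeas_ae sF (filtration_null uF t0) (g := fun w => \1_G (Z t w) * f (Z t w))).
  apply: (smeas_within sF) => [i||x Gx e e0]; first exact: aZi.
    by apply: (smeas_closed sF); [move=> i; exact: aZi|exact: ESP_closed hE].
  have c0 : 0 < `|Lt| + 1 by rewrite ltr_wpDl.
  have [c1 c10 h1] := enorm_small J (divr_gt0 e0 c0); exists c1 => // y Gy /h1.
  rewrite ltr_pdivlMr// => h; apply: le_lt_trans (hf _ _ Gy Gx) _.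
  apply: le_lt_trans h; rewrite mulrC ler_wpM2l ?enorm_ge0//.
  by rewrite (le_trans (ler_norm Lt))// lerDl.
by apply: filterS GZ => w h; rewrite indicE mem_set ?mul1r//; exact: h.
Qed.

Let mH t i j : 0 <= t -> measurable_fun setT (fun w => sigma (Z t w) i j).
Proof.
move=> t0; apply: (Fsmeas_measurable uF t0).
by apply: (@coef_smeas (fun x => sigma x i j)) => // x y; exact: lip_sigma.
Qed.

Let cH : \forall w \ae P, forall i j, pcont (fun t => sigma (Z t w) i j : R^o).
Proof.
apply: filterS2 GZ cZ' => w Gw cw i j.
by apply: (@pcont_lipschitz _ _ G (fun x => sigma x i j) _ Lt) => // x y; exact: lip_sigma.
Qed.

Let cb : \forall w \ae P, forall i, pcont (fun t => b (Z t w) i ord0 : R^o).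
Proof.
apply: filterS2 GZ cZ' => w Gw cw i.
by apply: (@pcont_lipschitz _ _ G (fun x => b x i ord0) _ Lt) => // x y; exact: lip_b.
Qed.

Let D t w i : R := drift (fun s => b (Z s w) i ord0) t.

Let aD t i : 0 <= t -> smeas (F t) (fun w => D t w i).
Proof.
move=> t0; apply: (@drift_smeas _ _ _ P _ (filtration_sigma uF t0) (filtration_null uF t0)
  (fun s w => b (Z s w) i ord0)) => //.
  move=> s /andP[s0 st]; apply: (Fsmeas_le uF s0 st).
  by apply: (@coef_smeas (fun x => b x i ord0)) => // x y; exact: lip_b.
by apply: filterS cb => w; exact.
Qed.

Let YE w : (forall t, 0 <= t ->
    Z t w = Z 0 w + \col_i drift (fun s => b (Z s w) i ord0) t + I t w + Y t w) ->
  forall t i, 0 <= t ->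
  Y t w i ord0 = Z t w i ord0 - Z 0 w i ord0 - D t w i - I t w i ord0.
Proof. by move=> h t i t0; rewrite (h t t0) !mxE /D; ring. Qed.

Let aY t i : 0 <= t -> smeas (F t) (fun w => Y t w i ord0).
Proof.
move=> t0; have sF := filtration_sigma uF t0.
apply: (smeas_ae sF (filtration_null uF t0)
  (g := fun w => Z t w i ord0 - Z 0 w i ord0 - D t w i - I t w i ord0)).
  apply: smeasB; last exact: aIi.
  apply: smeasB; last exact: aD.
  by apply: smeasB; [exact: aZi|apply: (Fsmeas_le uF (lexx 0) t0); exact: aZi].
by apply: filterS eqZ => w h; apply: YE => // s s0; case: (h s s0).
Qed.

Let cY : \forall w \ae P, pcont (Y ^~ w).
Proof.
apply: filterS3 (filterI cZ' cI) cb eqZ => w [cZw cIw] cbw h; apply: pcont_cV => i.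
apply: (@pcont_eq _ R^o _ (fun t => Z t w i ord0 - Z 0 w i ord0 - D t w i - I t w i ord0)).
  by move=> t t0; apply: YE => // s s0; case: (h s s0).
apply: pcontB; last exact: pcont_entry.
apply: pcontB; last exact: pcont_drift.
by apply: pcontB; [exact: pcont_entry|exact: pcont_cst].
Qed.

Let gp : \forall w \ae P, good_path G d b Z I Y w.
Proof.
apply: filterS3 cZ' cb eqZ => w cZw cbw h; split=> //.
- by move=> t t0; case: (h t t0).
- move=> s t s0 st; have t0 := le_trans s0 (ltW st).
  have [_ -> _] := h t t0; have [_ -> _] := h s s0.
  by apply/matrixP => i j; rewrite !mxE; ring.
- by move=> s t s0 st; have [_ _ hh] := h t (le_trans s0 (ltW st)); exact: hh.
Qed.

Let tau0 : Omega -> \bar R := hitting_time V Z.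

(** [tau0] is the first time at which the distance to [V] is nonpositive. *)
Let stau : stopping_time F tau0.
Proof.
have [V0|V0] := pselect (V !=set0); last first.
  have -> : tau0 = fun=> +oo%E.
    apply/funext => w; rewrite /tau0 /hitting_time (_ : [set _ | _ in _] = set0) ?ereal_inf0//.
    by apply/seteqP; split=> // x [t [_ Vt] _]; apply: V0; exists (Z t w).
  split=> // t t0; have -> : [set w : Omega | (+oo <= t%:E)%E] = set0.
    by rewrite -subset0 => w /=; rewrite leye_eq.
  by rewrite -[set0]setCT; apply: (subsigmaC (filtration_sigma uF t0)); exact: subsigmaT (filtration_sigma uF t0).
have -> : tau0 = first_time 0 (fun t w => vdist V (Z t w)).
  apply/funext => w; rewrite /tau0 /hitting_time /first_time; congr (ereal_inf (image _ _)).
  apply/seteqP; split=> t /= [t0 h]; split=> //; first by rewrite vdist_eq0.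
  apply: contrapT => nV; have := vdist_gt0 V0 (Vset_closed hE) nV.
  by rewrite ltNge h.
apply: (first_time_stopping uF (lexx 0)) => [t t0|].
  apply: (smeas_continuous (filtration_sigma uF t0)) => [i|x e e0]; first exact: aZi.
  exact: vdist_cont.
apply: filterS cZ' => w cw s s0 e e0.
have [c c0 hc] := vdist_cont V0 (Z s w) e0; have [c' c'0 hc'] := cw s s0 c c0.
by exists c' => // u u0 us; apply: hc; exact: hc'.
Qed.

Variables (L rad beta : R).
Hypothesis beta0 : 0 < beta.
Hypothesis test : test_function_condition G d L rad beta.
Hypothesis bounded_coefficients :
  (ereal_sup [set (Num.max (\sum_i \sum_j `|diffusion_matrix sigma x i j|) (enorm (b x)))%:E
     | x in nbhd rad V `&` G] < +oo)%E.
Hypothesis weight_finite : forall t : R, 0 <= t ->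
  (\int[P]_w \int[lebesgue_measure]_(s in `[0%R, tmin t (tau0 w)])
     singular_weight rad beta (set_dist (Z s w) V) < +oo)%E.

Let near_V : exists2 rv : R, 0 < rv & V !=set0 -> forall q t, 0 <= q -> q < t ->
  \forall w \ae P, exists M : R, forall u, q <= u <= t -> (q%:E < tau0 w)%E ->
  (forall v, q <= v <= u -> 0 < vdist V (Z v w) <= rv) ->
  forall (p : nat -> R) l, (forall j, p j <= p j.+1) -> (forall j, q <= p j <= u) ->
  \sum_(j < l) enorm (Y (p j.+1) w - Y (p j) w) <= M.
Proof.
have [V0|V0] := pselect (V !=set0); last by exists 1 => // /V0.
have [g [U [L' [theta [r [[L0 theta0 r0 rrad] [oU GU cdg gL gradL] steps]]]]]] :=
  test_function_steps hE V0 beta0 test.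
have [B [B0 bB sigmaB]] := coefficients_bound bounded_coefficients.
have nV x : vdist V x <= rad -> nbhd rad V x by rewrite /nbhd /= (set_distE V0) lee_fin.
exists (r / 2) => [|_ q t q0 qt]; first by rewrite divr_gt0.
have t0 : 0 <= t := le_trans q0 (ltW qt).
set w0 := (\int[P]_w \int[lebesgue_measure]_(s in `[0%R, tmin t (tau0 w)])
     singular_weight rad beta (set_dist (Z s w) V))%E.
have hC0 : (w0 <= (fine w0)%:E)%E.
  rewrite fineK// ge0_fin_numE; first exact: (weight_finite t0).
  apply: integral_ge0 => w _; apply: integral_ge0 => s _; rewrite /singular_weight.
  by case: ifP => // _; rewrite inve_ge0 poweR_ge0.
apply: (near_bounded uF bW hE V0 L0 theta0 rrad beta0 oU GU cdg gL gradL B0 _ _ aZi aY iI mH cH gp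
  stau erefl q0 qt hC0 cY steps) => x Gx /nV; [exact: bB|exact: sigmaB].
Qed.

(** For rational starting times and integer horizons the exceptional null sets are
    countably many. *)
Let near_rat : exists2 rv : R, 0 < rv & \forall w \ae P, V !=set0 -> forall (q : rat) (n : nat), 0 <= (ratr q : R) < n%:R ->
  exists M : R, forall u : R, ratr q <= u <= n%:R -> ((ratr q)%:E < tau0 w)%E ->
  (forall v : R, ratr q <= v <= u -> 0 < vdist V (Z v w) <= rv) ->
  forall (p : nat -> R) l, (forall j, p j <= p j.+1) -> (forall j, ratr q <= p j <= u) ->
  \sum_(j < l) enorm (Y (p j.+1) w - Y (p j) w) <= M.
Proof.
have [rv rv0 hV] := near_V; exists rv => //.
have [V0|V0] := pselect (V !=set0); last by apply: aeW => w /V0.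
pose Q (qn : rat * nat) w := 0 <= (ratr qn.1 : R) < qn.2%:R ->
  exists M : R, forall u : R, ratr qn.1 <= u <= qn.2%:R -> ((ratr qn.1)%:E < tau0 w)%E ->
  (forall v : R, ratr qn.1 <= v <= u -> 0 < vdist V (Z v w) <= rv) ->
  forall (p : nat -> R) l, (forall j, p j <= p j.+1) -> (forall j, ratr qn.1 <= p j <= u) ->
  \sum_(j < l) enorm (Y (p j.+1) w - Y (p j) w) <= M.
have hQ m : \forall w \ae P, if unpickle m is Some qn then Q qn w else True.
  case: (unpickle m) => [[q n]|]; last exact: aeW.
  have [/andP[q0 qn]|h] := boolP (0 <= (ratr q : R) < n%:R); last first.
    by apply: aeW => w; rewrite /Q /= (negbTE h).
  by apply: filterS (hV V0 _ _ q0 qn) => w h _.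
apply: filterS (ae_foralln hQ) => w h _ q n qn.
by have := h (pickle (q, n)); rewrite pickleK; exact.
Qed.

Let bvY : \forall w \ae P, forall t, 0 <= t -> bv_on (Y ^~ w) 0 (tmin t (tau0 w)).
Proof.
have [rv rv0 hV] := near_rat; apply: filterS3 gp cY hV => w [cZw cbw Gw inc hull] cYw hn t t0.
have ta0 : (0 <= tau0 w)%E by case: stau.
have T0 : 0 <= tmin t (tau0 w) by exact: tmin_ge0.
apply: (reflection_bv hE cZw cYw Gw hull rv0 T0) => [s /andP[s0 st]|Vt q /andP[q0 qT]].
  move=> Vs; have : ((tmin t (tau0 w))%:E <= s%:E)%E.
    apply: le_trans (tmin_lex t ta0) _; apply: ereal_inf_lbound; exists s => //.
  by rewrite lee_fin leNgt st.
have V0 : V !=set0 by exists (Z (tmin t (tau0 w)) w).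
pose n := (Num.truncn (tmin t (tau0 w))).+1.
have Tn : tmin t (tau0 w) < n%:R by exact: truncnS_gt.
have [|M hM] := hn V0 q n; first by rewrite q0 (lt_trans qT).
exists M => u /andP[qu uT] hv p l pm pb; apply: (hM u) => //.
- by rewrite qu ltW// (lt_trans uT).
- by apply: lt_le_trans (tmin_lex t ta0); rewrite lte_fin.
Qed.

Let tau_ge0 w : (0 <= tau0 w)%E. Proof. by case: stau. Qed.

Let tmin0 (x : \bar R) : (0 <= x)%E -> tmin 0 x = 0.
Proof. by move=> x0; rewrite tminE. Qed.

Let real_adapted_smeas (X : R -> Omega -> R) : (forall t, 0 <= t -> smeas (F t) (X t)) ->
  real_adapted F X.
Proof. by move=> h t t0 B mB; exact: (proj1 (smeasP (filtration_sigma uF t0) _) (h t t0)). Qed.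

Let stopped_coord (X : R -> Omega -> 'cV[R]_J) (rho : Omega -> \bar R) i t :
  stopping_time F rho -> (forall s j, 0 <= s -> smeas (F s) (fun w => X s w j ord0)) ->
  (\forall w \ae P, pcont (X ^~ w)) -> 0 <= t ->
  smeas (F t) (fun w => X (tmin t (rho w)) w i ord0).
Proof.
move=> sr aX cX t0; apply: (@stopped_smeas _ _ _ P F uF rho sr (fun s w => X s w i ord0)) => //.
  by move=> s s0; exact: aX.
by apply: filterS cX => w; exact: pcont_entry.
Qed.

(** The exit times of balls localize the stochastic integral. *)
Let T (k : nat) : Omega -> \bar R := first_time 0 (fun t w => k%:R - enorm (Z t w)).

Let enormZ_pcont : \forall w \ae P, pcont (fun t => enorm (Z t w) : R^o).
Proof. by apply: filterS cZ' => w cw; apply: pcont_enorm => i; exact: pcont_entry. Qed.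

Let sT k : stopping_time F (T k).
Proof.
apply: (first_time_stopping uF (lexx 0)) => [t t0|].
  apply: smeasB; first exact: smeas_cst.
  apply: (smeas_continuous (filtration_sigma uF t0)) => [i|x e e0]; first exact: aZi.
  have [c c0 h] := enorm_small J e0; exists c => // y /h.
  exact: le_lt_trans (enorm_dist _ _).
by apply: filterS enormZ_pcont => w c; apply: pcontB => //; exact: pcont_cst.
Qed.

Let T_mono w k : (T k w <= T k.+1 w)%E.
Proof.
apply: le_ereal_inf => _ [t [t0 h] <-]; exists t => //; split=> //.
by move: h; rewrite !subr_le0; apply: le_trans; rewrite ler_nat.
Qed.

Let T_cvg : \forall w \ae P, T n w @[n --> \oo] --> +oo%E.
Proof.
apply: filterS enormZ_pcont => w cw; apply/cvgeyPge => A.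
have [M _ hM] := pcont_bounded A cw.
exists (Num.truncn M).+1 => // k /= hk; apply: le_ereal_inf_tmp => _ [t [t0 h] <-].
rewrite lee_fin leNgt; apply/negP => tA.
have := hM t (ltac:(by rewrite t0 ltW)); rewrite ger0_norm ?enorm_ge0// => h'.
move: h; rewrite subr_le0 => h; have := le_trans h h'; apply/negP; rewrite -ltNge.
apply: lt_le_trans (truncnS_gt M) _; by rewrite ler_nat.
Qed.

Let sigma_local (z : 'cV[R]_J) : G z -> forall k : nat, exists2 B : R, 0 <= B &
  forall x, G x -> enorm x <= k%:R -> enorm (sigma x) ^+ 2 <= B.
Proof.
move=> Gz k; pose B := \sum_(i < J) \sum_(j < K) (`|Lt| * (k%:R + enorm z) + `|sigma z i j|) ^+ 2.
exists B; first by rewrite sumr_ge0// => i _; rewrite sumr_ge0// => j _; rewrite sqr_ge0.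
move=> x Gx xk; rewrite enorm_sqr; apply: ler_sum => i _; apply: ler_sum => j _.
rewrite -[leLHS]real_normK ?num_real// lerXn2r ?nnegrE//.
  by rewrite addr_ge0// mulr_ge0// addr_ge0// enorm_ge0.
rewrite -{1}(subrK (sigma z i j) (sigma x i j)); apply: le_trans (ler_normD _ _) _.
rewrite lerD2r; apply: le_trans (lip_sigma i j Gx Gz) _.
apply: (@le_trans _ _ (`|Lt| * enorm (x - z))).
  by rewrite ler_wpM2r ?enorm_ge0// ler_norm.
rewrite ler_wpM2l//; apply: le_trans (enormD _ _) _.
by rewrite enormN lerD2r.
Qed.

(** The value at time [0] is subtracted from [I] and goes to the finite variation part. *)
Let M i t w : R := I (tmin t (tau0 w)) w i ord0 - I 0 w i ord0.
Let A i t w : R := Z (tmin t (tau0 w)) w i ord0 - Z (tmin 0 (tau0 w)) w i ord0 - M i t w.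

Let M_smeas i t : 0 <= t -> smeas (F t) (M i t).
Proof.
move=> t0; apply: smeasB; first exact: stopped_coord.
by apply: (Fsmeas_le uF (lexx 0) t0); exact: aIi.
Qed.

Let M_pcont i : \forall w \ae P, pcont (fun t => M i t w : R^o).
Proof.
apply: filterS cI => w cw; apply: pcontB; last exact: pcont_cst.
apply: (@pcont_tmin _ R^o (fun t => I t w i ord0)) => //; exact: pcont_entry.
Qed.

Variable z : 'cV[R]_J.
Hypothesis Gz : G z.

(** Before the exit time of a ball the diffusion coefficient is bounded, so that the
    increments of [I] have conditional mean zero. *)
Let M_martingale i k : martingale P F (stopped (M i) (T k)).
Proof.
pose rho w := Order.min (T k w) (tau0 w).
have srho : stopping_time F rho := stopping_min uF (sT k) stau.
have T0 w : (0 <= T k w)%E by case: (sT k).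
have rho0 w : (0 <= rho w)%E by case: srho.
have XE : stopped (M i) (T k) = fun t => ito_incr I rho 0 t i.
  apply/funext => t; apply/funext => w.
  by rewrite /stopped /M /ito_incr tmin_tmin// (tmin0 (rho0 w)).
have [B B0 hB] := sigma_local Gz k.
have hBr s t : 0 <= s -> \forall w \ae P, forall u, s <= u <= t -> (u%:E < rho w)%E ->
    enorm (sigma (Z u w)) ^+ 2 <= B.
  move=> s0; apply: filterS GZ => w Gw u /andP[su _]; have u0 := le_trans s0 su.
  rewrite lt_min => /andP[uT _]; apply: hB; first exact: Gw.
  by have := first_time_lt u0 uT; rewrite subr_gt0 => /ltW.
have zero w : ito_incr I rho 0 0 i w = 0 by rewrite /ito_incr subrr.
have sm t : 0 <= t -> smeas (F t) (ito_incr I rho 0 t i).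
  move=> t0; apply: smeasB; first exact: stopped_coord.
  by apply: (Fsmeas_le uF (lexx 0) t0); apply: stopped_coord.
have rX t : 0 <= t -> rint P (ito_incr I rho 0 t i).
  rewrite le_eqVlt => /predU1P[<-|t0].
    by apply: eq_rint (rint_cst P 0) _ => w; rewrite zero.
  apply: rint_sq; first by apply: (Fsmeas_measurable uF (ltW t0)); exact: sm (ltW t0).
  exact: (ito_incr_sq uF bW iI mH cH srho (lexx 0) t0 B0 (hBr 0 t (lexx 0)) i).
rewrite XE; split=> [||s t s0 st A0 FA].
- exact: real_adapted_smeas.
- by move=> t t0; exact: rX.
have t0 := le_trans s0 st.
have mA := filtration_set_measurable uF s0 FA.
move: st; rewrite le_eqVlt => /predU1P[->//|st].
rewrite !(Ex_indicM P _ mA) !ExE//; try by apply: rint_indicM => //; exact: rX.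
congr (_%:E); apply/eqP; rewrite -subr_eq0 -ExB; last 2 first.
- by apply: rint_indicM => //; exact: rX.
- by apply: rint_indicM => //; exact: rX.
have [_ [<- _]] := ito_incr_moments uF bW iI mH cH srho s0 st B0 (hBr s t s0) i FA.
apply/eqP; congr Ex; apply/funext => w; rewrite /ito_incr; ring.
Qed.

Let A_pcont i : \forall w \ae P, pcont (fun t => A i t w : R^o).
Proof.
apply: filterS2 cZ' (M_pcont i) => w cw cM; apply: pcontB => //.
apply: pcontB; last exact: pcont_cst.
apply: (@pcont_tmin _ R^o (fun t => Z t w i ord0)) => //; exact: pcont_entry.
Qed.

Let A_smeas i t : 0 <= t -> smeas (F t) (A i t).
Proof.
move=> t0; apply: smeasB; last exact: M_smeas.
apply: smeasB; first exact: stopped_coord.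
by apply: (Fsmeas_le uF (lexx 0) t0); apply: stopped_coord.
Qed.

(** The part of finite variation is the drift plus [Y], both stopped at [tau0]. *)
Let A_bv i : \forall w \ae P, forall t, 0 <= t -> bounded_variation 0 t (fun s => A i s w).
Proof.
apply: filterS3 cb bvY eqZ => w cbw bw h t t0.
have T0 : 0 <= tmin t (tau0 w) by exact: tmin_ge0.
have [c c0 hc] := pcont_bounded (tmin t (tau0 w)) (cbw i).
apply: (@bounded_variation_stopped _ _ (Y ^~ w) _
  (fun s => drift (fun s => b (Z s w) i ord0) s + I 0 w i ord0) (fun s => tmin s (tau0 w)) i c t
  (tmin t (tau0 w))) => //.
- by move=> s u _ su _; exact: tmin_mono.
- by move=> s /andP[s0 st]; rewrite tmin_ge0// tmin_mono.
- move=> s u s0 su uT; rewrite opprD addrACA subrr addr0.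
  by apply: drift_lipschitz => // v /andP[sv vu]; apply: hc; rewrite (le_trans s0 sv) (le_trans vu).
- exact: bw.
move=> s /andP[s0 st]; have m0 := tmin_ge0 s0 (tau_ge0 w).
rewrite /A /M (tmin0 (tau_ge0 w)); have [_ eq _] := h _ m0.
by rewrite [in LHS]eq !mxE; ring.
Qed.

Lemma stopped_solution_semimartingale : semimartingale P F (stopped Z (hitting_time V Z)).
Proof.
move=> i; split.
  by apply: real_adapted_smeas => t t0; exact: stopped_coord.
exists (M i), (A i); split.
- split.
  + by apply: real_adapted_smeas => t t0; exact: M_smeas.
  + by apply: filterS (M_pcont i) => w; exact: pcont_cadlag.
  + by apply: aeW => w; rewrite /M tmin0 ?subrr.
  + exists T; split=> [k||k]; [exact: sT| |exact: M_martingale].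
    by apply: filterS T_cvg => w h; split=> // k; exact: T_mono.
- split.
  + by apply: real_adapted_smeas => t t0; exact: A_smeas.
  + by apply: filterS (A_pcont i) => w; exact: pcont_cadlag.
  + by apply: aeW => w; rewrite /A /M tmin0 ?subrr// subr0 subrr.
  + exact: A_bv.
- by apply: aeW => w t t0; rewrite /stopped /A; ring.
Qed.

End StoppedSolution.

Unset Implicit Arguments.
Theorem theorem5p2 (R : realType) (J K : nat)
    (disp : measure_display) (Omega : measurableType disp)
    (P : probability Omega R) (F : R -> set (set Omega))
    (G : set 'cV[R]_J) (d : 'cV[R]_J -> set 'cV[R]_J)
    (b : 'cV[R]_J -> 'cV[R]_J) (sigma : 'cV[R]_J -> 'M[R]_(J, K))
    (W : R -> Omega -> 'cV[R]_K)
    (L rad beta : R)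
    (Z : 'cV[R]_J -> R -> Omega -> 'cV[R]_J) :
  let a := diffusion_matrix sigma in
  let V := Vset G d in
  let tau0 z := hitting_time V (Z z) in
  usual_filtration P F ->
  ESP G d ->
  lipschitz_coefficients G b sigma ->
  uniformly_elliptic G a ->
  0 < beta ->
  test_function_condition G d L rad beta ->
  (ereal_sup [set (Num.max (\sum_i \sum_j `|a x i j|) (enorm (b x)))%:E
             | x in nbhd rad V `&` G] < +oo)%E ->
  brownian_motion P F W ->
  (forall z, G z ->
     [/\ SDER_strong_solution P F G d b sigma W (Z z),
         strong_markov P F (Z z),
         (\forall w \ae P, Z z 0 w = z) &
         forall t : R, 0 <= t ->
           (\int[P]_w \int[lebesgue_measure]_(s in `[0%R, tmin t (tau0 z w)])
              singular_weight rad beta (set_dist (Z z s w) V) < +oo)%E]) ->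
  forall z, G z -> semimartingale P F (stopped (Z z) (tau0 z)).
Proof.
move=> a V tau0 uF hE [Lt lip] _ beta0 test bounded bW solution z Gz.
have [[aZ cZ [I [Y [iI eqZ]]]] _ _ weight] := solution z Gz.
exact: (stopped_solution_semimartingale uF bW hE lip aZ cZ iI eqZ beta0 test bounded weight Gz).
Qed.
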